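(* Let $C\in\mathcal{H}_{10,11}$ be a general curve and $X=\mathrm{Bl}_C\mathbb{P}^3$. The linear system $|11H-3E|$ on $X$ has dimension $3$.
   Context: The base field is algebraically closed of characteristic $0$. $\mathcal{H}_{10,11}$ is the unique irreducible component of the Hilbert scheme of curves of degree $10$ and genus $11$ in $\mathbb{P}^3$ whose general element is a smooth irreducible arithmetically Cohen-Macaulay curve. $H$ is the pullback to $X$ of the hyperplane class of $\mathbb{P}^3$ and $E$ is the exceptional divisor. *)

(* Defs.v *)
From HB Require Import structures.
From mathcomp Require Import all_boot all_order all_algebra.
From mathcomp.multinomials Require Import mpoly.
Set Implicit Arguments.
Unset Strict Implicit.
Unset Printing Implicit Defensive.
Import GRing.Theory.
Local Open Scope ring_scope.

(* A closed subscheme C of P^3 over an algebraically closed field k is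
   represented by its saturated homogeneous ideal I_C, a subset of the
   homogeneous coordinate ring {mpoly k[4]} of P^3. *)

Definition basis_mod (k : fieldType) (U : lmodType k) (W V : U -> Prop)
    (n : nat) (b : 'I_n -> U) : Prop :=
  (forall i, V (b i)) /\
  (forall v, V v -> exists! c : {ffun 'I_n -> k},
     W (v - \sum_(i < n) c i *: b i)).

Definition dim_mod (k : fieldType) (U : lmodType k) (W V : U -> Prop)
    (n : nat) : Prop :=
  exists b : 'I_n -> U, basis_mod W V b.

Definition is_basis (k : fieldType) (U : lmodType k) (V : U -> Prop)
    (n : nat) (b : 'I_n -> U) : Prop :=
  basis_mod (fun u => u = 0) V b.

Definition has_dim (k : fieldType) (U : lmodType k) (V : U -> Prop)
    (n : nat) : Prop :=
  dim_mod (fun u => u = 0) V n.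

Definition homogeneous_ideal (k : fieldType) (I : {pred {mpoly k[4]}}) : Prop :=
  idealr_closed I /\
  (forall p, p \in I -> forall d, pihomog mdeg d p \in I).

Definition saturated (k : fieldType) (I : {pred {mpoly k[4]}}) : Prop :=
  forall p : {mpoly k[4]},
    (forall i : 'I_4, exists m : nat, 'X_i ^+ m * p \in I) -> p \in I.

(* dim (S / I)_d = e d + 1 - g for d >> 0, where S = k[x_0, ..., x_3]; the
   truncated subtraction is exact for d >> 0 when e > 0. *)
Definition hilbert_polynomial (k : fieldType) (I : {pred {mpoly k[4]}})
    (e g : nat) : Prop :=
  exists d0 : nat, forall d : nat, (d0 <= d)%N ->
    dim_mod (fun p : {mpoly k[4]} => p \in I)
            (fun p => p \is [in k[4], d.-homog]) (e * d + 1 - g)%N.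

Definition hilb (k : fieldType) (e g : nat) (I : {pred {mpoly k[4]}}) : Prop :=
  [/\ homogeneous_ideal I, saturated I & hilbert_polynomial I e g].

(* Pluecker coordinates of the span of b : the maximal minors of the matrix of
   coefficients of b on the monomials of degree at most d, one for each
   sequence of r monomials. *)
Definition plucker_index (r d : nat) : finType :=
  {ffun 'I_r -> 'X_{1..4 < d.+1}}.

Definition plucker (k : fieldType) (r d : nat) (b : 'I_r -> {mpoly k[4]}) :
    'I_#|plucker_index r d| -> k :=
  fun s => \det (\matrix_(i < r, j < r) (b i)@_(bmnm (enum_val s j))).

(* dim S_d - dim (S / I)_d for I in hilb e g and d >> 0 *)
Definition graded_piece_dim (e g d : nat) : nat :=
  ('C(d + 3, 3) - (e * d + 1 - g))%N.

Definition graded_piece (k : fieldType) (I : {pred {mpoly k[4]}}) (d : nat)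
    (p : {mpoly k[4]}) : Prop :=
  p \in I /\ p \is [in k[4], d.-homog].

(* For d at least the Gotzmann number of the Hilbert polynomial, I |-> I_d
   embeds the Hilbert scheme as a closed subscheme of a Grassmannian, and the
   topology is induced from the Pluecker embedding of that Grassmannian. *)
Definition hilb_closed (k : fieldType) (e g : nat)
    (A : {pred {mpoly k[4]}} -> Prop) : Prop :=
  exists d0 : nat, forall d : nat, (d0 <= d)%N ->
    let r := graded_piece_dim e g d in
    exists F : {mpoly k[#|plucker_index r d|]} -> Prop,
      (forall f, F f -> exists m : nat,
         f \is [in k[#|plucker_index r d|], m.-homog]) /\
      (forall I, hilb e g I ->
       forall b : 'I_r -> {mpoly k[4]}, is_basis (graded_piece I d) b ->
         (A I <-> forall f, F f -> f.@[plucker b] = 0)).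

Definition hilb_irreducible (k : fieldType) (e g : nat)
    (Z : {pred {mpoly k[4]}} -> Prop) : Prop :=
  [/\ forall I, Z I -> hilb e g I,
      exists I, Z I &
      forall A B : {pred {mpoly k[4]}} -> Prop,
        hilb_closed e g A -> hilb_closed e g B ->
        (forall I, Z I -> A I \/ B I) ->
        (forall I, Z I -> A I) \/ (forall I, Z I -> B I)].

Definition hilb_component (k : fieldType) (e g : nat)
    (Z : {pred {mpoly k[4]}} -> Prop) : Prop :=
  hilb_irreducible e g Z /\
  (forall Z' : {pred {mpoly k[4]}} -> Prop, hilb_irreducible e g Z' ->
     (forall I, Z I -> Z' I) -> forall I, Z' I -> Z I).

Definition general_element (k : fieldType) (e g : nat)
    (Z Q : {pred {mpoly k[4]}} -> Prop) : Prop :=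
  exists A : {pred {mpoly k[4]}} -> Prop,
    [/\ hilb_closed e g A, exists I, Z I /\ ~ A I &
        forall I, Z I -> ~ A I -> Q I].

Definition gradient (k : fieldType) (f : {mpoly k[4]}) (x : 'rV[k]_4) :
    'rV[k]_4 :=
  \row_(i < 4) (mderiv i f).@[fun j => x 0 j].

(* Jacobian criterion: at each point of the curve (given by homogeneous
   coordinates x), the gradients of the elements of I span a space of
   dimension 2 = codim(C, P^3). *)
Definition smooth_curve (k : fieldType) (I : {pred {mpoly k[4]}}) : Prop :=
  forall x : 'rV[k]_4, x != 0 ->
    (forall f, f \in I -> f.@[fun j => x 0 j] = 0) ->
    exists f1 f2, [/\ f1 \in I, f2 \in I,
      \rank (col_mx (gradient f1 x) (gradient f2 x)) = 2%N &
      forall f, f \in I ->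
        (gradient f x <= col_mx (gradient f1 x) (gradient f2 x))%MS].

(* The homogeneous coordinate ring S / I of a curve has Krull dimension 2, so
   it is Cohen-Macaulay iff it has a regular sequence of length 2 of homogeneous
   elements of positive degree. *)
Definition acm_curve (k : fieldType) (I : {pred {mpoly k[4]}}) : Prop :=
  exists (d1 d2 : nat) (u v : {mpoly k[4]}),
    [/\ (0 < d1)%N /\ u \is [in k[4], d1.-homog],
        (0 < d2)%N /\ v \is [in k[4], d2.-homog],
        forall p, u * p \in I -> p \in I &
        forall p q, v * p - u * q \in I -> exists q', p - u * q' \in I].

Definition smooth_irreducible_acm (k : fieldType) (I : {pred {mpoly k[4]}}) :
    Prop :=
  [/\ prime_idealr_closed I, smooth_curve I & acm_curve I].

(* For (e, g) = (10, 11) there is exactly one such component, H_{10,11}. *)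
Definition acm_component (k : fieldType) (e g : nat)
    (Z : {pred {mpoly k[4]}} -> Prop) : Prop :=
  hilb_component e g Z /\
  general_element e g Z (@smooth_irreducible_acm k).

Definition ratfun (k : fieldType) : Type := {fraction {mpoly k[4]}}.
HB.instance Definition _ (k : fieldType) := GRing.Field.on (ratfun k).

Definition ratfun_scale (k : fieldType) (c : k) (s : ratfun k) : ratfun k :=
  tofrac (c%:MP_[4]) * s.

Fact ratfun_scaleA (k : fieldType) (a b : k) (s : ratfun k) :
  ratfun_scale a (ratfun_scale b s) = ratfun_scale (a * b) s.
Proof. by rewrite /ratfun_scale mulrA -rmorphM -mpolyCM. Qed.

Fact ratfun_scale1 (k : fieldType) : left_id 1 (@ratfun_scale k).
Proof. by move=> s; rewrite /ratfun_scale mpolyC1 rmorph1 mul1r. Qed.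

Fact ratfun_scaleDr (k : fieldType) : right_distributive (@ratfun_scale k) +%R.
Proof. by move=> c s t; rewrite /ratfun_scale mulrDr. Qed.

Fact ratfun_scaleDl (k : fieldType) (s : ratfun k) :
  {morph (@ratfun_scale k)^~ s : a b / a + b}.
Proof. by move=> a b; rewrite /ratfun_scale mpolyCD rmorphD mulrDl. Qed.

HB.instance Definition _ (k : fieldType) :=
  GRing.Zmodule_isLmodule.Build k (ratfun k)
    (@ratfun_scaleA k) (@ratfun_scale1 k) (@ratfun_scaleDr k)
    (@ratfun_scaleDl k).

Fixpoint ideal_pow (k : fieldType) (I : {pred {mpoly k[4]}}) (n : nat) :
    {mpoly k[4]} -> Prop :=
  if n is n'.+1 then fun p =>
    exists (r : nat) (a b : 'I_r -> {mpoly k[4]}),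
      [/\ forall i, a i \in I, forall i, ideal_pow I n' (b i) &
          p = \sum_(i < r) a i * b i]
  else fun=> True.

(* Let C be integral, with ideal I.  The blow-up X of P^3 along C is the
   (bihomogeneous) Proj of the Rees algebra S[It], bigraded by
   (degree in x, degree in t); it is covered by the affine charts where x_i
   and g t are invertible, for i < 4 and g a nonzero form in I.  Since
   I O_X = O_X(-E) is the relative O(1), the sections of O_X(aH - bE) over such
   a chart are the elements of bidegree (a, b) of S[It] localized at x_i g t,
   namely h t^(b + m) / (x_i g t)^m with h in I^(b + m).  As X is integral, a
   global section is a t^b-multiple of an element s of Frac S which has this
   form on every chart. *)
Definition blowup_section (k : fieldType) (I : {pred {mpoly k[4]}})
    (a b : nat) (s : ratfun k) : Prop :=
  forall (i : 'I_4) (d : nat) (g : {mpoly k[4]}),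
    g \in I -> g != 0 -> g \is [in k[4], d.-homog] ->
    exists (m : nat) (h : {mpoly k[4]}),
      [/\ h \is [in k[4], (a + m * d.+1).-homog],
          ideal_pow I (b + m)%N h &
          s * (tofrac (('X_i * g) ^+ m) : ratfun k) = tofrac h].

(* |aH - bE| is the projective space of lines in H^0(X, O_X(aH - bE)). *)
Definition linear_system_dim (k : fieldType) (I : {pred {mpoly k[4]}})
    (a b n : nat) : Prop :=
  has_dim (blowup_section I a b) n.+1.

(* Main.v *)
From Stdlib Require Import Classical.
From HB Require Import structures.
Require Import Defs.
From mathcomp Require Import all_boot all_order all_algebra.
From mathcomp.multinomials Require Import mpoly.
From mathcomp Require Import ring zify.
Set Implicit Arguments.
Unset Strict Implicit.
Unset Printing Implicit Defensive.
Import GRing.Theory.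
Local Open Scope ring_scope.

(** Outside the closed set that [general_element] provides, a curve C of the family is
smooth, irreducible and arithmetically Cohen-Macaulay, and every such curve of degree 10
and genus 11 satisfies the conclusion ([acm_curve_dim]). Let I be its ideal in
S = k[x_0..x_3].

The equations of C. Two linear forms z, w make a regular sequence modulo I, and the
Hilbert polynomial 10d - 10 leaves 1, 2, 3, 4, 0 as the Hilbert function of S/(I,z,w)
([lin_sop]). So I contains no cubic, and modulo z, w its quartics span the five monomials
in the remaining two variables. The four evident linear syzygies of these monomials lift,
and I is generated by the signed maximal minors f_0..f_4 of a 4 x 5 matrix M of linear
forms ([hilbert_burch_form]).

The four sections. The products l_a = sum_j M_aj y_j are bilinear; read as linear forms in
x they are sum_i N_ai(y) x_i for a 4 x 4 matrix N of linear forms in y. Since M f = 0,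
the matrix N(f) kills the vector x, so each column of its adjugate is proportional to x:
adj(N(f))_ia = x_i s_a ([adjN_sections]). The forms s_a have degree 3*4 - 1 = 11 and
x_i s_a is a cubic polynomial in f, so the s_a are sections of 11H - 3E. Geometrically
X is the locus l_0 = .. = l_3 = 0 in P^3 x P^4, and the second projection maps it
birationally onto the quartic threefold Delta = det N = 0.

There are no others. At a point where M had rank at most 2 all partial derivatives of its
maximal minors would vanish, so smoothness gives rank at least 3 everywhere off the origin
([smooth_rank]). By the Nullstellensatz the j-minors of the first j + 1 rows contain powers
of all variables, and where such a minor is invertible l_0..l_j are, after a row operation,
a regular sequence ([cminor_regular]). Hence the l_a fail to be regular only along x = 0,
and a descent on the number of variables x_i shows that the x-torsion modulo (l) is
generated by Delta ([torsion_levelP]) and that families Q_i with x_j Q_i = x_i Q_j modulo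
(l) are divisible by x ([compatible_levelP]). The first fact identifies the relations among
f_0..f_4: they are generated by the l_a and Delta ([kernel_lid]). So f_0..f_4 satisfy no
cubic relation with constant coefficients, and one quartic relation. The second shows that
the cube of I is saturated from degree 12 on ([deg3_descend]). A section of 11H - 3E is a
form s of degree 11 that becomes a cubic form in f on every chart ([blowup_polynomial],
[section_one_minor]), so each x_i s is a cubic q_i(f) with constant coefficients. Now N q
vanishes at f, whence N q = Delta c with c constant, q = adj(N) c, and s is the
combination of the s_a with coefficients c ([sections_adj]). A relation between the s_a
would give adj(N) c = 0, hence Delta c = 0 and c = 0 ([adjN_independent]). *)

(** * Regularity and torsion for bilinear forms *)

Section FiniteGeneration.
Variable T : comNzRingType.
Implicit Types (l : nat -> T) (p q : T).

Definition gen (n : nat) l p := exists r : nat -> T, p = \sum_(i < n) r i * l i.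

Lemma gen0 n l : gen n l 0.
Proof. by exists (fun=> 0); rewrite big1 // => i _; rewrite mul0r. Qed.

Lemma genD n l p q : gen n l p -> gen n l q -> gen n l (p + q).
Proof.
move=> [r ->] [s ->]; exists (fun i => r i + s i).
by rewrite -big_split /=; apply: eq_bigr => i _; rewrite mulrDl.
Qed.

Lemma genM n l c p : gen n l p -> gen n l (c * p).
Proof.
move=> [r ->]; exists (fun i => c * r i).
by rewrite big_distrr /=; apply: eq_bigr => i _; rewrite mulrA.
Qed.

Lemma genN n l p : gen n l p -> gen n l (- p).
Proof. by move=> h; rewrite -mulN1r; apply: genM. Qed.

Lemma genB n l p q : gen n l p -> gen n l q -> gen n l (p - q).
Proof. by move=> hp hq; apply: genD => //; apply: genN. Qed.

Lemma gen_eqr n l p q : gen n l (p - q) -> gen n l q -> gen n l p.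
Proof. by move=> hp hq; rewrite -(subrK q p); apply: genD. Qed.

Lemma gen_mem n l i c : (i < n)%N -> gen n l (c * l i).
Proof.
move=> lt_in; exists (fun j => if j == i then c else 0).
rewrite (bigD1 (Ordinal lt_in)) //= eqxx big1 ?addr0 // => j.
by rewrite -val_eqE /= => /negPf ->; rewrite mul0r.
Qed.

Lemma gen_sum n l (J : Type) (s : seq J) (P : pred J) (F : J -> T) :
  (forall j, P j -> gen n l (F j)) -> gen n l (\sum_(j <- s | P j) F j).
Proof. by move=> h; elim/big_ind: _ => //; [apply: gen0 | apply: genD]. Qed.

Lemma gen_mono n m l p : (n <= m)%N -> gen n l p -> gen m l p.
Proof.
move=> le_nm [r ->]; apply: gen_sum => i _; apply: gen_mem.
exact: leq_trans le_nm.
Qed.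

Lemma genSP n l p : gen n.+1 l p <-> exists q, gen n l (p - q * l n).
Proof.
split=> [[r ->]|[q h]].
  by exists (r n); exists r; rewrite big_ord_recr /= addrK.
by apply: gen_eqr (gen_mono (leqnSn n) h) _; apply: gen_mem.
Qed.

Lemma gen_rmorph (phi : {rmorphism T -> T}) n l l' p :
  (forall i, (i < n)%N -> phi (l i) = l' i) -> gen n l p -> gen n l' (phi p).
Proof.
move=> h [r ->]; exists (fun i => phi (r i)).
by rewrite rmorph_sum; apply: eq_bigr => i _; rewrite rmorphM h.
Qed.

End FiniteGeneration.

(** The ring T plays the role of S[y_0..y_4], with retractions [pi i] that set x_i to 0 and
fix the entries N_ai, which involve only the y variables. Level [m] keeps x_0..x_(m-1). The
hypothesis [local_regular] says that the forms are a regular sequence after inverting the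
last variable of a level; everything else follows by letting the level grow. *)
Section LinearForms.
Variables (T : idomainType) (x : nat -> T) (pi : nat -> {rmorphism T -> T}).
Variables (N : nat -> nat -> T) (n : nat).
Hypothesis x_neq0 : forall i, (i < n)%N -> x i != 0.
Hypothesis pix : forall i, (i < n)%N -> pi i (x i) = 0.
Hypothesis pix_neq : forall i j, (i < n)%N -> (j < n)%N -> i != j -> pi i (x j) = x j.
Hypothesis piN : forall i a b, (i < n)%N -> pi i (N a b) = N a b.
Hypothesis pi_mod : forall i p, (i < n)%N -> exists q, p = pi i p + x i * q.
Hypothesis piC : forall i j p, (i < n)%N -> (j < n)%N -> pi i (pi j p) = pi j (pi i p).

Definition lform (m a : nat) := \sum_(i < m) N a i * x i.

Definition lid (j m : nat) := gen j (lform m).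

Definition xlast (m : nat) := if m is m'.+1 then x m' else 0.

Hypothesis local_regular : forall j m p, (j <= m <= n)%N -> (j < n)%N -> (0 < m)%N ->
  lid j m (lform m j * p) -> exists K, lid j m (xlast m ^+ K.+1 * p).

Fixpoint eps (m : nat) : {rmorphism T -> T} :=
  if m is m'.+1 then (eps m' \o pi m')%FUN else idfun.

Definition ldet (m : nat) := \det (\matrix_(a < m, i < m) N a i).

Lemma lformS m a : lform m.+1 a = lform m a + N a m * x m.
Proof. by rewrite /lform big_ord_recr. Qed.

Lemma pi_idem i p : (i < n)%N -> pi i (pi i p) = pi i p.
Proof.
move=> lt_in; have [q e] := pi_mod p lt_in.
by rewrite [in RHS]e rmorphD rmorphM pix // mul0r addr0.
Qed.

Lemma pi_lform m a : (m < n)%N -> pi m (lform m.+1 a) = lform m a.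
Proof.
move=> lt_mn; rewrite lformS rmorphD rmorphM pix // mulr0 addr0 rmorph_sum.
apply: eq_bigr => i _; have lt_in := ltn_trans (ltn_ord i) lt_mn.
by rewrite rmorphM piN // pix_neq // gtn_eqF.
Qed.

Lemma pi_lform_id m a : (m < n)%N -> pi m (lform m a) = lform m a.
Proof.
move=> lt_mn; rewrite rmorph_sum.
apply: eq_bigr => i _; have lt_in := ltn_trans (ltn_ord i) lt_mn.
by rewrite rmorphM piN // pix_neq // gtn_eqF.
Qed.

Lemma pi_lid j m p : (m < n)%N -> lid j m.+1 p -> lid j m (pi m p).
Proof. by move=> lt_mn; apply: gen_rmorph => i _; apply: pi_lform. Qed.

Lemma lid_lift j m p :
  (m < n)%N -> lid j m (pi m p) -> exists q, lid j m.+1 (p - x m * q).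
Proof.
move=> lt_mn [r e]; have [q ep] := pi_mod p lt_mn.
exists (q - \sum_(a < j) r a * N a m); exists r.
have -> : p - x m * (q - \sum_(a < j) r a * N a m) =
  pi m p + x m * \sum_(a < j) r a * N a m by rewrite {1}ep; ring.
rewrite e big_distrr -big_split /=; apply: eq_bigr => i _.
by rewrite lformS; ring.
Qed.

Lemma eps_x m i : (m <= n)%N -> (i < m)%N -> eps m (x i) = 0.
Proof.
elim: m => // m IHm lt_mn; rewrite ltnS leq_eqVlt => /orP[/eqP-> | lt_im] /=.
  by rewrite pix // rmorph0.
rewrite pix_neq //; first by apply: IHm => //; apply: ltnW.
  exact: leq_trans lt_im (ltnW lt_mn).
by rewrite gtn_eqF.
Qed.

Lemma eps_N m a b : (m <= n)%N -> eps m (N a b) = N a b.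
Proof. by elim: m => // m IHm lt_mn /=; rewrite piN // IHm // ltnW. Qed.

Lemma eps_lform m a : (m <= n)%N -> eps m (lform m a) = 0.
Proof.
move=> le_mn; rewrite rmorph_sum big1 // => i _.
by rewrite rmorphM eps_x // mulr0.
Qed.

Lemma eps_lid j m p : (m <= n)%N -> lid j m p -> eps m p = 0.
Proof.
move=> le_mn [r ->]; rewrite rmorph_sum big1 // => i _.
by rewrite rmorphM eps_lform // mulr0.
Qed.

Lemma eps_ldet m : (m <= n)%N -> eps m (ldet m) = ldet m.
Proof.
move=> le_mn; rewrite /ldet -det_map_mx; congr (\det _).
by apply/matrixP=> i j; rewrite !mxE eps_N.
Qed.

Lemma eps_mod m p : (m <= n)%N -> gen m x (p - eps m p).
Proof.
elim: m p => [|m IHm] p lt_mn /=; first by rewrite subrr; apply: gen0.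
have [q e] := pi_mod p lt_mn.
rewrite {1}e addrAC; apply: genD.
  by apply: gen_mono (IHm _ (ltnW lt_mn)).
by rewrite mulrC; apply: gen_mem.
Qed.

(** Cramer's rule for the square system of forms of level [m]. *)
Lemma x_ldet_lid m i : (i < m)%N -> lid m m (x i * ldet m).
Proof.
move=> lt_im; pose A := \matrix_(a < m, b < m) N a b.
pose X := \col_(b < m) x b.
have eL a : (A *m X) a 0 = lform m a.
  by rewrite mxE; apply: eq_bigr => b _; rewrite !mxE.
have : (\adj A *m (A *m X)) (Ordinal lt_im) 0 = x i * ldet m.
  by rewrite mulmxA mul_adj_mx mul_scalar_mx !mxE mulrC.
move=> <-; rewrite mxE; apply: gen_sum => a _; rewrite eL.
exact: gen_mem.
Qed.

(** The last row of the adjugate: modulo the first [m] forms, x_m det_(m+1) agrees with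
det_m times the form [m], which links the determinants of consecutive levels. *)
Lemma ldetS_lid m : lid m m.+1 (x m * ldet m.+1 - ldet m * lform m.+1 m).
Proof.
pose A := \matrix_(a < m.+1, b < m.+1) N a b.
pose X := \col_(b < m.+1) x b.
have eL a : (A *m X) a 0 = lform m.+1 a.
  by rewrite mxE; apply: eq_bigr => b _; rewrite !mxE.
have : (\adj A *m (A *m X)) ord_max 0 = x m * ldet m.+1.
  by rewrite mulmxA mul_adj_mx mul_scalar_mx !mxE mulrC.
move=> <-; rewrite mxE big_ord_recr /= eL.
have -> : (\adj A) ord_max ord_max = ldet m.
  rewrite mxE /cofactor addnn -signr_odd odd_double mul1r.
  congr (\det _); apply/matrixP=> i j; rewrite !mxE.
  by congr N; rewrite lift_max.
rewrite addrK; apply: gen_sum => a _; rewrite eL.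
exact: (@gen_mem _ m (lform m.+1) a).
Qed.

Definition regular_level m := forall j p, (j < m)%N ->
  lid j m (lform m j * p) -> lid j m p.

(** Setting x_m to 0 lowers the level, where the forms are already known to be regular; so
x_m can be put in front of the sequence, and a regular sequence starting with x_m may be
permuted. *)
Lemma x_nzd m j p : (m < n)%N -> regular_level m -> (j <= m)%N ->
  lid j m.+1 (x m * p) -> lid j m.+1 p.
Proof.
move=> lt_mn reg; elim: j p => [|j IHj] p le_jm.
  case=> r; rewrite big_ord0 => /eqP; rewrite mulf_eq0 (negPf (x_neq0 lt_mn)) /=.
  by move=> /eqP->; apply: gen0.
move=> /genSP[q h].
have /reg : lid j m (lform m j * pi m q).
  have := pi_lid lt_mn h.
  rewrite rmorphB !rmorphM pix // mul0r sub0r pi_lform // => /genN.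
  by rewrite opprK mulrC.
move=> /(_ le_jm) /(lid_lift lt_mn)[q' hq'].
apply/genSP; exists q'; apply: IHj; first exact: ltnW.
have -> : x m * (p - q' * lform m.+1 j) =
  (x m * p - q * lform m.+1 j) + lform m.+1 j * (q - x m * q') by ring.
by apply: genD => //; apply: genM.
Qed.

Lemma regular_levelP m : (m <= n)%N -> regular_level m.
Proof.
elim: m => [|m IHm] lt_mn j p // lt_jm h.
have [|||K] := local_regular _ _ _ h => //; first by rewrite (ltnW lt_jm).
  exact: leq_trans lt_jm lt_mn.
move=> {h}; elim: K.+1 => [|K' IHK]; first by rewrite expr0 mul1r.
rewrite exprS -mulrA => /x_nzd => h; apply: IHK; apply: h => //.
by apply: IHm; apply: ltnW.
Qed.

Lemma pi_ldet m i : (i < n)%N -> pi i (ldet m) = ldet m.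
Proof.
move=> lt_in; rewrite /ldet -det_map_mx; congr (\det _).
by apply/matrixP=> a b; rewrite !mxE piN.
Qed.

Lemma ldet_neq0 m : (m <= n)%N -> ldet m != 0.
Proof.
elim: m => [|m IHm] lt_mn; first by rewrite /ldet det_mx00 oner_neq0.
apply: contra (IHm (ltnW lt_mn)) => /eqP d0.
have := ldetS_lid m; rewrite d0 mulr0 sub0r => /genN; rewrite opprK mulrC.
move=> /(regular_levelP lt_mn (ltnSn m))/(eps_lid lt_mn) /=.
by rewrite pi_ldet // eps_ldet ?(ltnW lt_mn) // => ->.
Qed.

Lemma ldet_lid m c : (m <= n)%N -> eps m c * ldet m = 0 -> lid m m (c * ldet m).
Proof.
move=> le_mn e; have := eps_mod c le_mn; rewrite -[c * _]subr0 -e -mulrBl.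
move=> [r ->]; rewrite mulr_suml; apply: gen_sum => i _.
by rewrite -mulrA; apply: genM; apply: x_ldet_lid.
Qed.

(** The determinant involves no x, so an element that vanishes at x = 0 has no genuine
determinant part. *)
Lemma lid_of_eps0 m p c :
  (m <= n)%N -> eps m p = 0 -> lid m m (p - c * ldet m) -> lid m m p.
Proof.
move=> le_mn e h; apply: (gen_eqr h); apply: ldet_lid => //.
move: (eps_lid le_mn h); rewrite rmorphB e sub0r rmorphM eps_ldet //.
by move/eqP; rewrite oppr_eq0 => /eqP.
Qed.

Definition torsion_level m := forall K p,
  lid m m (xlast m ^+ K.+1 * p) -> exists c, lid m m (p - c * ldet m).

Lemma local_regular0 j m p : (j <= m <= n)%N -> (j < n)%N ->
  lid j m (lform m j * p) -> exists K, lid j m (xlast m ^+ K.+1 * p).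
Proof.
case: m => [|m] hj ltjn h; last exact: local_regular h.
by exists 0%N; rewrite expr1 mul0r; apply: gen0.
Qed.

(** The torsion with respect to the last variable is cyclic, generated by the determinant. One
power of x_m at a time: if x_m z is in the ideal of level m+1, its coefficient at the
new form is torsion at level m, hence a multiple of det_m, and [ldetS_lid] turns this into
a multiple of det_(m+1). *)
Lemma torsion_levelP m : (m <= n)%N -> torsion_level m.
Proof.
elim: m => [|m IHm] lt_mn K p.
  by move=> _; exists p; rewrite /ldet det_mx00 mulr1 subrr; apply: gen0.
have reg := regular_levelP (ltnW lt_mn).
have step z : lid m.+1 m.+1 (x m * z) ->
    exists c, lid m.+1 m.+1 (z - c * ldet m.+1).
  move=> /genSP[q h].
  have hq : lid m m (lform m m * pi m q).
    have := pi_lid lt_mn h.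
    rewrite rmorphB !rmorphM pix // mul0r sub0r pi_lform // => /genN.
    by rewrite opprK mulrC.
  have le_mmn : (m <= m <= n)%N by rewrite leqnn ltnW.
  have [K' hK'] := local_regular0 le_mmn lt_mn hq.
  have [c hc] := IHm (ltnW lt_mn) K' _ hK'.
  have : lid m m (pi m (q - c * ldet m)).
    have := gen_rmorph (fun i _ => pi_lform_id i lt_mn) hc.
    by rewrite !rmorphB /= pi_idem.
  move=> /(lid_lift lt_mn)[q' hq'].
  exists c; apply/genSP; exists q'.
  apply: (x_nzd lt_mn reg (leqnn m)).
  have -> : x m * (z - c * ldet m.+1 - q' * lform m.+1 m) =
    (x m * z - q * lform m.+1 m) + lform m.+1 m * (q - c * ldet m - x m * q')
    - c * (x m * ldet m.+1 - ldet m * lform m.+1 m) by ring.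
  by apply: genB; [apply: genD => //; apply: genM | apply/genM/ldetS_lid].
elim: K => [|K IHK] h; first by apply: step; rewrite expr1 in h.
apply: IHK; move: h; rewrite exprS -mulrA => /step[c].
apply: lid_of_eps0 => //.
by rewrite /= rmorphM rmorphXn /= pix // expr0n /= mul0r rmorph0.
Qed.

Lemma pi_eps_comm j m p : (j < n)%N -> (m <= n)%N -> pi j (eps m p) = eps m (pi j p).
Proof.
move=> lt_jn; elim: m p => // m IHm p lt_mn /=.
by rewrite IHm ?(ltnW lt_mn) // piC.
Qed.

Lemma pi_eps j m p : (j < m)%N -> (m <= n)%N -> pi j (eps m p) = eps m p.
Proof.
elim: m p => // m IHm p; rewrite ltnS leq_eqVlt => /orP[/eqP-> | lt_jm] lt_mn /=.
  by rewrite pi_eps_comm ?(ltnW lt_mn) // pi_idem.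
by apply: IHm => //; apply: ltnW.
Qed.

Lemma eps_fix m c : (m <= n)%N -> (forall j, (j < m)%N -> pi j c = c) -> eps m c = c.
Proof.
elim: m => // m IHm lt_mn h /=; rewrite h //.
by apply: IHm => [|j lt_jm]; [apply: ltnW | apply/h/ltnW].
Qed.

Lemma eps_idem m p : (m <= n)%N -> eps m (eps m p) = eps m p.
Proof. by move=> le_mn; apply: eps_fix => // j lt_jm; apply: pi_eps. Qed.

Lemma x_fix m j i : (j <= m)%N -> (m < n)%N -> (i < j)%N -> pi i (x m) = x m.
Proof.
move=> le_jm lt_mn lt_ij; have lt_im := leq_trans lt_ij le_jm.
by apply: pix_neq => //; [apply: ltn_trans lt_im lt_mn | rewrite ltn_eqF].
Qed.

(** Comparing the parts of degree one in x. *)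
Lemma linear_part0 m (c q : nat -> T) : (m <= n)%N ->
  (forall i j, (i < m)%N -> (j < m)%N -> pi j (c i) = c i) ->
  (forall i, (i < m)%N -> eps m (q i) = 0) ->
  \sum_(i < m) x i * c i = \sum_(i < m) x i * q i ->
  forall i, (i < m)%N -> c i = 0.
Proof.
elim: m c q => // m IHm c q lt_mn hc hq e.
have le_mn := ltnW lt_mn.
have c0 i : (i < m)%N -> c i = 0.
  apply: (IHm _ (fun i => pi m (q i))) => //.
  - by move=> {}i j lt_im lt_jm; apply: hc; apply: ltnW.
  - by move=> {}i lt_im; have := hq i (ltnW lt_im).
  have := congr1 (pi m) e; rewrite !big_ord_recr !rmorphD !rmorphM /= pix //.
  rewrite !mul0r !addr0 !rmorph_sum => e'.
  rewrite [LHS](eq_bigr (fun i : 'I_m => pi m (x i * c i))).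
    rewrite e'; apply: eq_bigr => i0 _; rewrite rmorphM.
    by rewrite pix_neq ?gtn_eqF // (ltn_trans (ltn_ord i0) lt_mn).
  move=> i0 _; rewrite rmorphM pix_neq ?gtn_eqF //.
    by rewrite hc // ltnW // ltnS.
  exact: (ltn_trans (ltn_ord i0) lt_mn).
move=> i; rewrite ltnS leq_eqVlt => /orP[/eqP-> | ]; last exact: c0.
have := congr1 (eps m) e; rewrite !big_ord_recr /= big1; last first.
  by move=> j _; rewrite c0 // mulr0.
rewrite add0r rmorphD rmorph_sum big1 ?add0r; last first.
  by move=> j _; rewrite rmorphM eps_x // mul0r.
rewrite !rmorphM /=.
have -> : eps m (x m) = x m.
  by apply: eps_fix => // j lt_jm; apply: (x_fix (j := m)).
have -> : eps m (c m) = c m by apply: eps_fix => // j lt_jm; apply: hc => //; apply: ltnW.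
move=> /(mulfI (x_neq0 lt_mn)) em.
rewrite -(hc m m) // em pi_eps_comm //.
exact: (hq m (ltnSn m)).
Qed.

(** An element of the ideal that has x-order at least two can be written with coefficients of
x-order at least one, because its linear part vanishes. *)
Lemma lid_eps0 j m p : (m <= n)%N -> lid j m p ->
  (exists2 q : nat -> T, forall i, (i < m)%N -> eps m (q i) = 0 &
     p = \sum_(i < m) x i * q i) ->
  exists2 r : nat -> T, forall b, eps m (r b) = 0 &
    p = \sum_(b < j) r b * lform m b.
Proof.
move=> le_mn [r e] [q hq e'].
pose c i := \sum_(b < j) eps m (r b) * N b i.
pose d i := \sum_(b < j) (r b - eps m (r b)) * N b i.
have c0 i : (i < m)%N -> c i = 0.
  apply: (@linear_part0 m c (fun i => q i - d i)) => //.
  - move=> {}i k lt_im lt_km; rewrite rmorph_sum; apply: eq_bigr => b _.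
    by rewrite rmorphM pi_eps // piN // (leq_trans lt_km).
  - move=> {}i lt_im; rewrite rmorphB hq // sub0r rmorph_sum big1 ?oppr0 // => b _.
    by rewrite rmorphM rmorphB /= eps_idem // subrr mul0r.
  have -> : \sum_(i < m) x i * (q i - d i) =
      \sum_(i < m) x i * q i - \sum_(i < m) x i * d i.
    by rewrite -sumrB; apply: eq_bigr => k _; rewrite mulrBr.
  rewrite -e' e; apply/eqP; rewrite eq_sym subr_eq -big_split /=; apply/eqP.
  rewrite (eq_bigr (fun b : 'I_j => \sum_(k < m) r b * (N b k * x k))); last first.
    by move=> b _; rewrite big_distrr.
  rewrite exchange_big; apply: eq_bigr => k _; rewrite -mulrDr -big_split /=.
  by rewrite big_distrr; apply: eq_bigr => b _ /=; ring.
exists (fun b => r b - eps m (r b)).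
  by move=> b; rewrite rmorphB /= eps_idem // subrr.
have e0 : \sum_(b < j) eps m (r b) * lform m b = 0.
  rewrite (eq_bigr (fun b : 'I_j => \sum_(k < m) x k * (eps m (r b) * N b k))).
    rewrite exchange_big big1 //= => k _.
    by rewrite -big_distrr /= -/(c k) c0 // mulr0.
  by move=> b _; rewrite big_distrr; apply: eq_bigr => k _ /=; ring.
transitivity (\sum_(b < j) r b * lform m b - \sum_(b < j) eps m (r b) * lform m b).
  by rewrite e0 subr0.
by rewrite -sumrB; apply: eq_bigr => b _; rewrite mulrBl.
Qed.

Lemma nat_choice (U : Type) (u0 : U) m (P : nat -> U -> Prop) :
  (forall i, (i < m)%N -> exists u, P i u) ->
  exists u : nat -> U, forall i, (i < m)%N -> P i (u i).
Proof.
elim: m => [|m IHm] h; first by exists (fun=> u0).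
have [|u hu] := IHm; first by move=> i lt_im; apply/h/ltnW.
have [v hv] := h m (ltnSn m).
exists (fun i => if i == m then v else u i) => i; rewrite ltnS leq_eqVlt.
by case: eqP => [-> // | _ /= /hu].
Qed.

Definition compatible_level m := forall Q : nat -> T,
  (forall i, (i < m)%N -> eps m (Q i) = 0) ->
  (forall i j, (i < m)%N -> (j < m)%N -> lid m m (x j * Q i - x i * Q j)) ->
  exists q, forall i, (i < m)%N -> lid m m (Q i - x i * q).

Lemma torsion0 m p : (m <= n)%N -> eps m p = 0 ->
  (exists K, lid m m (xlast m ^+ K.+1 * p)) -> lid m m p.
Proof.
by move=> le_mn e [K] /(torsion_levelP le_mn)[c]; apply: lid_of_eps0.
Qed.

(** Up to torsion, x_j Q_i = x_i Q_j forces the family Q to be divisible by x. Reducing the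
last member modulo x_m gives an element all of whose x_j-multiples lie in the ideal of the
first m + 1 forms of level m; the induction hypothesis, applied to the coefficients of these multiples
at the last form, shows that it lies in the ideal itself, so that Q_m is divisible by x_m
and the other members follow. *)
Lemma compatible_levelP m : (m <= n)%N -> compatible_level m.
Proof.
elim: m => [|m IHm] lt_mn Q Q0 hQ; first by exists 0.
have le_mn := ltnW lt_mn; have le_mmn : (m <= m <= n)%N by rewrite leqnn.
pose Qb := pi m (Q m).
have Qb0 : eps m Qb = 0 by apply: (Q0 m).
have [r hr] : exists r : nat -> nat -> T, forall j, (j < m)%N ->
    (forall b, eps m (r j b) = 0) /\
    x j * Qb = \sum_(b < m.+1) r j b * lform m b.
  pose R j (u : nat -> T) := (forall b, eps m (u b) = 0) /\
    x j * Qb = \sum_(b < m.+1) u b * lform m b.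
  apply: (@nat_choice _ (fun=> 0) m R) => j lt_jm.
  have [||r r0 e] := @lid_eps0 m.+1 m (x j * Qb) le_mn.
  - have := pi_lid lt_mn (hQ m j (ltnSn m) (ltnW lt_jm)).
    rewrite rmorphB !rmorphM (pix lt_mn) mul0r subr0 pix_neq ?gtn_eqF //.
    exact: ltn_trans lt_jm lt_mn.
  - exists (fun i => if i == j then Qb else 0).
      by move=> i _; case: eqP => // _; rewrite rmorph0.
    rewrite (bigD1 (Ordinal lt_jm)) //= eqxx big1 ?addr0 // => i.
    by rewrite -val_eqE /= => /negPf ->; rewrite mulr0.
  by exists r.
have [P hP] : exists P, forall j, (j < m)%N -> lid m m (r j m - x j * P).
  apply: (IHm le_mn (fun j => r j m)) => [j lt_jm | i j lt_im lt_jm].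
    by case: (hr j lt_jm).
  apply: torsion0 => //.
    by rewrite rmorphB !rmorphM !eps_x // !mul0r subrr.
  apply: local_regular0 => //.
  have [_ ei] := hr i lt_im; have [_ ej] := hr j lt_jm.
  rewrite !big_ord_recr /= in ei ej.
  have -> : lform m m * (x j * r i m - x i * r j m) =
      x i * \sum_(b < m) r j b * lform m b - x j * \sum_(b < m) r i b * lform m b.
    have e : x j * (x i * Qb) = x i * (x j * Qb) by ring.
    rewrite ei ej in e; move: e.
    set A := \sum_(_ < _) _; set B := \sum_(_ < _) _ => e.
    apply/eqP; rewrite -subr_eq0; apply/eqP.
    transitivity (x j * (A + r i m * lform m m) - x i * (B + r j m * lform m m)).
      by ring.
    by rewrite e subrr.
  by apply: genB; apply: genM; eexists.
have lid_Qb : lid m.+1 m Qb.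
  apply/genSP; exists P; rewrite mulrC.
  case: m => [|m'] in lt_mn le_mn le_mmn Q0 hQ Qb Qb0 r hr P hP IHm *.
    by rewrite /= in Qb0; rewrite Qb0 /lform big_ord0 mul0r subr0; apply: gen0.
  apply: torsion0 => //.
    by rewrite rmorphB rmorphM eps_lform // mul0r Qb0 subrr.
  exists 0%N; rewrite expr1 /= mulrBr.
  have [_ ->] := hr m' (ltnSn m'); rewrite big_ord_recr /= -addrA.
  apply: genD; first by eexists.
  have -> : r m' m'.+1 * lform m'.+1 m'.+1 - x m' * (lform m'.+1 m'.+1 * P) =
    lform m'.+1 m'.+1 * (r m' m'.+1 - x m' * P) by ring.
  exact/genM/hP.
have [q hq] := lid_lift lt_mn lid_Qb.
exists q => i; rewrite ltnS leq_eqVlt => /orP[/eqP-> // | lt_im].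
apply: torsion0 => //.
  rewrite rmorphB rmorphM Q0 1?ltnW // eps_x ?mul0r ?subrr // ltnW //.
exists 0%N; rewrite expr1 [xlast _]/=.
have -> : x m * (Q i - x i * q) =
  - (x i * Q m - x m * Q i) + x i * (Q m - x m * q) by ring.
by apply: genD; [apply/genN/hQ; rewrite // ltnW | apply: genM].
Qed.

End LinearForms.

(** * Linear substitutions and elimination of rows *)

Lemma additive_pihomog (R S : nzRingType) (n m : nat)
    (phi : {additive {mpoly R[n]} -> {mpoly S[m]}}) :
  (forall d p, p \is d.-homog -> phi p \is d.-homog) ->
  forall d p, pihomog mdeg d (phi p) = phi (pihomog mdeg d p).
Proof.
move=> hphi d p.
rewrite {1}[p](pihomog_partitionE (leqnn (msize p))) (raddf_sum phi).
rewrite (linear_sum (pihomog mdeg d)) /=.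
have hd e : phi (pihomog mdeg e p) \is e.-homog by apply/hphi/pihomogP.
case: (ltnP d (msize p)) => hdp.
  rewrite (bigD1 (Ordinal hdp)) //= pihomog_dE // big1 ?addr0 // => i.
  by rewrite -val_eqE /= => ne; apply: pihomog_ne0 (hd i).
rewrite big1 => [|i _]; last first.
  by apply: pihomog_ne0 (hd i); rewrite ltn_eqF // (leq_trans _ hdp).
have -> : pihomog mdeg d p = 0; last by rewrite raddf0.
rewrite pihomogE big_seq_cond big1 // => m' /andP[hm /eqP e].
by move: (msize_mdeg_lt hm); rewrite e ltnNge hdp.
Qed.

Section LinearSubstitution.
Variables (R : comNzRingType) (n : nat).
Implicit Types (v : 'rV[R]_n) (Q : 'M[R]_n) (p q : {mpoly R[n]}).

Definition lin v : {mpoly R[n]} := \sum_(i < n) v 0 i *: 'X_i.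

Lemma lin_is_linear : linear lin.
Proof.
move=> a u v; rewrite /lin scaler_sumr -big_split /=; apply: eq_bigr => i _.
by rewrite !mxE scalerDl scalerA.
Qed.
HB.instance Definition _ := GRing.isLinear.Build R 'rV[R]_n {mpoly R[n]} _ lin lin_is_linear.

Lemma linZ a v : lin (a *: v) = a *: lin v.
Proof. exact: linearZ. Qed.

Lemma lin_sum (I : Type) (r : seq I) (P : pred I) (E : I -> 'rV[R]_n) :
  lin (\sum_(i <- r | P i) E i) = \sum_(i <- r | P i) lin (E i).
Proof. exact: linear_sum. Qed.

Lemma lin_coef v i : (lin v)@_U_(i) = v 0 i.
Proof.
rewrite /lin raddf_sum (bigD1 i) //= mcoeffZ mcoeffXU eqxx mulr1.
rewrite big1 ?addr0 // => j /negPf ne.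
by rewrite mcoeffZ mcoeffXU ne mulr0.
Qed.

Lemma lin_eq0 v : lin v = 0 -> v = 0.
Proof. by move=> e; apply/rowP => i; rewrite -lin_coef e mcoeff0 mxE. Qed.

Lemma lin_homog v : lin v \is 1.-homog.
Proof. by apply: rpred_sum => i _; apply: rpredZ; rewrite dhomogX /= mdeg1. Qed.

Lemma lin_delta i : lin (delta_mx 0 i) = 'X_i.
Proof.
rewrite /lin (bigD1 i) //= mxE !eqxx scale1r big1 ?addr0 // => j /negPf ne.
by rewrite mxE ne andbF scale0r.
Qed.

Lemma homog1_lin p : p \is 1.-homog -> p = lin (\row_i p@_U_(i)).
Proof.
move=> hp; apply/mpolyP => m; case: (boolP (mdeg m == 1%N)) => [/mdeg1P[i /eqP->]|ne].
  by rewrite lin_coef mxE.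
by rewrite (dhomog_nemf_coeff hp ne) (dhomog_nemf_coeff (lin_homog _) ne).
Qed.

Definition lsubst Q p := p \mPo [tuple lin (row i Q) | i < n].

HB.instance Definition _ Q := GRing.RMorphism.copy (lsubst Q)
  (comp_mpoly [tuple lin (row i Q) | i < n]).
HB.instance Definition _ Q := GRing.Linear.copy (lsubst Q)
  (comp_mpoly [tuple lin (row i Q) | i < n]).

Lemma lsubstX Q i : lsubst Q 'X_i = lin (row i Q).
Proof. by rewrite /lsubst comp_mpolyXU -tnth_nth tnth_mktuple. Qed.

Lemma lsubstZ Q c p : lsubst Q (c *: p) = c *: lsubst Q p.
Proof. exact: comp_mpolyZ. Qed.

Lemma lsubst_lin Q v : lsubst Q (lin v) = lin (v *m Q).
Proof.
rewrite mulmx_sum_row !linear_sum; apply: eq_bigr => i _.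
by rewrite !linearZ /= lsubstX.
Qed.

Lemma comp_homog (lq : n.-tuple {mpoly R[n]}) d p :
  (forall i, tnth lq i \is 1.-homog) -> p \is d.-homog -> p \mPo lq \is d.-homog.
Proof.
move=> hlq hp; rewrite comp_mpolyEX big_seq; apply: rpred_sum => m hm.
apply: rpredZ; rewrite comp_mpolyX -(dhomog_mf hp hm) /= mdegE.
elim/big_rec2: _ => [|i d' q _ hq]; first exact: dhomog1.
by apply: dhomogM => //; have := dhomogMn (m i) (hlq i); rewrite mul1n.
Qed.

Lemma lsubst_homog Q d p : p \is d.-homog -> lsubst Q p \is d.-homog.
Proof. by apply: comp_homog => i; rewrite tnth_mktuple lin_homog. Qed.

Lemma lsubst_pihomog Q d p :
  pihomog mdeg d (lsubst Q p) = lsubst Q (pihomog mdeg d p).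
Proof. by apply: additive_pihomog => e q; apply: lsubst_homog. Qed.

Lemma mpoly_ind_ring (P : {mpoly R[n]} -> Prop) :
  (forall c, P c%:MP) -> (forall i, P 'X_i) ->
  (forall p q, P p -> P q -> P (p + q)) -> (forall p q, P p -> P q -> P (p * q)) ->
  forall p, P p.
Proof.
move=> hC hX hD hM; have hXn m : P 'X_[m].
  rewrite mpolyXE_id; apply: (big_ind P) => //; first by rewrite -mpolyC1.
  move=> i _; elim: (m i) => [|k IHk]; first by rewrite expr0 -mpolyC1.
  by rewrite exprS; apply: hM.
elim/mpolyind => [|c m p _ _ hp]; first by rewrite -mpolyC0.
by apply: hD => //; rewrite -mul_mpolyC; apply: hM.
Qed.

Lemma rmorph_mpoly_ext (U : nzRingType) (f g : {rmorphism {mpoly R[n]} -> U}) :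
  (forall c, f c%:MP = g c%:MP) -> (forall i, f 'X_i = g 'X_i) -> f =1 g.
Proof.
by move=> hC hX; apply: mpoly_ind_ring => // p q hp hq;
  rewrite ?rmorphD ?rmorphM /= hp hq.
Qed.

Lemma lsubst_comp Q Q' p : lsubst Q (lsubst Q' p) = lsubst (Q' *m Q) p.
Proof.
move: p; apply: (@rmorph_mpoly_ext _ (lsubst Q \o lsubst Q')%FUN (lsubst (Q' *m Q))).
  by move=> c; rewrite /= /lsubst !comp_mpolyC.
by move=> i; rewrite /= !lsubstX lsubst_lin row_mul.
Qed.

Lemma lsubst1 p : lsubst 1%:M p = p.
Proof.
move: p; apply: (@rmorph_mpoly_ext _ (lsubst 1%:M) idfun).
  by move=> c; rewrite /= /lsubst comp_mpolyC.
by move=> i; rewrite /= lsubstX row1 lin_delta.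
Qed.

Lemma lin_meval v (u : 'I_n -> R) : (lin v).@[u] = \sum_i v 0 i * u i.
Proof. by rewrite linear_sum; apply: eq_bigr => i _; rewrite /= mevalZ mevalXU. Qed.

Lemma lsubst_meval Q p (u : 'I_n -> R) :
  (lsubst Q p).@[u] = p.@[fun i => \sum_j Q i j * u j].
Proof.
rewrite comp_mpoly_meval; apply: meval_eq => i; rewrite tnth_mktuple lin_meval.
by apply: eq_bigr => j _; rewrite mxE.
Qed.

End LinearSubstitution.

Section Elimination.
Variables (R : idomainType) (n m : nat) (A : 'M[R]_(m, n)).
Implicit Types (p q : {mpoly R[n]}) (U : pred 'I_m).

Definition rowform (a : 'I_m) : {mpoly R[n]} := lin (row a A).

Definition rowid U p :=
  exists r : 'I_m -> {mpoly R[n]}, p = \sum_(a | U a) r a * rowform a.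

Lemma rowidD U p q : rowid U p -> rowid U q -> rowid U (p + q).
Proof.
move=> [r ->] [s ->]; exists (fun i => r i + s i).
by rewrite -big_split /=; apply: eq_bigr => i _; rewrite mulrDl.
Qed.

Lemma rowidM U c p : rowid U p -> rowid U (c * p).
Proof.
move=> [r ->]; exists (fun i => c * r i).
by rewrite big_distrr /=; apply: eq_bigr => i _; rewrite mulrA.
Qed.

Lemma rowid0 U : rowid U 0.
Proof. by exists (fun=> 0); rewrite big1 // => i _; rewrite mul0r. Qed.

Lemma rowid_sum U (J : Type) (s : seq J) (P : pred J) (F : J -> {mpoly R[n]}) :
  (forall j, P j -> rowid U (F j)) -> rowid U (\sum_(j <- s | P j) F j).
Proof. by move=> h; elim/big_ind: _ => //; [apply: rowid0 | apply: rowidD]. Qed.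

Lemma rowid_mem U a c : U a -> rowid U (c * rowform a).
Proof.
move=> Ua; exists (fun j => if j == a then c else 0).
rewrite (bigD1 a) //= eqxx big1 ?addr0 // => j /andP[_ /negPf->].
by rewrite mul0r.
Qed.

Variables (E : 'M[R]_(n, m)) (h : R).

(** The substitution h y - E A y, the rows outside [U] being dropped. When A E = h on the
rows of [U] it sends these forms to 0, while it is multiplication by h modulo them. *)
Definition elim_mx U : 'M[R]_n := h%:M - \matrix_(i, b) (E i b *+ U b) *m A.

Lemma elim_mx_form U a :
  lsubst (elim_mx U) (rowform a) =
    h *: rowform a - \sum_(b | U b) (A *m E) a b *: rowform b.
Proof.
rewrite lsubst_lin mulmxBr linearB /= mul_mx_scalar linearZ /=; congr (_ - _).
rewrite mulmxA -row_mul mulmx_sum_row linear_sum /= [RHS]big_mkcond /=.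
apply: eq_bigr => b _; rewrite linearZ /= -/(rowform b).
have -> : row a (A *m \matrix_(i, b0) (E i b0 *+ U b0)) 0 b = (A *m E) a b *+ U b.
  by rewrite !mxE -sumrMnl; apply: eq_bigr => i _; rewrite !mxE mulrnAr.
by case: (U b); rewrite ?mulr1n ?mulr0n ?scale0r.
Qed.

Lemma elim_mx_monomial U (k : 'X_{1..n}) :
  rowid U (h ^+ mdeg k *: 'X_[k] - lsubst (elim_mx U) 'X_[k]).
Proof.
pose Rel c p := rowid U (c *: p - lsubst (elim_mx U) p).
have hX i : Rel h 'X_i.
  rewrite /Rel lsubstX linearB linearB /= -scalemx1 linearZ linearZ /= row1 lin_delta.
  rewrite opprB addrC subrK row_mul mulmx_sum_row linear_sum; apply: rowid_sum => b _.
  rewrite linearZ /= !mxE -/(rowform b) -mul_mpolyC; case: (boolP (U b)) => Ub.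
    by rewrite mulr1n; apply: rowid_mem.
  by rewrite mulr0n mpolyC0 mul0r; apply: rowid0.
have hM c p d q : Rel c p -> Rel d q -> Rel (c * d) (p * q).
  rewrite /Rel rmorphM /= => hp hq.
  have -> : (c * d) *: (p * q) - lsubst (elim_mx U) p * lsubst (elim_mx U) q =
    (d *: q) * (c *: p - lsubst (elim_mx U) p)
    + lsubst (elim_mx U) p * (d *: q - lsubst (elim_mx U) q).
    by rewrite -!mul_mpolyC mpolyCM; ring.
  by apply: rowidD; apply: rowidM.
have h1 : Rel 1 1 by rewrite /Rel rmorph1 scale1r subrr; apply: rowid0.
have hXn i d : Rel (h ^+ d) ('X_i ^+ d).
  elim: d => [|d IHd]; first by rewrite !expr0.
  rewrite (exprS h) (exprS 'X_i); exact: hM (hX i) IHd.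
rewrite mdegE mpolyXE_id (big_morph (fun d => h ^+ d) (exprD h) (expr0 h)).
rewrite -/(Rel _ _); apply: (big_ind2 Rel h1) => [c p d q | i _]; first exact: hM.
exact: hXn.
Qed.

(** On degree d the substitution is multiplication by h^d modulo the eliminated rows. *)
Lemma elim_mx_homog U d p : p \is d.-homog ->
  rowid U ((h ^+ d)%:MP * p - lsubst (elim_mx U) p).
Proof.
move=> hp; rewrite mul_mpolyC [p]mpolyE (linear_sum (lsubst _)).
rewrite scaler_sumr -sumrB big_seq; apply: rowid_sum => k hk.
rewrite -{1}(dhomog_mf hp hk) /= lsubstZ.
rewrite scalerA mulrC -scalerA -scalerBr.
by rewrite -[p@_k *: _]mul_mpolyC; apply: rowidM; apply: elim_mx_monomial.
Qed.

Lemma elim_mx_kernel U p : lsubst (elim_mx U) p = 0 ->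
  exists K, rowid U ((h ^+ K)%:MP * p).
Proof.
move=> e; exists (msize p).
rewrite {2}[p](pihomog_partitionE (leqnn (msize p))) big_distrr /=.
apply: rowid_sum => d _.
have := elim_mx_homog U (pihomogP mdeg d p).
rewrite -lsubst_pihomog e raddf0 subr0.
move=> hd; rewrite [X in h ^+ X](_ : msize p = (msize p - d + d)%N); last by rewrite subnK // ltnW.
by rewrite exprD mpolyCM -mulrA; apply: rowidM.
Qed.

End Elimination.

Section MinorRegular.
Variables (R : idomainType) (n j : nat) (A : 'M[R]_(j.+1, n)).
Variables (E : 'M[R]_(n, j.+1)) (h : R) (c : 'I_j.+1).
Hypothesis AE : forall a b, a != c -> b != c -> (A *m E) a b = h *+ (a == b).
Hypothesis Afree : forall v : 'rV_j.+1, v *m A = 0 -> v = 0.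
Hypothesis h_neq0 : h != 0.

Let notc : pred 'I_j.+1 := fun a => a != c.

Lemma elim_kill (U : pred (ordinal j.+1)) a : (forall b, U b -> b != c) -> U a ->
  lsubst (elim_mx A E h U) (rowform A a) = 0.
Proof.
move=> hU Ua; rewrite elim_mx_form (bigD1 a) //= AE ?hU // eqxx mulr1n.
rewrite big1 ?addr0 ?subrr // => b /andP[Ub ne].
by rewrite AE ?hU // eq_sym (negPf ne) mulr0n scale0r.
Qed.

Lemma elim_keep (U : pred (ordinal j.+1)) a : (forall b, U b -> b != c) -> a != c -> ~~ U a ->
  lsubst (elim_mx A E h U) (rowform A a) = h *: rowform A a.
Proof.
move=> hU ac Ua; rewrite elim_mx_form big1 ?subr0 // => b Ub.
rewrite (AE ac (hU _ Ub)); have [e|_] := eqVneq a b; last by rewrite mulr0n scale0r.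
by rewrite e Ub in Ua.
Qed.

Lemma rowform_neq0 a : rowform A a != 0.
Proof.
apply/eqP => /lin_eq0; rewrite rowE => /Afree/rowP/(_ a)/eqP.
by rewrite !mxE !eqxx oner_eq0.
Qed.

(** The one row that is not eliminated stays nonzero: its image is h times the row plus a
combination of the others, and the rows are independent. *)
Lemma elim_c_neq0 : lsubst (elim_mx A E h notc) (rowform A c) != 0.
Proof.
rewrite elim_mx_form.
pose v : 'rV[R]_j.+1 := \row_b (if b == c then h else - (A *m E) c b).
have -> : h *: rowform A c - \sum_(b | notc b) (A *m E) c b *: rowform A b = lin (v *m A).
  rewrite mulmx_sum_row (linear_sum (@lin R n)) [RHS](bigD1 c) //= linZ mxE eqxx; congr (_ + _).
  rewrite -sumrN; apply: eq_bigr => b /negPf ne.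
  have e : v 0 b = - (A *m E) c b by rewrite [LHS]mxE ne.
  by rewrite /= linZ e scaleNr.
apply/eqP => /lin_eq0/Afree/rowP/(_ c)/eqP.
by rewrite !mxE eqxx (negPf h_neq0).
Qed.

(** After inverting h the rows other than [c] become distinct variables. If [c] is the last
row, killing these variables leaves a domain where the last form is nonzero. Otherwise one
first clears the coefficient at row [c], and then kills the remaining rows. *)
Lemma minor_regular p :
  rowid A (fun a => a != ord_max) (rowform A ord_max * p) ->
  exists K, rowid A (fun a => a != ord_max) ((h ^+ K)%:MP * p).
Proof.
move=> [r e].
have [ec|nec] := eqVneq c ord_max.
  have := congr1 (lsubst (elim_mx A E h notc)) e.
  rewrite rmorphM (linear_sum (lsubst _)) big1 /=; last first.
    by move=> a na; rewrite rmorphM /= elim_kill ?mulr0 // /notc ec.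
  move/eqP; rewrite mulf_eq0 -{1}ec (negPf elim_c_neq0) /= => /eqP/elim_mx_kernel.
  by rewrite /notc ec.
have max_c : ord_max != c by rewrite eq_sym.
have rc0 : lsubst (elim_mx A E h notc) (r c) = 0.
  have := congr1 (lsubst (elim_mx A E h notc)) e.
  rewrite rmorphM (linear_sum (lsubst _)) (bigD1 c) //= big1 => [|a /andP[_ na]].
    rewrite (@elim_kill notc ord_max) // mul0r addr0 rmorphM => /esym/eqP.
    by rewrite mulf_eq0 (negPf elim_c_neq0) orbF => /eqP.
  by rewrite rmorphM /= (@elim_kill notc a) ?mulr0.
have [K [s es]] := elim_mx_kernel rc0.
pose U : pred 'I_j.+1 := fun a => (a != c) && (a != ord_max).
have hU b : U b -> b != c by case/andP.
pose q := (h ^+ K)%:MP * p - s ord_max * rowform A c.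
have eq : rowform A ord_max * q =
    \sum_(a | U a) ((h ^+ K)%:MP * r a + s a * rowform A c) * rowform A a.
  have -> : rowform A ord_max * q =
    (h ^+ K)%:MP * (rowform A ord_max * p) - s ord_max * rowform A c * rowform A ord_max.
    by rewrite /q; ring.
  rewrite e (bigD1 c) ?nec //= mulrDr mulrA es (bigD1 ord_max) 1?eq_sym //=.
  rewrite mulrDl [s ord_max * _]mulrC -[_ * s _ * _]mulrA [s _ * rowform A c]mulrC.
  rewrite [rowform A c * s _]mulrC.
  have -> : \sum_(i | (i != ord_max) && (i != c)) r i * rowform A i =
    \sum_(a | U a) r a * rowform A a by apply: eq_bigl => a; rewrite /U andbC.
  rewrite [RHS](eq_bigr (fun a => (h ^+ K)%:MP * (r a * rowform A a)
     + s a * rowform A a * rowform A c)); last by move=> a _; ring.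
  rewrite big_split /= -big_distrr -big_distrl /=.
  rewrite -/(U) addrC; ring.
have q0 : lsubst (elim_mx A E h U) q = 0.
  have := congr1 (lsubst (elim_mx A E h U)) eq.
  rewrite rmorphM (linear_sum (lsubst _)) big1 => [|a Ua]; last first.
    by rewrite rmorphM /= (@elim_kill U a) ?mulr0.
  rewrite /= (@elim_keep U ord_max) //; last by rewrite /U eqxx andbF.
  move/eqP; rewrite mulf_eq0 -mul_mpolyC mulf_eq0 mpolyC_eq0 (negPf h_neq0).
  by rewrite (negPf (rowform_neq0 _)) /= => /eqP.
have [K' [t et]] := elim_mx_kernel q0.
exists (K' + K)%N.
have -> : (h ^+ (K' + K))%:MP * p =
   (h ^+ K')%:MP * q + (h ^+ K')%:MP * s ord_max * rowform A c.
  by rewrite exprD mpolyCM /q; ring.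
apply: rowidD; last exact: rowid_mem.
rewrite et; apply: rowid_sum => a /andP[_ na]; exact: rowid_mem.
Qed.

End MinorRegular.

(** * Homogeneous ideals and the projective Nullstellensatz *)

Lemma rmorph_comb (A B : nzRingType) (phi : {rmorphism A -> B}) D u v g p D' g' p' :
  phi D = D' -> phi g = g' -> phi p = p' ->
  D = u * g + v * p -> D' = phi u * g' + phi v * p'.
Proof. by move=> <- <- <- ->; rewrite rmorphD !rmorphM. Qed.

Section ProjectiveNullstellensatz.

Definition idealP (R : nzRingType) (J : R -> Prop) :=
  [/\ J 0, forall p q, J p -> J q -> J (p + q) & forall c p, J p -> J (c * p)].

Definition hidealP (R : nzRingType) (n : nat) (J : {mpoly R[n]} -> Prop) :=
  idealP J /\ (forall p d, J p -> J (pihomog mdeg d p)).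

Lemma idealP_sum (R : nzRingType) (J : R -> Prop) (I : Type) (s : seq I) (P : pred I)
    (F : I -> R) :
  idealP J -> (forall i, P i -> J (F i)) -> J (\sum_(i <- s | P i) F i).
Proof. by case=> J0 JD _ h; elim/big_ind: _. Qed.

Variable k : closedFieldType.

Section Uni.
Variable n : nat.

Definition ucons (a : 'I_n -> k) (t : k) (i : 'I_n.+1) : k :=
  if unlift ord_max i is Some j then a j else t.

Lemma widen_lift (i : 'I_n) : widen_ord (leqnSn n) i = lift ord_max i.
Proof. by apply: val_inj; rewrite [RHS]lift_max. Qed.

Lemma muniX (i : 'I_n) : muni ('X_(lift ord_max i) : {mpoly k[n.+1]}) = ('X_i)%:P.
Proof.
rewrite muniE msuppX big_seq1 mcoeffX eqxx scale1r -widen_lift.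
rewrite mnmE -(inj_eq val_inj) /= ltn_eqF // expr0 alg_polyC; congr (_%:P).
congr 'X_[_]; apply/mnmP => j; rewrite !mnmE -(inj_eq val_inj) /=.
by rewrite (inj_eq val_inj).
Qed.

Lemma muniXmax : muni ('X_ord_max : {mpoly k[n.+1]}) = 'X.
Proof.
rewrite muniE msuppX big_seq1 mcoeffX eqxx scale1r mnmE eqxx expr1.
rewrite [X in 'X_[X]](_ : _ = 0%MM) ?mpolyX0 ?scale1r //.
by apply/mnmP => j; rewrite !mnmE -(inj_eq val_inj) /= gtn_eqF.
Qed.

(** The inverse of [muni]. *)
Definition multi (P : {poly {mpoly k[n]}}) : {mpoly k[n.+1]} :=
  (map_poly (@mwiden n k) P).['X_ord_max].

HB.instance Definition _ := GRing.RMorphism.copy multi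
  (horner_eval ('X_ord_max : {mpoly k[n.+1]}) \o map_poly (@mwiden n k))%FUN.

Lemma mwidenXU (i : 'I_n) : mwiden ('X_i : {mpoly k[n]}) = 'X_(lift ord_max i).
Proof. by rewrite mwidenX mnmwiden1 widen_lift. Qed.

Lemma multiK (p : {mpoly k[n.+1]}) : multi (muni p) = p.
Proof.
move: p; apply: (@rmorph_mpoly_ext _ _ _ (multi \o @muni n k)%FUN idfun).
  by move=> c; rewrite /= muniC /multi map_polyC hornerC /= mwidenC.
move=> i; rewrite /=; case: (unliftP ord_max i) => [j|] ->.
  by rewrite muniX /multi map_polyC hornerC /= mwidenXU.
by rewrite muniXmax /multi map_polyX hornerX.
Qed.

Lemma multiC (c : {mpoly k[n]}) : multi c%:P = mwiden c.
Proof. by rewrite /multi map_polyC hornerC. Qed.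

Lemma muni_multi (P : {poly {mpoly k[n]}}) : muni (multi P) = P.
Proof.
elim/poly_ind: P => [|P c IH]; first by rewrite !raddf0.
rewrite !rmorphD !rmorphM /= IH multiC; congr (_ * _ + _).
  by rewrite /multi map_polyX hornerX muniXmax.
move: c; apply: (@rmorph_mpoly_ext _ _ _ (@muni n k \o @mwiden n k)%FUN polyC).
  by move=> c; rewrite /= mwidenC muniC.
by move=> i; rewrite /= mwidenXU muniX.
Qed.

Lemma muni_eval (p : {mpoly k[n.+1]}) (a : 'I_n -> k) t :
  (map_poly (meval a) (muni p)).[t] = p.@[ucons a t].
Proof.
move: p; apply: (@rmorph_mpoly_ext _ _ _
  (horner_eval t \o (map_poly (meval a) \o @muni n k))%FUN (meval (ucons a t))).
  by move=> c; rewrite /= /horner_eval muniC map_polyC hornerC /= !mevalC.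
move=> i; rewrite /= /horner_eval /ucons mevalXU; case: unliftP => [j|] ->.
  by rewrite muniX map_polyC hornerC /= mevalXU.
by rewrite muniXmax map_polyX hornerX.
Qed.

Lemma mwiden_homog d (p : {mpoly k[n]}) : p \is d.-homog -> mwiden p \is d.-homog.
Proof.
move=> hp; rewrite (mwidenE (leqnn _)); apply: rpred_sum => m _.
have [->|nz] := eqVneq (p@_m) 0; first by rewrite scale0r rpred0.
apply: rpredZ; rewrite dhomogX /=.
have : (m : 'X_{1..n}) \in msupp p by rewrite mcoeff_msupp.
move/(dhomog_mf hp) => /= <-; rewrite !mdegE big_ord_recr /= mnmwiden_ordmax addn0.
by apply/eqP; apply: eq_bigr => i _; rewrite mnmwiden_widen.
Qed.

Lemma muni_lead (p : {mpoly k[n.+1]}) d : p \is d.-homog ->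
  p.@[ucons (fun=> 0) 1] = 1 -> muni p \is monic /\ size (muni p) = d.+1.
Proof.
move=> hp p1.
have mle (m : 'X_{1..n.+1}) : (m ord_max <= mdeg m)%N.
  by rewrite mdegE big_ord_recr /= leq_addl.
have sz : (size (muni p) <= d.+1)%N.
  rewrite muniE big_seq; elim/big_ind: _ => [|q r hq hr|m hm].
  - by rewrite size_poly0.
  - by rewrite (leq_trans (size_polyD _ _)) // geq_max hq hr.
  apply: leq_trans (size_scale_leq _ _) _.
  by rewrite size_polyXn ltnS -(dhomog_mf hp hm) mle.
have cd : (muni p)`_d = 1.
  rewrite muniE coef_sum -[RHS]mpolyC1 -p1 mevalE rmorph_sum.
  rewrite !big_seq; apply: eq_bigr => m hm; rewrite coefZ coefXn.
  have dm := dhomog_mf hp hm; rewrite /= in dm.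
  rewrite /= big_ord_recr /= {2}/ucons unlift_none expr1n mulr1.
  rewrite (eq_bigr (fun i => 0 ^+ m (lift ord_max i))); last first.
    by move=> i _; rewrite widen_lift /ucons liftK.
  have [e|ne] := eqVneq d (m ord_max).
    have m0 i : m (lift ord_max i) = 0%N.
      have : mdeg m = m ord_max by rewrite dm.
      rewrite mdegE big_ord_recr /= -[RHS]add0n => /addIn/eqP.
      rewrite sum_nat_eq0 => /forallP/(_ i)/=/eqP.
      by rewrite widen_lift.
    rewrite big1 => [|i _]; last by rewrite m0 expr0.
    rewrite !mulr1 -alg_mpolyC; congr (_ *: _).
    rewrite [X in 'X_[X]](_ : _ = 0%MM) ?mpolyX0 //.
    by apply/mnmP => i; rewrite !mnmE widen_lift m0.
  rewrite mulr0; apply/esym/eqP; rewrite mpolyC_eq0 mulf_eq0; apply/orP; right.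
  have [i hi] : exists i, m (lift ord_max i) != 0%N.
    apply/existsP; apply: contraR ne => /existsPn h.
    rewrite -dm mdegE big_ord_recr /= big1 ?add0n // => i _.
    by rewrite widen_lift; apply/eqP; move: (h i); rewrite negbK.
  by rewrite (bigD1 i) //= expr0n (negPf hi) mul0r.
have szE : size (muni p) = d.+1.
  apply/eqP; rewrite eqn_leq sz ltnNge; apply/negP => le.
  by move: cd; rewrite nth_default // => /esym/eqP; rewrite oner_eq0.
by split=> //; rewrite monicE lead_coefE szE /= cd.
Qed.

Lemma multi_comb (D : {mpoly k[n]}) u v g p :
  D%:P = u * muni g + v * muni p -> mwiden D = multi u * g + multi v * p.
Proof. exact: (rmorph_comb (multiC D) (multiK g) (multiK p)). Qed.

End Uni.

(** The norm of g from A[X]/f to A, as the determinant of multiplication by g. It lies in the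
ideal (f, g), and it specializes to 1 wherever g does; this replaces the resultant. *)
Lemma monic_norm (A : comNzRingType) (f g : {poly A}) :
  f \is monic -> exists G : 'M[A]_((size f).-1),
   (exists u v, (\det G)%:P = u * g + v * f) /\
   (forall (K : fieldType) (phi : {rmorphism A -> K}),
      map_poly phi g = 1 -> phi (\det G) = 1).
Proof.
move=> fm; have f0 : f != 0 by apply: monic_neq0.
have : size f = (size f).-1.+1 by rewrite prednK // size_poly_gt0.
move: (size f).-1 => d szf.
pose r i := Pdiv.Ring.rmodp ('X^i * g) f.
pose q i := Pdiv.Ring.rdivp ('X^i * g) f.
have eqr i : 'X^i * g = q i * f + r i by apply: Pdiv.RingMonic.rdivp_eq.
have szr i : (size (r i) <= d)%N by rewrite -ltnS -szf Pdiv.Ring.ltn_rmodpN0.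
exists (\matrix_(i, j) (r i)`_j); split.
  set G := \matrix_(i, j) _.
  case: d => [|d] in szf szr G *.
    exists 0, 1; rewrite mul0r add0r mul1r det_mx00.
    rewrite (size1_polyC (eq_leq szf)).
    by move: (monicP fm); rewrite lead_coefE szf /= => ->.
  pose Gp := map_mx polyC G; pose X := \col_(i < d.+1) ('X^i : {poly A}).
  have eX : Gp *m X = \col_i ('X^i * g - q i * f).
    apply/colP => i; rewrite !mxE [in RHS]eqr addrC addKr.
    rewrite [RHS](_ : _ = \sum_(j < d.+1) (r i)`_j *: 'X^j).
      by apply: eq_bigr => j _; rewrite !mxE mul_polyC.
    by rewrite -poly_def; apply/polyP => j; rewrite coef_poly; case: ltnP => // hj; rewrite nth_default // (leq_trans (szr i)).
  have := congr1 (fun M => (\adj Gp *m M) 0 0) eX.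
  rewrite mulmxA mul_adj_mx mul_scalar_mx !mxE expr0 mulr1 det_map_mx => ->.
  exists (\sum_(i < d.+1) \adj Gp 0 i * 'X^i), (- \sum_(i < d.+1) \adj Gp 0 i * q i).
  rewrite mulNr !big_distrl -sumrB /=; apply: eq_bigr => i _.
  by rewrite [X in _ * X]mxE; ring.
move=> K phi g1; rewrite -det_map_mx.
have -> : map_mx phi (\matrix_(i < d, j < d) (r i)`_j) = 1%:M; last by rewrite det1.
apply/matrixP => i j; rewrite !mxE.
have := congr1 (map_poly phi) (eqr i).
rewrite rmorphM rmorphD rmorphM /= g1 mulr1 map_polyXn => e.
have fpm : map_poly phi f \is monic by apply: monic_map.
have szfp : size (map_poly phi f) = d.+1.
  by rewrite size_map_poly_id0 // (monicP fm) rmorph1 oner_neq0.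
have szrp : (size (map_poly phi (r i)) <= d)%N.
  exact: leq_trans (size_poly _ _) (szr i).
have q0 : map_poly phi (q i) = 0.
  apply/eqP; apply: contraTT isT => nz.
  have : (size (map_poly phi (q i) * map_poly phi f)%R <= d)%N.
    have -> : map_poly phi (q i) * map_poly phi f = 'X^i - map_poly phi (r i).
      by rewrite e addrK.
    apply: leq_trans (size_polyD _ _) _.
    by rewrite size_polyN geq_max szrp size_polyXn ltn_ord.
  rewrite size_Mmonic // szfp addnS /= leqNgt.
  by rewrite -{1}[d]add0n ltn_add2r size_poly_gt0 nz.
rewrite -[phi _]coef_map; rewrite q0 mul0r add0r in e.
by rewrite -e coefXn eq_sym.
Qed.

(** An ideal of polynomials in one variable is principal. *)
Lemma common_root (B : {poly k} -> Prop) (f : {poly k}) :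
  idealP B -> B f -> f != 0 -> ~ B 1 -> exists t, forall g, B g -> root g t.
Proof.
move=> idB Bf f0 B1; have [B0 BD BM] := idB.
have [m] := ubnP (size f); elim: m f Bf f0 => // m IHm f Bf f0 szf.
have [[g [Bg nd]]|alld] := classic (exists g, B g /\ ~~ (f %| g)).
  apply: (IHm (g %% f)).
  - have -> : g %% f = g + - (g %/ f) * f.
      by rewrite {2}(divp_eq g f) mulNr addrAC subrr add0r.
    by apply: BD => //; apply: BM.
  - by move: nd; rewrite /dvdp.
  - by apply: (@leq_trans (size f)); rewrite ?ltn_modp.
have dvd g : B g -> f %| g.
  by move=> Bg; apply/negPn/negP => nd; apply: alld; exists g.
have [t ft] : exists t, root f t.
  apply/closed_rootP; apply/negP => /eqP szf1; apply: B1.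
  have [c c0 fc] : exists2 c, c != 0 & f = c%:P by apply/size_poly1P/eqP.
  by have := BM c^-1%:P _ Bf; rewrite fc -polyCM mulVf.
by exists t => g /dvd/root_dvdp; apply.
Qed.

Definition radical (R : nzRingType) (J : R -> Prop) (p : R) := exists K, J (p ^+ K).

Lemma radicalM (R : comNzRingType) (J : R -> Prop) c p :
  idealP J -> radical J p -> radical J (c * p).
Proof. by move=> [_ _ JM] [K hK]; exists K; rewrite exprMn; apply: JM. Qed.

Lemma radicalD (R : comNzRingType) (J : R -> Prop) p q :
  idealP J -> radical J p -> radical J q -> radical J (p + q).
Proof.
move=> idJ [K hK] [L hL]; have [_ _ JM] := idJ; exists (K + L)%N.
rewrite exprDn; apply: idealP_sum => // i _; rewrite -mulr_natl; apply: (JM).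
case: (leqP L i) => hi.
  by rewrite -(subnK hi) exprD mulrA; apply: (JM).
rewrite mulrC (_ : (K + L - i)%N = ((K + L - i - K) + K)%N); last first.
  by rewrite subnK // -addnBA ?leq_addr // ltnW.
by rewrite exprD mulrA; apply: (JM).
Qed.

(** Induction on the number of variables by elimination. Some form of the ideal does not
vanish at (0,..,0,1), so it is monic in the last variable; the ideal contracted to the other
variables has no zero but the origin either, since over a zero of it the polynomials of the
ideal have a common root in the last variable. Thus powers of the other variables lie in the ideal, and modulo them
the monic form is a power of the last variable. *)
Lemma projective_nullstellensatz n (J : {mpoly k[n]} -> Prop) :
  hidealP J -> (forall v : 'I_n -> k, (forall p, J p -> p.@[v] = 0) -> v =1 fun=> 0) ->
  forall i, exists K, J ('X_i ^+ K).
Proof.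
elim: n J => [|n IHn] J [[J0 JD JM] Jh] nozero i; first by case: i.
have [p [Jp p1 [d hp]]] : exists p, [/\ J p, p.@[ucons (fun=> 0) 1] = 1 & exists d, p \is d.-homog].
  apply: NNPP => no.
  have /(_ ord_max) : (ucons (fun=> 0) 1 : 'I_n.+1 -> k) =1 fun=> 0.
    apply: nozero => p Jp; rewrite {1}[p](pihomog_partitionE (leqnn (msize p))).
    rewrite rmorph_sum big1 //= => d _; set q := pihomog _ _ _.
    apply/eqP; apply: contraPT no => nz; case; exists (q.@[ucons (fun=> 0) 1]^-1%:MP * q).
    split; first by apply/JM/Jh.
      by rewrite mevalM mevalC mulVf.
    by exists d; rewrite mul_mpolyC; apply/rpredZ/pihomogP.
  by rewrite /ucons unlift_none => /eqP; rewrite oner_eq0.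
have [fm szf] := muni_lead hp p1.
pose J' q := J (mwiden q).
have hJ' : hidealP J'.
  split; first split.
  - by rewrite /J' raddf0.
  - by move=> q r; rewrite /J' raddfD; apply: JD.
  - by move=> c q; rewrite /J' rmorphM; apply: JM.
  move=> q e Jq; rewrite /J' -(additive_pihomog (phi := @mwiden n k)) //.
    exact: Jh.
  exact: mwiden_homog.
have nozero' (a : 'I_n -> k) : (forall q, J' q -> q.@[a] = 0) -> a =1 fun=> 0.
  move=> ha.
  pose B h := exists2 g, J g & h = map_poly (meval a) (muni g).
  have [||||t ht] := @common_root B (map_poly (meval a) (muni p)).
  - split.
    + by exists 0 => //; rewrite !raddf0.
    + by move=> _ _ [g Jg ->] [h Jh' ->]; exists (g + h); [apply: JD | rewrite !raddfD].
    + move=> c _ [g Jg ->]; exists (multi (map_poly (@mpolyC n k) c) * g).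
        exact: JM.
      rewrite !rmorphM /=; congr (_ * _).
      by rewrite muni_multi -map_poly_comp_id0 ?rmorph0 //= map_poly_id // => x _; rewrite /= mevalC.
  - by exists p.
  - by rewrite monic_neq0 // monic_map.
  - move=> [g Jg /esym g1].
    have [G [[u [v e]] /(_ _ (meval a) g1)]] := monic_norm (muni g) fm.
    have e' := multi_comb e.
    rewrite /= ha => [/esym/eqP|]; first by rewrite oner_eq0.
    by rewrite /J' e'; apply: JD; apply: JM.
  have /(_ _)h0 : ucons a t =1 fun=> 0.
    apply: nozero => q Jq; rewrite -muni_eval; apply/eqP/ht.
    by exists q.
  by move=> j; have := h0 (lift ord_max j); rewrite /ucons liftK.
have hX (j : 'I_n) : exists K, J ('X_(lift ord_max j) ^+ K).
  have [K hK] := IHn J' hJ' nozero' j; exists K.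
  by move: hK; rewrite /J' rmorphXn /= mwidenXU.
case: (unliftP ord_max i) => [j ->|->]; first exact: hX.
have idJ : idealP J by [].
suff [K] : radical J ('X_ord_max ^+ d) by rewrite -exprM; exists (d * K)%N.
have -> : 'X_ord_max ^+ d = p - (p - 'X_ord_max ^+ d) by rewrite opprB addrC subrK.
apply: radicalD => //; first by exists 1%N.
rewrite -mulN1r; apply: radicalM => //.
have -> : p - 'X_ord_max ^+ d = \sum_(m <- msupp p)
    (p@_m *: 'X_[m] - (p@_m * \prod_j ucons (fun=> 0) 1 j ^+ m j)%:MP * 'X_ord_max ^+ d).
  rewrite sumrB -mpolyE -big_distrl -(rmorph_sum (@mpolyC n.+1 k)) /= -mevalE p1.
  by rewrite mpolyC1 mul1r.
rewrite big_seq; elim/big_ind: _ => [|q r|m hm].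
- by exists 1%N.
- exact: radicalD.
have dm := dhomog_mf hp hm; rewrite /= in dm.
case: (pickP (fun j => m (lift ord_max j) != 0%N)) => [j mj|m0].
  rewrite (bigD1 (lift ord_max j)) //= {1}/ucons liftK expr0n (negPf mj) mul0r mulr0.
  rewrite mpolyC0 mul0r subr0 -mul_mpolyC; apply: radicalM => //.
  have le : (U_(lift ord_max j) <= m)%MM by rewrite lep1mP.
  rewrite -(submK le) mpolyXD.
  by apply: radicalM => //; apply: hX.
have {}m0 j : m (lift ord_max j) = 0%N by apply/eqP; move: (m0 j) => /negbFE.
have md : m ord_max = d.
  by rewrite -dm mdegE big_ord_recr /= big1 // => j _; rewrite widen_lift.
rewrite big_ord_recr /= big1 => [|j _]; last by rewrite widen_lift m0.
rewrite mul1r {1}/ucons unlift_none expr1n mulr1.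
have -> : m = (U_(ord_max) *+ d)%MM.
  apply/mnmP => j; rewrite mulmnE mnm1E; case: (unliftP ord_max j) => [j' ->|->].
    by rewrite m0 (negPf (neq_lift _ _)).
  by rewrite eqxx mul1n.
rewrite -mpolyXn mul_mpolyC subrr.
by exists 1%N.
Qed.

End ProjectiveNullstellensatz.

(** * Hilbert functions *)

Lemma pihomogMl (R : comNzRingType) (n e d : nat) (z q : {mpoly R[n]}) :
  z \is e.-homog -> pihomog mdeg (e + d) (z * q) = z * pihomog mdeg d q.
Proof.
move=> hz; have hd i : z * pihomog mdeg i q \is (e + i).-homog.
  by apply: dhomogM => //; apply: pihomogP.
rewrite {1}[q](pihomog_partitionE (leqnn (msize q))) big_distrr.
rewrite (linear_sum (pihomog mdeg (e + d))) /=.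
case: (ltnP d (msize q)) => hdq.
  rewrite (bigD1 (Ordinal hdq)) //= pihomog_dE // big1 ?addr0 // => i.
  by rewrite -val_eqE /= => ne; apply: pihomog_ne0 (hd i); rewrite eqn_add2l.
rewrite big1 => [|i _]; last first.
  by apply: pihomog_ne0 (hd i); rewrite eqn_add2l ltn_eqF // (leq_trans _ hdq).
have -> : pihomog mdeg d q = 0; last by rewrite mulr0.
rewrite pihomogE big_seq_cond big1 // => m' /andP[hm /eqP em].
by move: (msize_mdeg_lt hm); rewrite em ltnNge hdq.
Qed.

Lemma pihomogMl0 (R : comNzRingType) (n e d : nat) (z q : {mpoly R[n]}) :
  z \is e.-homog -> (d < e)%N -> pihomog mdeg d (z * q) = 0.
Proof.
move=> hz lt_de; rewrite {1}[q](pihomog_partitionE (leqnn (msize q))) big_distrr.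
rewrite (linear_sum (pihomog mdeg d)) big1 //= => i _.
have hi : z * pihomog mdeg i q \is (e + i).-homog.
  by apply: dhomogM => //; apply: pihomogP.
by apply: pihomog_ne0 hi; rewrite gtn_eqF // ltn_addr.
Qed.

Lemma subspaceP (k : fieldType) (vT : vectType k) (P : vT -> Prop) :
  P 0 -> (forall a u v, P u -> P v -> P (a *: u + v)) ->
  exists U : {vspace vT}, forall v, v \in U <-> P v.
Proof.
move=> P0 PD.
suff h m (U : {vspace vT}) : (forall v, v \in U -> P v) ->
    (\dim {:vT} < m + \dim U)%N -> exists U : {vspace vT}, forall v, v \in U <-> P v.
  apply: (h (\dim {:vT}).+1 0%VS) => [v|]; last by rewrite dimv0 addn0.
  by rewrite memv0 => /eqP->.
elim: m U => [|m IHm] U hU lt.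
  by move: lt; rewrite add0n ltnNge dimvS ?subvf.
have [[v [Pv nv]]|all] := classic (exists v, P v /\ v \notin U); last first.
  exists U => v; split=> [/hU // | Pv].
  by apply/negPn/negP => nv; apply: all; exists v.
apply: (IHm (U + <[v]>)%VS) => [w|].
  move=> /memv_addP[u Uu [_ /vlineP[c ->] ->]]; rewrite addrC.
  by apply: PD => //; apply: hU.
rewrite addSn ltnS in lt; apply: leq_ltn_trans lt _.
rewrite ltn_add2l ltn_neqAle dimvS ?addvSl // andbT.
apply: contra nv => /eqP e.
have := dimv_leqif_eq (addvSl U <[v]>); move=> [_]; rewrite e eqxx => /esym/eqP->.
by apply/(subvP (addvSr U <[v]>))/memv_line.
Qed.

Section GradedDimension.
Variable k : fieldType.
Implicit Types (J : {mpoly k[4]} -> Prop) (d n : nat).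
Local Notation V d := (dhomog 4 k d).

(** The codimension [n] of J in degree [d], i.e. the Hilbert function of S/J; a subspace
witnesses it because J is only a proposition. *)
Definition hcodim J d n := exists U : {vspace V d},
  (forall v : V d, v \in U <-> J v) /\ (n + \dim U = 'C(d + 3, d))%N.

Lemma dim_dhomog d : \dim {: V d} = 'C(d + 3, d).
Proof. by rewrite dimvf. Qed.

Lemma hcodim_uniq J d m n : hcodim J d m -> hcodim J d n -> m = n.
Proof.
move=> [U [hU eU]] [U' [hU' eU']].
have e : U = U'.
  by apply/vspaceP => v; apply/idP/idP => [/hU/hU' | /hU'/hU].
by move: eU; rewrite e -eU' => /addIn.
Qed.

Lemma hcodim_exists J d : hidealP J -> exists n, hcodim J d n.
Proof.
move=> [[J0 JD JM] _].
have [|a u v Ju Jv|U hU] := @subspaceP _ (V d) (fun v => J v); first by [].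
  by rewrite linearP /= -mul_mpolyC; apply: JD => //; apply: JM.
exists ('C(d + 3, d) - \dim U)%N, U; split=> //.
by rewrite subnK // -dim_dhomog dimvS ?subvf.
Qed.

Definition spans J d n (b : 'I_n -> {mpoly k[4]}) :=
  (forall i, b i \is d.-homog) /\
  (forall p, p \is d.-homog -> exists c : 'I_n -> k, J (p - \sum_i c i *: b i)).

Definition independent J n (b : 'I_n -> {mpoly k[4]}) :=
  forall c : 'I_n -> k, J (\sum_i c i *: b i) -> forall i, c i = 0.

Definition lift_tuple n d (b : 'I_n -> {mpoly k[4]}) (hb : forall i, b i \is d.-homog) :
  n.-tuple (V d) := [tuple DHomog (hb i) | i < n].

Lemma lift_tuple_sum n d b (hb : forall i, b i \is d.-homog) (c : 'I_n -> k) :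
  \sum_i c i *: b i = \sum_i c i *: (lift_tuple hb)`_i :> {mpoly k[4]}.
Proof.
rewrite [RHS](linear_sum (@mpoly_of_dhomog _ _ _)).
by apply: eq_bigr => i _; rewrite -(tnth_nth 0 (lift_tuple hb)) tnth_mktuple.
Qed.

Lemma lift_tuple_span n d b (hb : forall i, b i \is d.-homog) (v : V d) :
  v \in <<lift_tuple hb>>%VS <-> exists c : 'I_n -> k, val v = \sum_i c i *: b i.
Proof.
split=> [/coord_span e | [c e]].
  exists (fun i => coord (lift_tuple hb) i v).
  by rewrite [in LHS]e lift_tuple_sum.
have -> : v = \sum_i c i *: (lift_tuple hb)`_i.
  by apply: val_inj; rewrite e lift_tuple_sum.
by apply: rpred_sum => i _; apply/rpredZ/memv_span/mem_nth; rewrite size_tuple.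
Qed.

Lemma hcodim_span J d n m (b : 'I_m -> {mpoly k[4]}) :
  hcodim J d n -> spans J d b -> (n <= m)%N.
Proof.
move=> [U [hU eU]] [hb sb].
have fullE : fullv = (U + <<lift_tuple hb>>)%VS.
  apply/esym/vspaceP => v; rewrite memvf; apply/idP.
  have [c hc] := sb v (dhomog_is_dhomog v).
  pose w := \sum_i c i *: (lift_tuple hb)`_i.
  rewrite -(subrK w v); apply: memv_add.
    by apply/hU; rewrite linearB /= -/w -lift_tuple_sum.
  by apply/lift_tuple_span; exists c; rewrite lift_tuple_sum.
have := dimv_sum_cap U <<lift_tuple hb>>%VS.
rewrite -fullE dim_dhomog -eU => e.
have := dim_span (lift_tuple hb); rewrite size_tuple; apply: leq_trans.
by rewrite -(leq_add2l (\dim U)) -e addnC -addnA leq_add2l leq_addr.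
Qed.

Lemma hcodim_basis J d n : hcodim J d n ->
  exists b : 'I_n -> {mpoly k[4]}, spans J d b /\ independent J b.
Proof.
move=> [U [hU eU]]; have en : n = \dim U^C.
  by rewrite dimv_compl dim_dhomog -eU addnK.
move: eU; rewrite {}en => _; pose X := vbasis U^C.
have bX : basis_of U^C X by apply: vbasisP.
exists (fun i => val (X`_i)); split; first split.
- by move=> i; apply: dhomog_is_dhomog.
- move=> p hp; pose v : V d := DHomog hp.
  exists (fun i => coord X i (v - projv U v)).
  have e := coord_vbasis (memv_projC U v).
  have -> : p - \sum_i coord X i (v - projv U v) *: val X`_i = val (projv U v).
    have -> : \sum_i coord X i (v - projv U v) *: val X`_i = val (v - projv U v).
      rewrite [in RHS]e [RHS](linear_sum (@mpoly_of_dhomog _ _ _)).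
      by apply: eq_bigr.
    by rewrite [val (_ - _)]linearB /= opprB addrC subrK.
  by apply/hU/memv_proj.
move=> c; have -> : \sum_i c i *: val X`_i = val (\sum_i c i *: X`_i).
  by rewrite [RHS](linear_sum (@mpoly_of_dhomog _ _ _)); apply: eq_bigr.
move=> /hU hs.
have : \sum_i c i *: X`_i \in (U :&: U^C)%VS.
  rewrite memv_cap hs; apply: rpred_sum => i _; apply: rpredZ.
  by apply: (basis_mem bX); apply: mem_nth; rewrite size_tuple.
rewrite capv_compl memv0 => /eqP e0 i.
by move/freeP: (basis_free bX) => /(_ c e0 i).
Qed.

Lemma basis_hcodim J d n (b : 'I_n -> {mpoly k[4]}) : hidealP J ->
  spans J d b -> independent J b -> hcodim J d n.
Proof.
move=> hJ sb ib; have [m hm] := hcodim_exists d hJ.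
suff -> : n = m by [].
apply/eqP; rewrite eqn_leq (hcodim_span hm sb) andbT.
have [[J0 _ _] _] := hJ; have [U [hU eU]] := hm; have [hb _] := sb.
have frX : free (lift_tuple hb).
  apply/freeP => c e0; apply: ib; rewrite (lift_tuple_sum hb).
  have -> : \sum_(i < n) c i *: (lift_tuple hb)`_i = 0 := e0.
  exact: J0.
have cap0 : (U :&: <<lift_tuple hb>> = 0)%VS.
  apply/eqP; rewrite -subv0; apply/subvP => v; rewrite memv_cap => /andP[/hU Jv].
  move=> /(lift_tuple_span hb)[c e]; rewrite memv0; apply/eqP/val_inj.
  rewrite e big1 // => i _; rewrite (ib c) ?scale0r //.
  by rewrite -e.
have := dimv_sum_cap U <<lift_tuple hb>>%VS; rewrite cap0 dimv0 addn0.
move: frX => /eqP ->; rewrite size_tuple => e.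
rewrite -(leq_add2r (\dim U)) eU addnC -e -dim_dhomog.
by rewrite dimvS ?subvf.
Qed.

Lemma dim_mod_hcodim J d n : hidealP J ->
  dim_mod J (fun p => p \is [in k[4], d.-homog]) n -> hcodim J d n.
Proof.
move=> hJ [b [hb cb]]; have [[J0 _ _] _] := hJ.
apply: (basis_hcodim hJ (b := b)); first split => // p /cb[c [hc _]].
  by exists c.
move=> c hc i; have hs : \sum_i c i *: b i \is d.-homog.
  by apply: rpred_sum => j _; apply: rpredZ.
have [c0 [_ cu]] := cb _ hs.
have e1 : c0 = finfun c.
  apply: cu; suff -> : \sum_(i < n) (finfun c) i *: b i = \sum_i c i *: b i.
    by rewrite subrr.
  by apply: eq_bigr => j _; rewrite ffunE.
have e2 : c0 = [ffun=> 0].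
  by apply: cu; rewrite [X in _ - X]big1 ?subr0 // => j _; rewrite ffunE scale0r.
by move: e1; rewrite e2 => /ffunP/(_ i); rewrite !ffunE.
Qed.

(** The ideal J + (z). *)
Definition addid J (z p : {mpoly k[4]}) := exists q, J (p - z * q).

Lemma addid_hideal J z : hidealP J -> z \is 1.-homog -> hidealP (addid J z).
Proof.
move=> [[J0 JD JM] Jh] hz; split; first split.
- by exists 0; rewrite mulr0 subr0.
- move=> p q [a ha] [b hb]; exists (a + b).
  have -> : p + q - z * (a + b) = (p - z * a) + (q - z * b) by ring.
  exact: JD.
- move=> c p [a ha]; exists (c * a).
  have -> : c * p - z * (c * a) = c * (p - z * a) by ring.
  exact: JM.
move=> p [|d] [q hq].
  exists 0; rewrite mulr0 subr0; have := Jh _ 0%N hq.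
  by rewrite raddfB /= (pihomogMl0 q hz) // subr0.
exists (pihomog mdeg d q).
by rewrite -(pihomogMl d q hz) -raddfB; apply: Jh.
Qed.

Lemma addid_sub J z p : J p -> addid J z p.
Proof. by exists 0; rewrite mulr0 subr0. Qed.

Lemma addid_homog J z p d : hidealP J -> z \is 1.-homog -> p \is d.+1.-homog ->
  addid J z p -> exists2 q, q \is d.-homog & J (p - z * q).
Proof.
move=> [_ Jh] hz hp [q /(Jh _ d.+1)]; rewrite raddfB /= pihomog_dE //.
rewrite -[d.+1]add1n (pihomogMl d q hz) => h.
by exists (pihomog mdeg d q) => //; apply: pihomogP.
Qed.

Section MulLinear.
Variables (z : {mpoly k[4]}) (hz : z \is 1.-homog) (z0 : z != 0) (d : nat).

Fact hmul_subproof (p : V d) : z * p \is d.+1.-homog.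
Proof. by rewrite -[d.+1]add1n; apply: dhomogM => //; apply: dhomog_is_dhomog. Qed.

Definition hmul (p : V d) : V d.+1 := DHomog (hmul_subproof p).

Fact hmul_linear : linear hmul.
Proof.
move=> a u v; apply: val_inj => /=.
by rewrite mulrDr -scalerAr.
Qed.
HB.instance Definition _ := GRing.isLinear.Build k (V d) (V d.+1) _ hmul hmul_linear.

Definition hmulf := linfun hmul.

Lemma hmulfE p : val (hmulf p) = z * p.
Proof. by rewrite lfunE. Qed.

Lemma lker_hmulf : lker hmulf = 0%VS.
Proof.
apply/eqP/lker0P => u v /(congr1 val); rewrite !hmulfE => /(mulfI z0) e.
exact: val_inj.
Qed.

Lemma dim_hmulf U : \dim (hmulf @: U) = \dim U.
Proof. by apply: limg_dim_eq; rewrite lker_hmulf capv0. Qed.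

Lemma hmulf_memP (U : {vspace V d}) v :
  v \in (hmulf @: U)%VS <-> exists2 p : V d, p \in U & val v = z * p.
Proof.
split=> [/memv_imgP[p hp ->] | [p hp e]]; first by exists p => //; rewrite hmulfE.
have -> : v = hmulf p by apply: val_inj; rewrite hmulfE.
exact: memv_img.
Qed.

End MulLinear.

(** The exact sequence 0 -> (S/J)_d -> (S/J)_(d+1) -> (S/(J,z))_(d+1) -> 0. *)
Lemma hcodim_mul J z d a b : hidealP J -> z \is 1.-homog -> z != 0 ->
  (forall p, p \is d.-homog -> J (z * p) -> J p) ->
  hcodim J d a -> hcodim J d.+1 b ->
  exists2 c, hcodim (addid J z) d.+1 c & (c + a)%N = b.
Proof.
move=> hJ hz z0 nzd [U [hU eU]] [U' [hU' eU']].
have [[J0 JD JM] Jh] := hJ.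
pose f := hmulf hz d; pose W := (U' + f @: fullv)%VS.
have capE : (U' :&: f @: fullv = f @: U)%VS.
  apply/vspaceP => v; rewrite memv_cap; apply/idP/idP.
    move=> /andP[/hU' Jv /(hmulf_memP hz)[p _ e]]; apply/(hmulf_memP hz).
    exists p => //; apply/hU; apply: nzd; first exact: dhomog_is_dhomog.
    by rewrite -e.
  move=> /(hmulf_memP hz)[p /hU Jp e]; apply/andP; split.
    by apply/hU'; rewrite [X in J X]e; apply: JM.
  by apply/(hmulf_memP hz); exists p; rewrite ?memvf.
have hW (v : V d.+1) : v \in W <-> addid J z v.
  split=> [/memv_addP[u /hU' Ju [w hw ->]] | ].
    have [p _ e] := (hmulf_memP hz _ _).1 hw.
    by exists (p : {mpoly k[4]}); rewrite -e /= addrK.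
  move=> /(addid_homog hJ hz (dhomog_is_dhomog v))[q hq h].
  rewrite -(subrK (f (DHomog hq)) v); apply: memv_add; last by rewrite memv_img ?memvf.
  by apply/hU'; rewrite linearB /= [X in _ - X]hmulfE.
have := dimv_sum_cap U' (f @: fullv); rewrite capE !dim_hmulf // -/W dim_dhomog -eU.
rewrite addnA => /addIn eW.
have leW : (\dim W <= 'C(d.+1 + 3, d.+1))%N by rewrite -dim_dhomog dimvS ?subvf.
exists ('C(d.+1 + 3, d.+1) - \dim W)%N; first by exists W; rewrite subnK.
by apply: (@addIn (\dim U')); rewrite eU' -addnA [(a + _)%N]addnC -eW subnK.
Qed.

End GradedDimension.

(** * Linear non-zero-divisors *)

(** A saturated homogeneous ideal J of constant codimension N in large degrees admits a linear
non-zero-divisor. Prime avoidance is replaced by a generic linear form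
x_0 + t x_1 + t^2 x_2 + t^3 x_3 with t an indeterminate. *)
Section LinearNonzerodivisor.
Variable k : closedFieldType.
Implicit Types (d n : nat).

Definition nzd (R : nzRingType) (J : R -> Prop) (w : R) := forall p, J (w * p) -> J p.

Lemma homog_comp (R : comNzRingType) (m : nat) (J : {mpoly R[m]} -> Prop) p' :
  hidealP J -> (forall d, J (pihomog mdeg d p')) -> J p'.
Proof.
move=> [idJ _] h; rewrite [p'](pihomog_partitionE (leqnn (msize p'))).
exact: idealP_sum.
Qed.

Lemma homogS_split (R : comNzRingType) (m d : nat) (p' : {mpoly R[m]}) :
  p' \is d.+1.-homog -> exists2 q' : 'I_m -> {mpoly R[m]},
    forall i, q' i \is d.-homog & p' = \sum_i 'X_i * q' i.
Proof.
pose P (p' : {mpoly R[m]}) := exists2 q' : 'I_m -> {mpoly R[m]},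
    forall i, q' i \is d.-homog & p' = \sum_i 'X_i * q' i.
move=> hp; rewrite -/(P p') [p']mpolyE big_seq; apply: (big_ind P).
- by exists (fun=> 0) => [i|]; rewrite ?rpred0 // big1 // => i _; rewrite mulr0.
- move=> _ _ [q1 h1 ->] [q2 h2 ->]; exists (fun i => q1 i + q2 i).
    by move=> i; apply: rpredD.
  by rewrite -big_split; apply: eq_bigr => i _; rewrite mulrDr.
move=> e he; have de := dhomog_mf hp he; rewrite /= in de.
have [i hi] : exists i, e i != 0%N.
  apply/existsP; move: de; rewrite mdegE; apply: contra_eqT => /existsPn h.
  by rewrite big1 // => i _; apply/eqP; move: (h i); rewrite negbK.
have le : (U_(i) <= e)%MM by rewrite lep1mP.
exists (fun j => if j == i then p'@_e *: 'X_[e - U_(i)] else 0).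
  move=> j; case: eqP => _; last by rewrite rpred0.
  apply: rpredZ; rewrite dhomogX /= -(eqn_add2r (mdeg U_(i))) -mdegD submK //.
  by rewrite de mdeg1 addn1.
rewrite (bigD1 i) //= eqxx big1 ?addr0 => [|j /negPf->]; last by rewrite mulr0.
by rewrite -scalerAr -mpolyXD addmC submK.
Qed.

Lemma homog_linear_comb J N (b : 'I_N -> {mpoly k[4]}) p (c : 'I_N -> k) w
    (A : 'I_N -> {mpoly k[4]}) :
  idealP J -> (forall j, J (w * b j - A j)) -> J (p - \sum_j c j *: b j) ->
  J (w * p - \sum_j c j *: A j).
Proof.
move=> [J0 JD JM] hA hp.
have -> : w * p - \sum_j c j *: A j =
    w * (p - \sum_j c j *: b j) + \sum_j (c j)%:MP * (w * b j - A j).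
  rewrite mulrBr -addrA; congr (_ + _); rewrite big_distrr /= -!sumrN -big_split /=.
  by apply: eq_bigr => j _; rewrite mulrBr !mul_mpolyC -scalerAr addKr.
by apply: (JD) => //; [apply: (JM) | apply: idealP_sum => // j _; apply: (JM)].
Qed.

Variable J : {mpoly k[4]} -> Prop.
Hypothesis hJ : hidealP J.
Hypothesis hsat : forall p, (forall i : 'I_4, J ('X_i * p)) -> J p.

Let JD : forall p q, J p -> J q -> J (p + q) := let: conj (And3 _ h _) _ := hJ in h.
Let JM : forall c p, J p -> J (c * p) := let: conj (And3 _ _ h) _ := hJ in h.
Let J0 : J 0 := let: conj (And3 h _ _) _ := hJ in h.
Let idJ : idealP J := let: conj h _ := hJ in h.

(** The coefficient of t^n in (x_0 + t x_1 + t^2 x_2 + t^3 x_3) * (sum_n p_n t^n). *)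
Definition curve_coef (p : nat -> {mpoly k[4]}) n :=
  \sum_(i < 4 | (i <= n)%N) 'X_i * p (n - i)%N.

(** McCoy's argument: if the generic linear form kills a polynomial in t with coefficients
in S/J, then x_0, x_1, x_2, x_3 successively kill all of its coefficients, which are then 0
because J is saturated. *)
Lemma mccoy L (p : nat -> {mpoly k[4]}) :
  (forall n, (L <= n)%N -> J (p n)) -> (forall n, J (curve_coef p n)) ->
  forall n, J (p n).
Proof.
elim: L p => [|L IHL] p hL hc; first by move=> n; apply: hL.
suff h (j : nat) : (j <= 4)%N -> forall i : 'I_4, (i < j)%N -> forall n, J ('X_i * p n).
  by move=> n; apply: hsat => i; apply: (h 4%N).
elim: j => [|j IHj] le_j i //; rewrite ltnS leq_eqVlt => /orP[/eqP eij | ]; last first.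
  by move=> lt_ij; exact: (IHj (ltnW le_j) i lt_ij).
have hlt (i' : 'I_4) n : (i' < i)%N -> J ('X_i' * p n).
  by rewrite eij => lt_ij; exact: (IHj (ltnW le_j) i' lt_ij n).
have hi0 : J ('X_i * p 0%N).
  have := hc i; rewrite /curve_coef (bigD1 i) //= subnn => hci.
  rewrite -[X in J X](addrK (\sum_(i0 < 4 | (i0 <= i)%N && (i0 != i)) 'X_i0 * p (i - i0)%N)).
  apply: JD => //; rewrite -mulN1r; apply: JM; apply: idealP_sum => // i' /andP[le ne].
  by apply: hlt; rewrite ltn_neqAle le andbT.
have hS n : J ('X_i * p n.+1).
  apply: (IHL (fun n => 'X_i * p n.+1)) => [m le_m|m]; first by apply: JM; apply: hL.
  have := JM 'X_i (hc m.+1); rewrite /curve_coef big_distrr /= => hm.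
  rewrite (eq_bigr (fun i' : 'I_4 => 'X_i * ('X_i' * p (m.+1 - i')%N))); last first.
    by move=> i' le; rewrite subSn // mulrCA.
  case: (ltnP m 3) => [lt3|ge3].
    move: hm; rewrite (bigD1 (Ordinal (lt3 : (m.+1 < 4)%N))) //= subnn => hm.
    rewrite (eq_bigl (fun i' : 'I_4 => (i' <= m.+1)%N && (i' != Ordinal (lt3 : (m.+1 < 4)%N)))).
      have := JD hm (JM (- 'X_(Ordinal (lt3 : (m.+1 < 4)%N))) hi0).
      rewrite mulrCA mulNr -[X in _ + X]mulrN.
      by rewrite addrAC mulrN subrr add0r.
    by move=> i' /=; rewrite -val_eqE /= [RHS]andbC -ltn_neqAle ltnS.
  move: hm; rewrite (eq_bigl (fun i' : 'I_4 => (i' <= m)%N)) // => i'.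
  have lt := ltn_ord i'; rewrite !(leq_trans (lt : (i' <= 3)%N)) //; exact: leqW.
by case.
Qed.

(** Between two pieces of the same dimension N the generic form acts by a square matrix over
k[t]. Its determinant is nonzero by [mccoy], so some value of t keeps it invertible. *)
Lemma exists_nzd_at d N : hcodim J d N -> hcodim J d.+1 N ->
  exists2 w, w \is 1.-homog & forall p, p \is d.-homog -> J (w * p) -> J p.
Proof.
move=> /hcodim_basis[b [[hb sb] ib]] /hcodim_basis[b' [[hb' sb'] ib']].
have [A hA] : exists A : 'I_4 -> 'I_N -> 'I_N -> k,
    forall i j, J ('X_i * b j - \sum_l A i j l *: b' l).
  have hij i j : exists c : 'I_N -> k, J ('X_i * b j - \sum_l c l *: b' l).
    by apply: sb'; rewrite -[d.+1]add1n; apply: dhomogM => //; rewrite dhomogX /= mdeg1.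
  have hi i : exists c : 'I_N -> 'I_N -> k, forall j, J ('X_i * b j - \sum_l c j l *: b' l).
    exact: (@fin_all_exists _ (fun=> 'I_N -> k)) (hij i).
  exact: (@fin_all_exists _ (fun=> 'I_N -> 'I_N -> k)) hi.
pose M := \matrix_(j < N, l < N) \sum_(i < 4) (A i j l)%:P * 'X^i.
have [/eqP/det0P[u u0 uM]|detM] := eqVneq (\det M) 0.
  pose p n := \sum_j (u 0 j)`_n *: b j.
  have Jp : forall n, J (p n).
    (* A bound on the degree in t. *)
    pose L := (\max_j size (u 0%R j))%N.
    apply: (@mccoy L p) => [n le|n].
       rewrite /p big1 // => j _; rewrite nth_default ?scale0r //.
      by apply: leq_trans le; apply: (leq_bigmax j).
    have e0 : \sum_(i < 4 | (i <= n)%N) \sum_j (u 0 j)`_(n - i) *: \sum_l A i j l *: b' l = 0.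
      under eq_bigr => i _ do under eq_bigr => j _ do rewrite scaler_sumr.
      under eq_bigr => i _ do rewrite exchange_big.
      rewrite exchange_big big1 //= => l _.
      under eq_bigr => i _ do (under eq_bigr => j _ do rewrite scalerA; rewrite -scaler_suml).
      rewrite -scaler_suml exchange_big /=.
      have := congr1 (fun P : 'rV[{poly k}]_N => (P 0 l)`_n) uM.
      rewrite !mxE coef0 coef_sum => e.
      rewrite [X in X *: _](_ : _ = 0) ?scale0r // -[RHS]e.
      apply: eq_bigr => j _; rewrite mxE big_distrr coef_sum /= [LHS]big_mkcond /=.
      apply: eq_bigr => i _; rewrite mulrA coefMXn ltnNge; case: (i <= n)%N => //=.
      by rewrite coefMC.
    rewrite -[curve_coef p n]subr0 -e0 /curve_coef -sumrB; apply: idealP_sum => // i _.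
    apply: (@homog_linear_comb _ _ b) => //.
    by rewrite /p subrr; apply: J0.
  case/negP: u0; apply/eqP/rowP => j; rewrite mxE; apply/polyP => n.
  by rewrite coef0; apply: (ib _ (Jp n)).
have [t rt] : exists t, ~~ root (\det M) t by apply/closed_nonrootP.
pose Mt := map_mx (horner_eval t) M.
have detMt : \det Mt != 0 by rewrite det_map_mx.
pose w := lin (\row_(i < 4) t ^+ i).
exists w; first exact: lin_homog.
move=> p hp Jwp; have [c hc] := sb p hp.
have hAt j : J (w * b j - \sum_l Mt j l *: b' l).
  have -> : w * b j - \sum_l Mt j l *: b' l =
      \sum_(i < 4) (t ^+ i)%:MP * ('X_i * b j - \sum_l A i j l *: b' l).
    rewrite /w /lin big_distrl /= [X in _ - X](_ : _ =
        \sum_(i < 4) (t ^+ i)%:MP * \sum_l A i j l *: b' l).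
      rewrite -sumrB; apply: eq_bigr => i _.
      by rewrite mxE mulrBr !mul_mpolyC -scalerAl.
    under [RHS]eq_bigr => i _ do rewrite mul_mpolyC scaler_sumr.
    rewrite exchange_big; apply: eq_bigr => l _ /=.
    under [RHS]eq_bigr => i _ do rewrite scalerA.
    rewrite -scaler_suml; congr (_ *: _); rewrite !mxE /horner_eval horner_sum.
    by apply: eq_bigr => i _; rewrite hornerM hornerC hornerXn mulrC.
  by apply: idealP_sum => // i _; apply: JM.
have := homog_linear_comb idJ hAt hc => h.
have {h} : J (\sum_l (\row_j c j *m Mt) 0 l *: b' l).
  have -> : \sum_l (\row_j c j *m Mt) 0 l *: b' l = \sum_j c j *: \sum_l Mt j l *: b' l.
    under [RHS]eq_bigr => j _ do rewrite scaler_sumr.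
    rewrite exchange_big; apply: eq_bigr => l _ /=.
    under [RHS]eq_bigr => j _ do rewrite scalerA.
    rewrite -scaler_suml; congr (_ *: _); rewrite mxE.
    by apply: eq_bigr => j _; rewrite mxE.
  set s := \sum_j _ in h *.
  have -> : s = w * p + (-1) * (w * p - s) by ring.
  by apply: JD => //; apply: JM.
move=> /ib' h0; have c0 : \row_j c j = 0.
  apply/eqP; apply: contraNT detMt => nz; apply/det0P; exists (\row_j c j) => //.
  by apply/rowP => l; rewrite [RHS]mxE; apply: h0.
rewrite -[p](subrK (\sum_i c i *: b i)); apply: JD => //.
rewrite big1 // => i _; move/rowP: c0 => /(_ i); rewrite !mxE => ->.
by rewrite scale0r.
Qed.

(** Injectivity in one degree spreads: equal dimensions make multiplication by [w] surjective
there, surjectivity passes to higher degrees since S/J is generated in degree 0, and there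
it gives injectivity back. Saturation then handles the lower degrees. *)
Section Propagate.
Variables (w : {mpoly k[4]}) (d N : nat).
Hypotheses (w1 : w \is 1.-homog) (w0 : w != 0).
Hypothesis hN : forall e, (d <= e)%N -> hcodim J e N.
Hypothesis nzd_d : forall p, p \is d.-homog -> J (w * p) -> J p.

Let surj e := forall p, p \is e.+1.-homog -> addid J w p.

Lemma nzd_surj_d : surj d.
Proof.
have [c hc] := hcodim_mul hJ w1 w0 nzd_d (hN (leqnn d)) (hN (leqnSn d)).
rewrite -[RHS]add0n => /addIn ec; rewrite ec in hc.
move: hc => [U [hU]]; rewrite add0n => eU p hp.
have Uf : U = fullv.
  by apply/eqP; rewrite -(dimv_leqif_eq (subvf U)) eU dim_dhomog.
by apply/(hU (DHomog hp)); rewrite Uf memvf.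
Qed.

Lemma surjS e : surj e -> surj e.+1.
Proof.
move=> se p /homogS_split[q hq ->]; apply: idealP_sum => [|i _].
  by case: (addid_hideal hJ w1).
by case: (addid_hideal hJ w1) => [[_ _ h] _]; apply/h/se.
Qed.

Lemma surj_nzd e p : (d <= e)%N -> surj e -> p \is e.-homog -> J (w * p) -> J p.
Proof.
move=> le se hp Jwp.
have [U [hU eU]] := hN le; have [U' [hU' eU']] := hN (leqW le).
pose f := hmulf w1 e.
have fullE : (U' + f @: fullv)%VS = fullv.
  apply/vspaceP => v; rewrite memvf; apply/idP.
  have [q hq h] := addid_homog hJ w1 (dhomog_is_dhomog v) (se v (dhomog_is_dhomog v)).
  rewrite -(subrK (f (DHomog hq)) v); apply: memv_add; last by rewrite memv_img ?memvf.
  by apply/hU'; rewrite linearB /= [X in _ - X]hmulfE.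
have sub : (f @: U <= U' :&: f @: fullv)%VS.
  apply/subvP => v /(hmulf_memP w1)[q /hU Jq ev]; rewrite memv_cap; apply/andP; split.
    by apply/hU'; rewrite [X in J X]ev; apply: JM.
  by apply/(hmulf_memP w1); exists q; rewrite ?memvf.
have := dimv_sum_cap U' (f @: fullv).
rewrite fullE (dim_hmulf w1 w0) !dim_dhomog -eU' -eU [(N + \dim U')%N]addnC -!addnA.
move=> /addnI/addnI ecap.
have capE : (f @: U = U' :&: f @: fullv)%VS.
  by apply/eqP; rewrite -(dimv_leqif_eq sub) (dim_hmulf w1 w0) ecap.
pose v : dhomog 4 k e := DHomog hp.
have : f v \in (f @: U)%VS.
  rewrite capE memv_cap memv_img ?memvf // andbT; apply/hU'.
  by rewrite [X in J X]hmulfE.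
move=> /(hmulf_memP w1)[q /hU Jq]; rewrite hmulfE => /(mulfI w0) evq.
by rewrite -[p]/(val v) [X in J X]evq.
Qed.

Lemma nzd_all : nzd J w.
Proof.
have se e : (d <= e)%N -> surj e.
  move=> /subnK <-; elim: (e - d)%N => [|m IHm]; first exact: nzd_surj_d.
  by rewrite addSn; apply: surjS.
have hh m e p : p \is e.-homog -> (d <= m + e)%N -> J (w * p) -> J p.
  elim: m e p => [|m IHm] e p hp le Jwp; first by apply: (surj_nzd le) => //; apply: se.
  apply: hsat => i; apply: (IHm e.+1).
  - by rewrite -[e.+1]add1n; apply: dhomogM => //; rewrite dhomogX /= mdeg1.
  - by rewrite addnS -addSn.
  - by rewrite mulrCA; apply: JM.
move=> p Jwp; apply: homog_comp => // e.
apply: (hh d e); [exact: pihomogP | exact: leq_addr |].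
by rewrite -(pihomogMl e p w1); case: hJ => _; apply.
Qed.

End Propagate.

Lemma exists_nzd d N : (0 < N)%N -> (forall e, (d <= e)%N -> hcodim J e N) ->
  exists w, [/\ w \is 1.-homog, w != 0 & nzd J w].
Proof.
move=> N0 hN; have [w w1 hw] := exists_nzd_at (hN d (leqnn d)) (hN d.+1 (leqnSn d)).
have w0 : w != 0.
  apply/eqP => ew; have [U [hU eU]] := hN d (leqnn d).
  have Uf : U = fullv.
    apply/vspaceP => v; rewrite memvf; apply/hU/hw; first exact: dhomog_is_dhomog.
    by rewrite ew mul0r; apply: J0.
  by move: eU N0; rewrite Uf dim_dhomog -[RHS]add0n => /addIn ->.
by exists w; split=> //; apply: (nzd_all w1 w0 hN hw).
Qed.

End LinearNonzerodivisor.

(** * A linear system of parameters and the Hilbert function 1, 2, 3, 4 *)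

(** Here [h], [j], [e] are the Hilbert functions of S/J, S/(J,z), S/(J,z,w). The degree
10 is the sum of the e_d, and the genus 11 makes the sum of (d - 1) e_d equal to 10. As
e_d <= d + 1, the values 1, 2, 3, 4 in degrees 0 to 3 are the only possibility, and then
e_4 = 0 and J has no cubics. *)
Lemma hvector_numeric (h j e : nat -> nat) D : (4 <= D)%N ->
  (forall d, (d <= D)%N -> (e d <= d.+1)%N) ->
  j 0%N = h 0%N -> (forall d, (d < D)%N -> (j d.+1 + h d = h d.+1)%N) ->
  e 0%N = j 0%N -> (forall d, (d < D)%N -> (e d.+1 + j d = j d.+1)%N) ->
  h D = (10 * D - 10)%N -> j D = 10%N -> e 4%N = 0%N /\ h 3%N = 20%N.
Proof.
move=> leD he j0 hj e0 hE hD jD.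
have inv n : (4 + n <= D)%N ->
   (h (4 + n)%N + j (4 + n)%N <=
      4 * e 0%N + 3 * e 1%N + 2 * e 2%N + e 3%N + (n + 2) * j (4 + n)%N)%N /\
   (e 4%N + (e 0%N + e 1%N + e 2%N + e 3%N) <= j (4 + n)%N)%N.
  elim: n => [|n IHn] le.
    move: (hj 0%N) (hj 1%N) (hj 2%N) (hj 3%N) (hE 0%N) (hE 1%N) (hE 2%N) (hE 3%N).
    rewrite !(leq_trans _ leD) // addn0 => /(_ isT) h1 /(_ isT) h2 /(_ isT) h3 /(_ isT) h4.
    by move=> /(_ isT) h5 /(_ isT) h6 /(_ isT) h7 /(_ isT) h8; lia.
  have lt : (4 + n < D)%N by rewrite -addnS.
  move: (IHn (ltnW lt)) (hj _ lt) (hE _ lt); rewrite -addnS.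
  move: (h (4 + n)%N) (j (4 + n)%N) (h _) (j (4 + n.+1)%N) (e (4 + n.+1)%N) => h1 j1 h2 j2 e2.
  by move=> [i1 i2] i3 i4; split; nia.
have [|i1 i2] := inv (D - 4)%N; first by rewrite subnKC.
rewrite subnKC // in i1 i2.
move: (he 0%N) (he 1%N) (he 2%N) (he 3%N) (hj 0%N) (hj 1%N) (hj 2%N) (hE 0%N) (hE 1%N) (hE 2%N).
rewrite !(leq_trans _ leD) // => /(_ isT) h1 /(_ isT) h2 /(_ isT) h3 /(_ isT) h4.
move=> /(_ isT) h5 /(_ isT) h6 /(_ isT) h7 /(_ isT) h8 /(_ isT) h9 /(_ isT) h10.
rewrite hD jD in i1 i2.
by lia.
Qed.

Lemma big_ord4 (R : Type) (op : R -> R -> R) (idx : R) (F : 'I_4 -> R) :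
  \big[op/idx]_(i < 4) F i =
    op (F (inord 0)) (op (F (inord 1)) (op (F (inord 2)) (op (F (inord 3)) idx))).
Proof.
rewrite !big_ord_recl big_ord0; congr (op (F _) (op (F _) (op (F _) (op (F _) _))));
by apply: val_inj; rewrite /= inordK.
Qed.

Lemma two_var_span (k : fieldType) d (p : {mpoly k[4]}) : p \is d.-homog ->
  exists c : 'I_d.+1 -> k, exists q r, p =
    \sum_(i < d.+1) c i *: ('X_(inord 0) ^+ i * 'X_(inord 1) ^+ (d - i))
    + 'X_(inord 2) * q + 'X_(inord 3) * r.
Proof.
set X0 : 'I_4 := inord 0; set X1 : 'I_4 := inord 1.
set X2 : 'I_4 := inord 2; set X3 : 'I_4 := inord 3.
pose P (p : {mpoly k[4]}) := exists c : 'I_d.+1 -> k, exists q r, p =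
    \sum_(i < d.+1) c i *: ('X_X0 ^+ i * 'X_X1 ^+ (d - i)) + 'X_X2 * q + 'X_X3 * r.
move=> hp; rewrite -/(P p) [p]mpolyE big_seq; apply: (big_ind P).
- exists (fun=> 0), 0, 0; rewrite !mulr0 !addr0 big1 // => i _.
  by rewrite scale0r.
- move=> _ _ [c1 [q1 [r1 ->]]] [c2 [q2 [r2 ->]]].
  exists (fun i => c1 i + c2 i), (q1 + q2), (r1 + r2).
  under [in RHS]eq_bigr => i _ do rewrite scalerDl.
  by rewrite big_split /=; ring.
move=> e he; have de := dhomog_mf hp he; rewrite /= in de.
have div (i : 'I_4) : e i != 0%N -> 'X_[e] = 'X_i * 'X_[e - U_(i)] :> {mpoly k[4]}.
  by move=> ne; rewrite -mpolyXD addmC submK // lep1mP.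
have [e2|/div e2] := eqVneq (e X2) 0%N; last first.
  exists (fun=> 0), (p@_e *: 'X_[e - U_(X2)]), 0.
  rewrite big1 => [|i _]; last by rewrite scale0r.
  by rewrite e2 mulr0 add0r addr0 scalerAr.
have [e3|/div e3] := eqVneq (e X3) 0%N; last first.
  exists (fun=> 0), 0, (p@_e *: 'X_[e - U_(X3)]).
  rewrite big1 => [|i _]; last by rewrite scale0r.
  by rewrite e3 mulr0 !add0r scalerAr.
have dE : (e X0 + e X1)%N = d.
  by rewrite -de mdegE big_ord4 e2 e3 !addn0.
have lt : (e X0 < d.+1)%N by rewrite ltnS -dE leq_addr.
exists (fun i => if i == Ordinal lt then p@_e else 0), 0, 0.
rewrite !mulr0 !addr0 (bigD1 (Ordinal lt)) //= eqxx big1 ?addr0; last first.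
  by move=> i /negPf->; rewrite scale0r.
congr (_ *: _); rewrite mpolyXE_id big_ord4 e2 e3.
by rewrite !expr0 !mulr1 -dE addKn.
Qed.

Lemma complete_rows (k : fieldType) (A : 'M[k]_(2, 4)) : row_free A ->
  exists2 G : 'M[k]_4, G \in unitmx &
    row (inord 2) G = row 0 A /\ row (inord 3) G = row 1 A.
Proof.
move=> fA; have rC : \rank (A^C)%MS = 2%N.
  by rewrite mxrank_compl (eqP fA).
pose B := castmx (rC, erefl 4%N) (row_base (A^C)%MS).
pose G : 'M[k]_(2 + 2, 4) := col_mx B A.
have eB : (B :=: (A^C))%MS.
  by apply: eqmx_trans (eqmx_cast _ _) (eq_row_base _).
have rG : \rank G = 4%N.
  rewrite -addsmxE (adds_eqmx eB (eqmx_refl A)) addsmxC.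
  by apply/eqP; rewrite -/(row_full _) addsmx_compl_full.
exists (G : 'M[k]_4); first by rewrite -row_free_unit; apply/eqP.
have -> : inord 2 = rshift 2 0 :> 'I_(2 + 2) by apply: val_inj; rewrite /= inordK.
have -> : inord 3 = rshift 2 1 :> 'I_(2 + 2) by apply: val_inj; rewrite /= inordK.
by split; exact: rowKd.
Qed.

Lemma row_free2 (k : fieldType) n (a b : 'rV[k]_n) :
  (forall c0 c1 : k, c0 *: a + c1 *: b = 0 -> c0 = 0 /\ c1 = 0) ->
  row_free (col_mx a b : 'M_(1 + 1, n)).
Proof.
move=> h; apply: inj_row_free => c; rewrite -[c]hsubmxK mul_row_col.
rewrite [lsubmx c]mx11_scalar [rsubmx c]mx11_scalar !mul_scalar_mx.
by move=> /h[-> ->]; rewrite !raddf0 row_mx0.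
Qed.

Section LinearSystemOfParameters.
Variable k : closedFieldType.
Implicit Types (p q : {mpoly k[4]}).

Lemma homogeneous_hidealP (I : {pred {mpoly k[4]}}) :
  homogeneous_ideal I -> hidealP (fun p => p \in I).
Proof.
move=> [[I0 _ IM] Ih]; split; last by move=> p d Ip; apply: Ih.
split=> // [p q Ip Iq|c p Ip].
  by rewrite -[p]mul1r; apply: IM.
by rewrite -[c * p]addr0; apply: IM.
Qed.

Lemma sum_X_ideal (J : {mpoly k[4]} -> Prop) d u p : idealP J -> (0 < d)%N ->
  u \is d.-homog -> (forall i : 'I_4, J ('X_i * p)) -> J (u * p).
Proof.
move=> idJ; case: d => // d _ /homogS_split[q _ ->] h; rewrite big_distrl /=.
apply: idealP_sum => // i _; rewrite mulrAC mulrC.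
by case: idJ => _ _; apply; apply: h.
Qed.

(** The Cohen-Macaulay property gives depth one for S/(J,z), whichever linear
non-zero-divisor z is chosen: an element killed by all variables is killed by u and v, and
the relation between the two quotients unwinds along the regular sequence u, v. *)
Lemma acm_saturated (J : {mpoly k[4]} -> Prop) d1 d2 u v z :
  hidealP J -> (0 < d1)%N -> u \is d1.-homog -> (0 < d2)%N -> v \is d2.-homog ->
  (forall p, J (u * p) -> J p) ->
  (forall p q, J (v * p - u * q) -> exists q', J (p - u * q')) ->
  z \is 1.-homog -> nzd J z ->
  forall p, (forall i : 'I_4, addid J z ('X_i * p)) -> addid J z p.
Proof.
move=> hJ d1p hu d2p hv nu nv hz nz p hp.
have [[J0 JD JM] _] := hJ; have [idJz _] := addid_hideal hJ hz.
have [q hq] := sum_X_ideal idJz d1p hu hp.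
have [q' hq'] := sum_X_ideal idJz d2p hv hp.
have : J (v * q - u * q').
  apply: nz; have -> : z * (v * q - u * q') =
    (- v) * (u * p - z * q) + u * (v * p - z * q') by ring.
  by apply: (JD); apply: (JM).
move=> /nv[w hw]; exists w; apply: nu.
have -> : u * (p - z * w) = (u * p - z * q) + z * (q - u * w) by ring.
by apply: (JD) => //; apply: (JM).
Qed.

(** The ideal J in the coordinates given by the linear substitution G. *)
Definition pullback (G : 'M[k]_4) (J : {mpoly k[4]} -> Prop) p := J (lsubst G p).

Lemma pullback_hideal G J : hidealP J -> hidealP (pullback G J).
Proof.
move=> [[J0 JD JM] Jh]; split; first split.
- by rewrite /pullback rmorph0.
- by move=> p q Jp Jq; rewrite /pullback rmorphD; apply: JD.
- by move=> c p Jp; rewrite /pullback rmorphM; apply: JM.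
by move=> p d Jp; rewrite /pullback -lsubst_pihomog; apply: Jh.
Qed.

Lemma pullback_addid G J z p : G \in unitmx ->
  pullback G (addid J (lsubst G z)) p <-> addid (pullback G J) z p.
Proof.
move=> uG; split=> [[q hq]|[q hq]].
  exists (lsubst (invmx G) q); rewrite /pullback rmorphB rmorphM /= lsubst_comp.
  by rewrite mulVmx // lsubst1.
by exists (lsubst G q); move: hq; rewrite /pullback rmorphB rmorphM.
Qed.

Lemma addid_mono (J J' : {mpoly k[4]} -> Prop) z p : (forall q, J q -> J' q) ->
  addid J z p -> addid J' z p.
Proof. by move=> h [q hq]; exists q; apply: h. Qed.

(** In suitable coordinates x_2, x_3 is a regular sequence on S/J'; the last two conclusions
record that the Artinian reduction has Hilbert function 1, 2, 3, 4. *)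
Lemma lin_sop (J : {mpoly k[4]} -> Prop) d0 :
  hidealP J -> (forall p q, J (p * q) -> J p \/ J q) ->
  (exists d1 d2 u v, [/\ (0 < d1)%N /\ u \is d1.-homog, (0 < d2)%N /\ v \is d2.-homog,
     forall p, J (u * p) -> J p &
     forall p q, J (v * p - u * q) -> exists q', J (p - u * q')]) ->
  (forall d, (d0 <= d)%N -> hcodim J d (10 * d - 10)) ->
  exists2 G : 'M[k]_4, G \in unitmx &
   let J' := pullback G J in
   [/\ hidealP J', nzd J' 'X_(inord 2), nzd (addid J' 'X_(inord 2)) 'X_(inord 3),
       forall p, p \is 3.-homog -> J' p -> p = 0 &
       forall p, p \is 4.-homog -> addid (addid J' 'X_(inord 2)) 'X_(inord 3) p].
Proof.
move=> hJ pJ [d1 [d2 [u [v [[d1p hu] [d2p hv] nu nv]]]]] hH.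
have [[J0 JD JM] Jh] := hJ; have idJ : idealP J by case: hJ.
(* A variable outside the prime J is a non-zero-divisor; all variables in J would make S/J finite. *)
have [i0 ni0] : exists i : 'I_4, ~ J 'X_i.
  apply: NNPP => no; pose D := maxn d0 2.
  have [U [hU eU]] := hH D (leq_maxl _ _).
  have : U = fullv.
    apply/vspaceP => x; rewrite memvf; apply/hU; rewrite -[X in J X]mulr1.
    apply: (sum_X_ideal idJ _ (dhomog_is_dhomog x)); first by rewrite (leq_trans _ (leq_maxr _ _)).
    by move=> i; rewrite mulr1; apply: NNPP => ni; apply: no; exists i.
  move=> Uf; move: eU; rewrite Uf dim_dhomog -[RHS]add0n => /addIn.
  by have := leq_maxr d0 2; rewrite -/D; lia.
pose z : {mpoly k[4]} := 'X_i0.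
have hz : z \is 1.-homog by rewrite dhomogX /= mdeg1.
have z0 : z != 0 by apply/eqP => e; apply: ni0; rewrite -/z e.
have nz : nzd J z by move=> p /pJ[].
have hJ1 := addid_hideal hJ hz.
have step d a b : hcodim J d a -> hcodim J d.+1 b ->
    exists2 c, hcodim (addid J z) d.+1 c & (c + a)%N = b.
  by apply: hcodim_mul => // p _; apply: nz.
have c10 d : (maxn d0 2 < d)%N -> hcodim (addid J z) d 10.
  case: d => // d; rewrite ltnS geq_max => /andP[le0 le2].
  have [c hc ec] := step d _ _ (hH d le0) (hH d.+1 (leqW le0)).
  by have -> : 10%N = c by lia.
have sat := acm_saturated hJ d1p hu d2p hv nu nv hz nz.
have [w [hw w0 nw]] := exists_nzd hJ1 sat (isT : (0 < 10)%N) c10.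
pose K := addid (addid J z) w.
have hK : hidealP K by apply: addid_hideal.
have step1 d a b : hcodim (addid J z) d a -> hcodim (addid J z) d.+1 b ->
    exists2 c, hcodim K d.+1 c & (c + a)%N = b.
  by apply: hcodim_mul => // p _; apply: nw.
pose vz := \row_i z@_U_(i); pose vw := \row_i w@_U_(i).
have ez : z = lin vz by apply: homog1_lin.
have ew : w = lin vw by apply: homog1_lin.
have not1 : ~ addid J z 1.
  move=> h1; have [U [hU eU]] := c10 (maxn d0 2).+1 (ltnSn _).
  have Uf : U = fullv.
    apply/vspaceP => x; rewrite memvf; apply/hU; rewrite -[X in addid J z X]mulr1.
    by case: hJ1 => [[_ _ h] _]; apply: h.
  by move: eU; rewrite Uf dim_dhomog -[RHS]add0n => /addIn.
pose A : 'M[k]_(2, 4) := col_mx vz vw.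
have fA : row_free A.
  apply: row_free2 => c0 c1 e.
  have {}e : c0 *: z + c1 *: w = 0 by rewrite ez ew -!linZ -linearD e linear0.
  have c10' : c1 = 0.
    apply/eqP/negP => /negP nc; apply: not1; apply: nw.
    exists ((- c0 / c1)%:MP); rewrite mulr1.
    have -> : w - z * (- c0 / c1)%:MP = c1^-1 *: (c0 *: z + c1 *: w).
      rewrite scalerDr !scalerA mulVf // scale1r mulrC mul_mpolyC addrC.
      by rewrite mulNr scaleNr opprK mulrC.
    by rewrite e scaler0; apply: J0.
  have c00 : c0 = 0.
    move/eqP: e; rewrite c10' scale0r addr0 -mul_mpolyC mulf_eq0 (negPf z0) orbF.
    by rewrite mpolyC_eq0 => /eqP.
  by [].
have [G uG [G2 G3]] := complete_rows fA.
have eG2 : lsubst G 'X_(inord 2) = z.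
  rewrite lsubstX G2 ez; congr lin; apply/rowP => i; rewrite !mxE.
  by case: splitP => j //=; rewrite mxE.
have eG3 : lsubst G 'X_(inord 3) = w.
  rewrite lsubstX G3 ew; congr lin; apply/rowP => i; rewrite !mxE.
  by case: splitP => j /=; [rewrite ord1 | rewrite !mxE].
have GK p : lsubst G (lsubst (invmx G) p) = p.
  by rewrite lsubst_comp mulVmx // lsubst1.
have KG p : lsubst (invmx G) (lsubst G p) = p.
  by rewrite lsubst_comp mulmxV // lsubst1.
have pb1 p : pullback G (addid J z) p <-> addid (pullback G J) 'X_(inord 2) p.
  by rewrite -eG2; apply: pullback_addid.
have pb2 p : pullback G K p -> addid (addid (pullback G J) 'X_(inord 2)) 'X_(inord 3) p.
  rewrite /K -eG3 => /(pullback_addid _ _ _ uG); apply: addid_mono => q; apply: (pb1 q).1.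
(* Beyond D the Hilbert functions of S/J and S/(J,z) agree with their polynomials. *)
pose D := (maxn d0 2).+2.
have [h hh] := nat_choice 0%N (fun d (_ : (d < D.+1)%N) => hcodim_exists d hJ).
have [j hj] := nat_choice 0%N (fun d (_ : (d < D.+1)%N) => hcodim_exists d hJ1).
have [e he] := nat_choice 0%N (fun d (_ : (d < D.+1)%N) => hcodim_exists d hK).
(* Modulo z, w the binary monomials span. *)
have le_e d : (d <= D)%N -> (e d <= d.+1)%N.
  move=> le; apply: (@hcodim_span _ K d (e d) d.+1
     (fun i => lsubst G ('X_(inord 0) ^+ i * 'X_(inord 1) ^+ (d - i)))) => //.
    exact: he.
  have [[_ _ KM] _] := hK; split=> [i|p hp].
    have := dhomogM (dhomogMn i (_ : 'X_(inord 0) \is 1.-homog))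
       (dhomogMn (d - i) (_ : ('X_(inord 1) : {mpoly k[4]}) \is 1.-homog)).
    rewrite !mul1n subnKC -1?ltnS // => hX; apply: lsubst_homog; apply: hX;
    by rewrite dhomogX /= mdeg1.
  have [c [q [r ep]]] := two_var_span (lsubst_homog (invmx G) hp).
  exists c; have -> : p - \sum_(i < d.+1) c i *: lsubst G ('X_(inord 0) ^+ i * 'X_(inord 1) ^+ (d - i)) =
     z * lsubst G q + w * lsubst G r.
    rewrite -{1}[p]GK ep !rmorphD !rmorphM /= eG2 eG3 (linear_sum (lsubst G)) /=.
    under eq_bigr => i _ do rewrite lsubstZ.
    by rewrite addrAC [X in X + _]addrAC subrr add0r.
  exists (lsubst G r); rewrite addrK; exists (lsubst G q).
  by rewrite subrr; apply: J0.
have deg0 (J1 : {mpoly k[4]} -> Prop) x n : x \is 1.-homog -> hidealP J1 ->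
    hcodim J1 0 n -> hcodim (addid J1 x) 0 n.
  move=> hx hJ1' [U [hU eU]]; exists U; split=> // y; split=> [/hU|[q hq]].
    exact: addid_sub.
  have := hJ1'.2 _ 0%N hq; rewrite raddfB /= (pihomogMl0 q hx) // subr0 pihomog_dE.
    by move/hU.
  exact: dhomog_is_dhomog.
have [||||||||e4 h3] := @hvector_numeric h j e D.
- by rewrite /D !ltnS; apply: leq_maxr.
- exact: le_e.
- apply: (hcodim_uniq (hj 0%N isT)); apply: deg0 => //; exact: hh.
- move=> d lt; have [c hc ec] := step d _ _ (hh d (ltnW lt)) (hh d.+1 lt).
  by rewrite (hcodim_uniq (hj d.+1 lt) hc).
- apply: (hcodim_uniq (he 0%N isT)); apply: deg0 => //; exact: hj.
- move=> d lt; have [c hc ec] := step1 d _ _ (hj d (ltnW lt)) (hj d.+1 lt).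
  by rewrite (hcodim_uniq (he d.+1 lt) hc).
- apply: (hcodim_uniq (hh D (ltnSn _))); apply: hH.
  exact: leq_trans (leq_maxl d0 2) (leq_trans (leqnSn _) (leqnSn _)).
- by apply: (hcodim_uniq (hj D (ltnSn _))); apply: c10; rewrite /D ltnS leqnSn.
exists G => //=; split.
- exact: pullback_hideal.
- by move=> p; rewrite /pullback rmorphM /= eG2; apply: nz.
- move=> p /pb1; rewrite /pullback rmorphM /= eG3 => /nw hp.
  by apply/pb1.
- move=> p hp Jp; have := hh 3%N (leq_trans (isT : (3 < 5)%N) _).
  rewrite h3 => /(_ _)[|U [hU eU]]; first by rewrite /D !ltnS leq_max orbT.
  have U0 : U = 0%VS.
    by apply/eqP; rewrite -dimv_eq0 -(eqn_add2l 20) eU.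
  have : DHomog (lsubst_homog G hp) \in U by apply/hU.
  rewrite U0 memv0 => /eqP/(congr1 val) /= e0.
  by rewrite -[p]KG e0 raddf0.
move=> p hp; apply: pb2.
have := he 4%N (leq_trans (isT : (4 < 5)%N) _).
rewrite e4 => /(_ _)[|U [hU eU]]; first by rewrite /D !ltnS leq_max orbT.
have Uf : U = fullv.
  by apply/eqP; rewrite -(dimv_leqif_eq (subvf U)) dim_dhomog -eU.
by apply/(hU (DHomog (lsubst_homog G hp))); rewrite Uf memvf.
Qed.

End LinearSystemOfParameters.

(** * Regular pairs of polynomials *)

Section RegularPair.
Variable T : idomainType.
Implicit Types p q a b : T.

(** That p, q is a regular sequence: p is a non-zero-divisor modulo q. It stands for coprimality
without unique factorization. *)
Definition rpair p q := forall a b, a * p = b * q -> exists c, a = c * q.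

Lemma rpair_sym p q : p != 0 -> q != 0 -> rpair p q -> rpair q p.
Proof.
move=> p0 q0 h a b e; have [c ec] := h _ _ (esym e).
by exists c; apply: (mulIf q0); rewrite e ec mulrAC.
Qed.

Lemma rpairX p q m : q != 0 -> rpair p q -> rpair p (q ^+ m).
Proof.
move=> q0 h; elim: m => [|m IHm] a b e; first by exists a; rewrite expr0 mulr1.
rewrite exprSr mulrA in e; have [c ec] := h _ _ e.
move: e; rewrite ec mulrAC => /(mulIf q0)/IHm[c' ->].
by exists c'; rewrite exprSr mulrA.
Qed.

Lemma rpairXX p q m n : p != 0 -> q != 0 -> rpair p q -> rpair (p ^+ m) (q ^+ n).
Proof.
move=> p0 q0 h; have p1 : p ^+ m != 0 by rewrite expf_neq0.
apply: rpairX => //; apply: rpair_sym => //.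
by apply: rpairX => //; apply: rpair_sym.
Qed.

End RegularPair.

Section Kill.
Variables (R : comNzRingType) (n : nat).
Implicit Types (p q : {mpoly R[n]}) (i j : 'I_n).

Definition kill i := lsubst (1%:M - delta_mx i i : 'M[R]_n).
HB.instance Definition _ i := GRing.RMorphism.on (kill i).
HB.instance Definition _ i := GRing.Linear.on (kill i).

Lemma killX i j : kill i 'X_j = if j == i then 0 else 'X_j.
Proof.
rewrite /kill lsubstX linearB /= row1 linearB /= lin_delta.
have -> : row j (delta_mx i i : 'M[R]_n) = (j == i)%:R *: delta_mx 0 i.
  by apply/rowP => l; rewrite !mxE eqxx /= -natrM mulnb.
rewrite linZ lin_delta; case: eqP => [->|_]; first by rewrite scale1r subrr.
by rewrite scale0r subr0.
Qed.

Lemma killC i c : kill i c%:MP = c%:MP.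
Proof. exact: comp_mpolyC. Qed.

Lemma kill_mod i p : exists q, p = kill i p + 'X_i * q.
Proof.
move: p; apply: mpoly_ind_ring.
- by move=> c; exists 0; rewrite killC mulr0 addr0.
- move=> j; rewrite killX; case: eqP => [->|_]; first by exists 1; rewrite mulr1 add0r.
  by exists 0; rewrite mulr0 addr0.
- move=> p q [a ea] [b eb]; exists (a + b).
  by rewrite rmorphD {1}ea {1}eb; ring.
move=> p q [a ea] [b eb]; exists (a * kill i q + kill i p * b + 'X_i * a * b).
by rewrite rmorphM {1}ea {1}eb; ring.
Qed.

Lemma kill_homog i d p : p \is d.-homog -> kill i p \is d.-homog.
Proof. exact: lsubst_homog. Qed.

(* Unfolding these substitutions would make unification compare polynomials by their coefficients. *)
Opaque kill lsubst.

Lemma kill_idem i p : kill i (kill i p) = kill i p.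
Proof.
move: p; apply: (@rmorph_mpoly_ext _ _ _ (kill i \o kill i)%FUN (kill i)).
  by move=> c; rewrite /= !killC.
by move=> j; rewrite /= !killX; case: eqP => [_|ne]; rewrite ?rmorph0 ?killX //; case: eqP.
Qed.

Lemma killK i j p : kill i (kill j p) = kill j (kill i p).
Proof.
move: p; apply: (@rmorph_mpoly_ext _ _ _ (kill i \o kill j)%FUN (kill j \o kill i)%FUN).
  by move=> c; rewrite /= !killC.
by move=> l; rewrite /= !killX; do 2 case: eqP; rewrite ?rmorph0 ?killX //;
   do 2 ?case: eqP => //; rewrite rmorph0.
Qed.

End Kill.

Lemma mpolyX_neq0 (R : nzRingType) (n : nat) (i : 'I_n) : ('X_i : {mpoly R[n]}) != 0.
Proof.
apply/eqP => /(congr1 (mcoeff U_(i))); rewrite mcoeffXU eqxx mcoeff0 => /eqP.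
by rewrite oner_eq0.
Qed.

Lemma rpair_mpolyX (R : idomainType) (n : nat) (i j : 'I_n) :
  i != j -> rpair ('X_i : {mpoly R[n]}) 'X_j.
Proof.
move=> ne a b e; have [q eq] := kill_mod j a; exists q.
have := congr1 (kill j) e; rewrite !rmorphM /= !killX eqxx (negPf ne) mulr0 => /eqP.
rewrite mulf_eq0 (negPf (mpolyX_neq0 _ i)) orbF => /eqP k0.
by rewrite eq k0 add0r mulrC.
Qed.

(** Regularity of a pair of forms lifts from the quotient by a variable x: [psi] sets x to 0,
[phi] sets fewer variables to 0. The correction terms lose a degree at each step, so the
lifting stops. *)
Section RegularPairLift.
Variables (R : idomainType) (n : nat).
Local Notation S := {mpoly R[n]}.
Implicit Types (p q a b c : S).

Definition rpair_on (phi : S -> S) p q :=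
  forall a b, phi a * phi p = phi b * phi q -> exists c, phi a = phi c * phi q.

Lemma rpair_on_idem (phi : {rmorphism S -> S}) p q :
  (forall y, phi (phi y) = phi y) -> rpair (phi p) (phi q) -> rpair_on phi p q.
Proof.
move=> idem h a b /h[c ec]; exists c.
by rewrite -[LHS]idem ec rmorphM idem.
Qed.

Variables (phi psi : {rmorphism S -> S}) (x : S).
Hypothesis phi_homog : forall d p, p \is d.-homog -> phi p \is d.-homog.
Hypothesis psi_homog : forall d p, p \is d.-homog -> psi p \is d.-homog.
Hypothesis x1 : x \is 1.-homog.
Hypothesis x0 : x != 0.
Hypothesis phix : phi x = x.
Hypothesis phi_psi : forall p, exists q, phi p = psi p + x * phi q.
Hypothesis psiphi : forall p, psi (phi p) = psi p.
Hypothesis phipsi : forall p, phi (psi p) = psi p.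
Variables (p q : S) (e : nat).
Hypotheses (pe : p \is e.-homog) (qe : q \is e.-homog) (q0 : psi q != 0).
Hypothesis rpsi : rpair_on psi p q.

Lemma rpair_lift_step d a b : a \is d.-homog -> b \is d.-homog ->
  phi a * phi p = phi b * phi q -> exists c a1 b1,
  [/\ phi c = c, phi a - c * phi q = x * phi a1, phi b - c * phi p = x * phi b1,
      phi a - c * phi q \is d.-homog & phi b - c * phi p \is d.-homog].
Proof.
move=> ha hb eab.
have epsi : psi a * psi p = psi b * psi q.
  by rewrite -[psi a]psiphi -[psi p]psiphi -rmorphM eab rmorphM /= !psiphi.
have [c0 ec0] := rpsi epsi.
have [c [ec hc]] : exists c, psi a = psi c * psi q /\
    forall r, r \is e.-homog -> psi c * r \is d.-homog.
  case: (leqP e d) => hed; last first.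
    exists 0; rewrite rmorph0 mul0r; split; last by move=> r _; rewrite mul0r rpred0.
    by rewrite -(pihomog_dE (psi_homog ha)) ec0 mulrC (pihomogMl0 _ (psi_homog qe)).
  have psi_pi m r : psi (pihomog mdeg m r) = pihomog mdeg m (psi r).
    by rewrite (additive_pihomog psi_homog).
  exists (pihomog mdeg (d - e) c0); split.
    rewrite -(pihomog_dE (psi_homog ha)) ec0 mulrC -{1}(subnKC hed).
    by rewrite (pihomogMl _ _ (psi_homog qe)) mulrC psi_pi.
  move=> r hr.
  by have := dhomogM (psi_homog (pihomogP mdeg (d - e) c0)) hr; rewrite subnK.
have ecb : psi b = psi c * psi p.
  by apply: (mulIf q0); rewrite -epsi ec mulrAC.
have [a2 ea2] := phi_psi a; have [b2 eb2] := phi_psi b.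
have [p2 ep2] := phi_psi p; have [q2 eq2] := phi_psi q.
exists (psi c), (a2 - psi c * q2), (b2 - psi c * p2); split.
- exact: phipsi.
- by rewrite ea2 eq2 ec rmorphB rmorphM /= phipsi; ring.
- by rewrite eb2 ep2 ecb rmorphB rmorphM /= phipsi; ring.
- by apply: rpredB; [apply: phi_homog | apply: hc; apply: phi_homog].
- by apply: rpredB; [apply: phi_homog | apply: hc; apply: phi_homog].
Qed.

Lemma rpair_lift_homog d a b : a \is d.-homog -> b \is d.-homog ->
  phi a * phi p = phi b * phi q -> exists c, phi a = phi c * phi q.
Proof.
elim: d a b => [|d IHd] a b ha hb eab.
all: have [c [a1 [b1 [phic ea eb hda hdb]]]] := rpair_lift_step ha hb eab.
  exists c; apply/eqP; rewrite phic -subr_eq0; apply/eqP.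
  by rewrite -(pihomog_dE hda) ea (pihomogMl0 _ x1).
have phi_pi m r : phi (pihomog mdeg m r) = pihomog mdeg m (phi r).
  by rewrite (additive_pihomog phi_homog).
have ea' : phi a - c * phi q = x * phi (pihomog mdeg d a1).
  by rewrite -(pihomog_dE hda) ea -[d.+1]add1n (pihomogMl _ _ x1) phi_pi.
have eb' : phi b - c * phi p = x * phi (pihomog mdeg d b1).
  by rewrite -(pihomog_dE hdb) eb -[d.+1]add1n (pihomogMl _ _ x1) phi_pi.
have [|||c' ec'] := IHd (pihomog mdeg d a1) (pihomog mdeg d b1).
- exact: pihomogP.
- exact: pihomogP.
- apply: (mulfI x0); rewrite !mulrA -ea' -eb' !mulrBl eab; congr (_ - _).
  by rewrite mulrAC.
exists (c + x * c').
move/eqP: ea'; rewrite subr_eq => /eqP ->; rewrite ec' rmorphD rmorphM /= phix phic.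
by ring.
Qed.

Lemma rpair_lift : rpair_on phi p q.
Proof.
move=> a b eab.
have phi_pi m r : phi (pihomog mdeg m r) = pihomog mdeg m (phi r).
  by rewrite (additive_pihomog phi_homog).
have h d : exists c, phi (pihomog mdeg d a) = phi c * phi q.
  apply: (@rpair_lift_homog d _ (pihomog mdeg d b)); [exact: pihomogP | exact: pihomogP |].
  rewrite !phi_pi mulrC -(pihomogMl _ _ (phi_homog pe)) mulrC eab mulrC.
  by rewrite (pihomogMl _ _ (phi_homog qe)) mulrC.
have [c hc] := @nat_choice _ (0 : S) (msize a)
   (fun d c => phi (pihomog mdeg d a) = phi c * phi q) (fun d _ => h d).
exists (\sum_(d < msize a) c d).
rewrite {1}[a](pihomog_partitionE (leqnn (msize a))) !rmorph_sum mulr_suml /=.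
by apply: eq_bigr => d _; apply: hc.
Qed.

End RegularPairLift.

Section TwoLifts.
Variables (R : idomainType) (n : nat).
Local Notation S := {mpoly R[n]}.
Variables (k2 k3 : {rmorphism S -> S}) (x2 x3 : S).
Hypothesis k2_homog : forall d p, p \is d.-homog -> k2 p \is d.-homog.
Hypothesis k3_homog : forall d p, p \is d.-homog -> k3 p \is d.-homog.
Hypotheses (x2h : x2 \is 1.-homog) (x3h : x3 \is 1.-homog).
Hypotheses (x2_neq0 : x2 != 0) (x3_neq0 : x3 != 0).
Hypothesis k3x2 : k3 x2 = x2.
Hypothesis k2_mod : forall p, exists q, p = k2 p + x2 * q.
Hypothesis k3_mod : forall p, exists q, p = k3 p + x3 * q.
Hypothesis k2_idem : forall p, k2 (k2 p) = k2 p.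
Hypothesis k3_idem : forall p, k3 (k3 p) = k3 p.
Hypothesis k23 : forall p, k2 (k3 p) = k3 (k2 p).

Lemma rpair_two_lifts P Q e : P \is e.-homog -> Q \is e.-homog -> k2 (k3 Q) != 0 ->
  rpair (k2 (k3 P)) (k2 (k3 Q)) -> rpair P Q.
Proof.
move=> hP hQ Q0 rPQ; pose red : {rmorphism S -> S} := (k2 \o k3)%FUN.
have base : rpair_on red P Q.
  by apply: rpair_on_idem => // p; rewrite /= -k23 k2_idem k3_idem.
have k3Q0 : k3 Q != 0 by apply: contra Q0 => /eqP ->; rewrite rmorph0.
have step : rpair_on k3 P Q.
  apply: (@rpair_lift _ _ k3 red x2 _ _ _ _ _ _ _ _ P Q e) => //.
  - by move=> d p hp; apply/k2_homog/k3_homog.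
  - move=> p; have [q eq] := k2_mod p; exists q.
    by rewrite {1}eq rmorphD rmorphM k3x2 -k23.
  - by move=> p; rewrite /= k3_idem.
  - by move=> p; rewrite /= -k23 k3_idem.
suff h : rpair_on idfun P Q by move=> a b; apply: h.
by apply: (@rpair_lift _ _ idfun k3 x3 _ _ _ _ _ _ _ _ P Q e).
Qed.

End TwoLifts.

Section HilbertBurch.
Variable k : fieldType.
Local Notation S := {mpoly k[4]}.
Implicit Types (p q r : S).
Local Notation X0 := ('X_(inord 0) : S).
Local Notation X1 := ('X_(inord 1) : S).
Local Notation X2 := ('X_(inord 2) : S).
Local Notation X3 := ('X_(inord 3) : S).

Let X_homog (i : 'I_4) : ('X_i : S) \is 1.-homog.
Proof. by rewrite dhomogX /= mdeg1. Qed.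

Lemma inord4_neq i j : (i < 4)%N -> (j < 4)%N -> i != j -> (inord i == inord j :> 'I_4) = false.
Proof. by move=> hi hj ne; rewrite -val_eqE /= !inordK // (negPf ne). Qed.

Definition red p := kill (inord 2) (kill (inord 3) p).
HB.instance Definition _ := GRing.RMorphism.copy red
  (kill (inord 2 : 'I_4) \o kill (inord 3 : 'I_4))%FUN.

Lemma redX i : (i < 4)%N -> red 'X_(inord i) = if (i < 2)%N then 'X_(inord i) else 0.
Proof.
move=> lt; rewrite /red killX; case: eqP => [e|ne].
  move: (congr1 val e) => /=; rewrite !inordK // => ->.
  by rewrite rmorph0.
rewrite killX; case: eqP => [e|ne'].
  by move: (congr1 val e) => /=; rewrite !inordK // => ->.
case: i lt ne ne' => [|[|[|[|]]]] //.
Qed.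

Lemma red_mod p : exists q r, p = red p + X2 * q + X3 * r.
Proof.
have [r er] := kill_mod (inord 3) p.
have [q eq] := kill_mod (inord 2) (kill (inord 3) p).
by exists q, r; rewrite {1}er {1}eq.
Qed.

Lemma rpair_forms (P Q : S) e m : P \is e.-homog -> Q \is e.-homog ->
  red P = X1 ^+ m -> red Q = X0 ^+ m -> rpair P Q.
Proof.
move=> hP hQ rP rQ.
have rQ0 : red Q != 0 by rewrite rQ expf_neq0 // mpolyX_neq0.
apply: (@rpair_two_lifts _ _ (kill (inord 2)) (kill (inord 3)) X2 X3 _ _
  _ _ _ _ _ _ _ _ _ _ P Q e hP hQ rQ0).
- by move=> d p; apply: kill_homog.
- by move=> d p; apply: kill_homog.
- exact: X_homog.
- exact: X_homog.
- exact: mpolyX_neq0.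
- exact: mpolyX_neq0.
- by rewrite /= killX inord4_neq.
- by move=> p; apply: kill_mod.
- by move=> p; apply: kill_mod.
- by move=> p; apply: kill_idem.
- by move=> p; apply: kill_idem.
- by move=> p; apply: killK.
have h : rpair (red P) (red Q).
  by rewrite rP rQ; apply: rpairXX; rewrite ?mpolyX_neq0 //; apply: rpair_mpolyX; rewrite inord4_neq.
exact: h.
Qed.

End HilbertBurch.

(** * Signed maximal minors *)

Section SignedMinors.
Variable R : comNzRingType.

Definition sminor n (M : 'M[R]_(n, n.+1)) (m : 'I_n.+1) : R := (-1) ^+ m * \det (col' m M).

Lemma sminor_expand n (M : 'M[R]_(n, n.+1)) (v : 'rV[R]_n.+1) :
  \sum_m sminor M m * v 0 m = \det (col_mx v M : 'M_(1 + n)).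
Proof.
rewrite (expand_det_row _ ord0); apply: eq_bigr => m _.
rewrite /cofactor add0n mulrC; congr (_ * _).
  have -> : (ord0 : 'I_(1 + n)) = lshift n (0 : 'I_1) by apply: val_inj.
  exact: (esym (col_mxEu v M 0 m)).
congr (_ * \det _); apply/matrixP => i j; rewrite !mxE.
case: splitP => [i'|i' /= e]; first by rewrite ord1.
by congr (M _ _); apply: val_inj; move: e; rewrite /= /bump leq0n !add1n => -[->].
Qed.

Lemma sminor_kernel n (M : 'M[R]_(n, n.+1)) i : \sum_m M i m * sminor M m = 0.
Proof.
have -> : \sum_m M i m * sminor M m = \det (col_mx (row i M) M : 'M_(1 + n)).
  by rewrite -sminor_expand; apply: eq_bigr => m _; rewrite mxE mulrC.
apply: (@determinant_alternate _ _ _ (lshift n 0) (rshift 1 i)).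
  by rewrite eq_lrshift.
by move=> j; rewrite col_mxEu col_mxEd mxE.
Qed.

(** Cramer's rule: modulo the rows of the matrix, the coordinate vectors are proportional
to the signed minors. *)
Lemma sminor_rows n (M : 'M[R]_(n, n.+1)) i j : exists w : 'rV_n,
  sminor M i *: delta_mx 0 j - sminor M j *: delta_mx 0 i = w *m M.
Proof.
pose A : 'M_(1 + n) := col_mx (delta_mx 0 i) M.
have dA : \det A = sminor M i.
  rewrite -sminor_expand (bigD1 i) //= mxE !eqxx mulr1 big1 ?addr0 // => m /negPf ne.
  by rewrite mxE ne andbF mulr0.
have aj : (\adj A) j 0 = sminor M j.
  rewrite mxE /cofactor add0n; congr (_ * \det _); apply/matrixP => a b; rewrite !mxE.
  case: splitP => [i'|i' /= e]; first by rewrite ord1.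
  by congr (M _ _); apply: val_inj; move: e; rewrite /= /bump leq0n !add1n => -[->].
have := congr1 (row j) (mul_adj_mx A); rewrite row_mul dA.
pose v : 'rV_(1 + n) := row j (\adj A); rewrite -/v -[v]hsubmxK mul_row_col => e.
exists (rsubmx v).
have -> : sminor M i *: delta_mx 0 j = row j (sminor M i)%:M :> 'rV_n.+1.
  by apply/rowP => l; rewrite !mxE eqxx /= eq_sym mulr_natr.
rewrite -e [lsubmx v]mx11_scalar mul_scalar_mx.
have -> : (lsubmx v) 0 0 = sminor M j by rewrite [LHS]mxE [LHS]mxE -aj; congr fun_of_matrix; apply: val_inj.
by rewrite addrAC subrr add0r.
Qed.

Lemma sminor_cramer n (M : 'M[R]_(n, n.+1)) (F : 'I_n.+1 -> R) :
  (forall i, \sum_m M i m * F m = 0) ->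
  forall i j, sminor M i * F j = sminor M j * F i.
Proof.
move=> MF i j; have [w] := sminor_rows M i j.
have MF0 : M *m (\col_m F m) = 0.
  by apply/colP => a; rewrite !mxE -[RHS](MF a); apply: eq_bigr => m _; rewrite mxE.
move/(congr1 (fun v : 'rV_n.+1 => (v *m (\col_m F m)) 0 0)).
rewrite /= -mulmxA MF0 mulmx0 mulmxBl -!scalemxAl -!rowE !mxE => /eqP.
by rewrite subr_eq0 => /eqP.
Qed.

End SignedMinors.

(** * The Hilbert-Burch matrix *)

Lemma homog0_const (R : nzRingType) (n : nat) (p : {mpoly R[n]}) :
  p \is 0.-homog -> p = (p@_0)%:MP.
Proof.
move=> hp; apply/mpolyP => m; rewrite mcoeffC.
case: eqP => [<-|ne]; first by rewrite mulr1.
rewrite mulr0 (dhomog_nemf_coeff hp) //= mdeg_eq0.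
by apply/eqP => e; apply: ne.
Qed.

Lemma det_homogM (R : comNzRingType) (n m e : nat) (A : 'M[{mpoly R[n]}]_m) :
  (forall i j, A i j \is e.-homog) -> \det A \is (m * e).-homog.
Proof.
move=> hA; rewrite /determinant; apply: rpred_sum => s _.
rewrite -signr_odd mulr_sign.
set P0 := bigop _ _ _; suff hp : P0 \is (m * e).-homog by case: (odd _); rewrite ?rpredN.
have em : (\sum_(i < m) e = m * e)%N by rewrite sum_nat_const card_ord.
rewrite {}/P0 -[X in X.-homog]em; apply: (big_rec2 (fun p d => p \is d.-homog)) => [|i p d _ hp].
  exact: dhomog1.
by apply: dhomogM.
Qed.

Lemma det_homog (R : comNzRingType) (n m : nat) (A : 'M[{mpoly R[n]}]_m) :
  (forall i j, A i j \is 1.-homog) -> \det A \is m.-homog.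
Proof. by move/det_homogM; rewrite muln1. Qed.

(** The forms x, y, z, w are coordinates, [red] sets z and w to 0, and J satisfies the
conclusions of [lin_sop] with respect to z, w. *)
Section HilbertBurchForm.
Variable k : fieldType.
Local Notation S := {mpoly k[4]}.
Implicit Types (p q r : S).
Variables (J : S -> Prop) (x y z w : S) (red : {rmorphism S -> S}).
Hypotheses (x1 : x \is 1.-homog) (y1 : y \is 1.-homog).
Hypotheses (z1 : z \is 1.-homog) (w1 : w \is 1.-homog).
Hypotheses (x_neq0 : x != 0) (y_neq0 : y != 0) (z_neq0 : z != 0).
Hypotheses (redx : red x = x) (redy : red y = y) (redz : red z = 0) (redw : red w = 0).
Hypothesis redC : forall c, red c%:MP = c%:MP.
Hypothesis two_var : forall d p, p \is d.-homog -> exists c : 'I_d.+1 -> k, exists q r,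
  p = \sum_(i < d.+1) c i *: (x ^+ i * y ^+ (d - i)) + z * q + w * r.
Hypothesis rpair_red : forall P Q e m, P \is e.-homog -> Q \is e.-homog ->
  red P = y ^+ m -> red Q = x ^+ m -> rpair P Q.

Hypothesis hJ : hidealP J.
Hypotheses (nz : nzd J z) (nw : nzd (addid J z) w).
Hypothesis J3 : forall p, p \is 3.-homog -> J p -> p = 0.
Hypothesis full4 : forall p, p \is 4.-homog -> addid (addid J z) w p.

Let JD : forall p q, J p -> J q -> J (p + q) := let: conj (And3 _ h _) _ := hJ in h.
Let JM : forall c p, J p -> J (c * p) := let: conj (And3 _ _ h) _ := hJ in h.
Let J0 : J 0 := let: conj (And3 h _ _) _ := hJ in h.
Let idJ : idealP J := let: conj h _ := hJ in h.
Let Jh : forall p d, J p -> J (pihomog mdeg d p) := let: conj _ h := hJ in h.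

(** Elements of J in the ideal (z, w) have coefficients in J: this is the regularity of the
sequence z, w modulo J. *)
Lemma ideal_zw d p q r : p \is d.+1.-homog -> J p -> p = z * q + w * r ->
  exists q' r', [/\ q' \is d.-homog, r' \is d.-homog, J q', J r' & p = z * q' + w * r'].
Proof.
move=> hp Jp ep.
have [s hs] : addid J z r.
  by apply: nw; exists (- q); rewrite mulrN opprK addrC -ep.
have Jq : J (q + w * s).
  apply: nz; have -> : z * (q + w * s) = p + (- w) * (r - z * s) by rewrite ep; ring.
  by apply: (JD) => //; apply: (JM).
exists (pihomog mdeg d (q + w * s)), (pihomog mdeg d (r - z * s)).
split; rewrite ?pihomogP //; [exact: Jh | exact: Jh |].
rewrite -!(pihomogMl _ _ z1) -!(pihomogMl _ _ w1) -raddfD /= -{1}(pihomog_dE hp) ep.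
by congr pihomog; ring.
Qed.

(** Multiplying by a power of z brings an element of degree at most 3 to degree 3. *)
Lemma ideal_low d p : (d < 4)%N -> p \is d.-homog -> J p -> p = 0.
Proof.
rewrite ltnS => le hp Jp; have zd : z ^+ (3 - d) \is (3 - d).-homog.
  by have := dhomogMn (3 - d) z1; rewrite mul1n.
have h3 : z ^+ (3 - d) * p \is 3.-homog by have := dhomogM zd hp; rewrite subnK.
have /eqP := J3 h3 (JM (z ^+ (3 - d)) Jp).
by rewrite mulf_eq0 expf_eq0 (negPf z_neq0) andbF => /eqP.
Qed.

Lemma monomial_quartics : exists F : 'I_5 -> S, forall j : 'I_5,
  [/\ F j \is 4.-homog, J (F j) &
      exists q r, x ^+ j * y ^+ (4 - j) = F j + z * q + w * r].
Proof.
have h (j : nat) : (j < 5)%N -> exists F, [/\ F \is 4.-homog, J F &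
    exists q r, x ^+ j * y ^+ (4 - j) = F + z * q + w * r].
  rewrite ltnS => le; have hm : x ^+ j * y ^+ (4 - j) \is 4.-homog.
    have := dhomogM (dhomogMn j x1) (dhomogMn (4 - j) y1).
    by rewrite !mul1n subnKC.
  have [r [q Jq]] := full4 hm.
  exists (pihomog mdeg 4 (x ^+ j * y ^+ (4 - j) - w * r - z * q)); split.
  - exact: pihomogP.
  - exact: Jh.
  exists (pihomog mdeg 3 q), (pihomog mdeg 3 r).
  by rewrite -(pihomogMl _ _ z1) -(pihomogMl _ _ w1) !raddfB /= (pihomog_dE hm); ring.
have [F hF] := nat_choice (0 : S) h; exists (fun j => F j) => j; exact: hF.
Qed.

Section Generators.
Variable F : 'I_5 -> S.
Hypothesis F4 : forall j, F j \is 4.-homog.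
Hypothesis JF : forall j, J (F j).
Hypothesis Fmod : forall j : 'I_5, exists q r, x ^+ j * y ^+ (4 - j) = F j + z * q + w * r.

Let comb e p := exists2 a : 'I_5 -> S, forall i, a i \is e.-homog & p = \sum_i a i * F i.

Let combD e p q : comb e p -> comb e q -> comb e (p + q).
Proof.
move=> [a ha ->] [b hb ->]; exists (fun i => a i + b i).
  by move=> i; apply: rpredD.
by rewrite -big_split; apply: eq_bigr => i _; rewrite mulrDl.
Qed.

Let comb0 e : comb e 0.
Proof. by exists (fun=> 0) => [i|]; rewrite ?rpred0 // big1 // => i _; rewrite mul0r. Qed.

Let combM d e c p : c \is d.-homog -> comb e p -> comb (d + e) (c * p).
Proof.
move=> hc [a ha ->]; exists (fun i => c * a i); first by move=> i; apply: dhomogM.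
by rewrite mulr_sumr; apply: eq_bigr => i _; rewrite mulrA.
Qed.

Let combF i : comb 0 (F i).
Proof.
exists (fun j => (j == i)%:R) => [j|].
  by case: (j == i); rewrite ?rpred0 ?dhomog1.
rewrite (bigD1 i) //= eqxx mul1r big1 ?addr0 // => j /negPf ->.
by rewrite mul0r.
Qed.

Let comb_ideal e p : comb e p -> J p /\ p \is (e + 4).-homog.
Proof.
move=> [a ha ->]; split.
  by apply: idealP_sum => // i _; apply: JM.
by apply: rpred_sum => i _; apply: dhomogM.
Qed.

Lemma comb_monomial e i : (i <= e + 4)%N ->
  exists g q r, comb e g /\ x ^+ i * y ^+ (e + 4 - i) = g + z * q + w * r.
Proof.
move=> le.
have [j [a [b [ja jb ab]]]] : exists j : 'I_5, exists a b,
    [/\ i = (a + j)%N, (e + 4 - i = b + (4 - j))%N & (a + b)%N = e].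
  case: (leqP i 4) => h.
    have h5 : (i < 5)%N by rewrite ltnS.
    by exists (Ordinal h5), 0%N, e; split=> //=; rewrite addnBA.
  exists (Ordinal (isT : (4 < 5)%N)), (i - 4)%N, (e + 4 - i)%N => /=.
  by split; [rewrite subnK // ltnW | rewrite addn0 | lia].
have [q [r eF]] := Fmod j.
exists (x ^+ a * y ^+ b * F j), (x ^+ a * y ^+ b * q), (x ^+ a * y ^+ b * r); split.
  have hc : x ^+ a * y ^+ b \is e.-homog.
    by have := dhomogM (dhomogMn a x1) (dhomogMn b y1); rewrite !mul1n ab.
  by have := combM hc (combF j); rewrite addn0.
rewrite jb ja !exprD mulrACA eF; ring.
Qed.

Lemma comb_mod e p : p \is (e + 4).-homog ->
  exists g q r, comb e g /\ p = g + z * q + w * r.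
Proof.
pose P p := exists g q r, comb e g /\ p = g + z * q + w * r.
have PD u v : P u -> P v -> P (u + v).
  move=> [g [q [r [hg ->]]]] [g' [q' [r' [hg' ->]]]].
  by exists (g + g'), (q + q'), (r + r'); split; [apply: combD | ring].
move=> hp; rewrite -/(P p).
have [c [q [r ->]]] := two_var hp.
apply: (PD); last by exists 0, 0, r; split; [exact: comb0 | ring].
apply: (PD); last by exists 0, q, 0; split; [exact: comb0 | ring].
apply: (big_ind P) => //; first by exists 0, 0, 0; split; [exact: comb0 | ring].
move=> i _; have le : (i <= e + 4)%N by rewrite -ltnS.
have [g [q' [r' [hg eg]]]] := comb_monomial le.
exists ((c i)%:MP * g), ((c i)%:MP * q'), ((c i)%:MP * r'); split.
  by rewrite -[e]add0n; apply: combM => //; rewrite -[_%:MP]mulr1 mul_mpolyC rpredZ ?dhomog1.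
by rewrite eg -mul_mpolyC; ring.
Qed.

(** Nakayama's lemma by induction on the degree: modulo (z, w) an element of J agrees with a
combination of the quartics, and the difference has coefficients in J by [ideal_zw]. *)
Lemma ideal_comb e p : p \is (e + 4).-homog -> J p -> comb e p.
Proof.
elim: e p => [|e IHe] p hp Jp.
all: have [g [q [r [hg ep]]]] := comb_mod hp; have [Jg hgd] := comb_ideal hg.
all: have epg : p - g = z * q + w * r by rewrite ep; ring.
all: have Jpg : J (p - g) by apply: (JD) => //; rewrite -mulN1r; apply: (JM).
  have hpg : p - g \is 4.-homog by apply: rpredB.
  have [q' [r' [hq hr Jq Jr e']]] := ideal_zw hpg Jpg epg.
  move: e'; rewrite (ideal_low _ hq Jq) // (ideal_low _ hr Jr) // !mulr0 addr0.
  by move/eqP; rewrite subr_eq0 => /eqP ->.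
have hpg : p - g \is (e + 4).+1.-homog by apply: rpredB.
have [q' [r' [hq hr Jq Jr e']]] := ideal_zw hpg Jpg epg.
rewrite -[p](subrK g) e' -[e.+1]add1n; apply: combD => //; apply: combD.
  by apply: combM => //; apply: IHe.
by apply: combM => //; apply: IHe.
Qed.

Lemma ideal_comb_any p : J p -> exists a : 'I_5 -> S, p = \sum_i a i * F i.
Proof.
move=> Jp; rewrite [p](pihomog_partitionE (leqnn (msize p))).
elim/big_ind: _ => [|u v [a ->] [b ->]|i _].
- by have [a _ e0] := comb0 0; exists a.
- by exists (fun i => a i + b i); rewrite -big_split; apply: eq_bigr => i _; rewrite mulrDl.
case: (ltnP i 4) => hi.
  by rewrite (ideal_low hi (pihomogP _ _ _) (Jh _ Jp)); have [a _ e0] := comb0 0; exists a.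
have hd : pihomog mdeg i p \is (i - 4 + 4).-homog by rewrite subnK // pihomogP.
by have [a _ ->] := ideal_comb hd (Jh _ Jp); exists a.
Qed.

Lemma red_F (j : 'I_5) : red (F j) = x ^+ j * y ^+ (4 - j).
Proof.
have [q [r /(congr1 red)]] := Fmod j.
by rewrite !rmorphD !rmorphM !rmorphXn /= redx redy redz redw !mul0r !addr0 => ->.
Qed.

(** The syzygies x * (x^j y^(4-j)) = y * (x^(j+1) y^(3-j)) hold modulo (z, w) for the quartics;
the difference is z, w times elements of J of degree 4, which are constant combinations of
the quartics. *)
Lemma linear_syzygies : exists M : 'M[S]_(4, 5), [/\
  forall i j, M i j \is 1.-homog,
  forall i j, red (M i j) = x *+ (j == i :> nat) - y *+ (j == i.+1 :> nat) &
  forall i, \sum_j M i j * F j = 0].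
Proof.
have h (i : nat) : (i < 4)%N -> exists v : 'rV[S]_5, [/\
    forall j, v 0 j \is 1.-homog,
    forall j : 'I_5, red (v 0 j) = x *+ (j == i :> nat) - y *+ (j == i.+1 :> nat) &
    \sum_j v 0 j * F j = 0].
  move=> lt; have lt5 : (i < 5)%N by apply: leqW.
  pose i0 := Ordinal lt5; pose i1 := Ordinal (lt : (i.+1 < 5)%N).
  pose p := x * F i0 - y * F i1.
  have hp : p \is 5.-homog by apply: rpredB; [exact: (dhomogM x1 (F4 i0)) | exact: (dhomogM y1 (F4 i1))].
  have Jp : J p by apply: (JD); [apply: (JM) | rewrite -mulNr; apply: (JM)].
  have [q [r ep]] : exists q r, p = z * q + w * r.
    have [q0 [r0 e0]] := Fmod i0; have [q1 [r1 e1]] := Fmod i1.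
    exists (y * q1 - x * q0), (y * r1 - x * r0).
    have e2 : x * (x ^+ i * y ^+ (4 - i)) = y * (x ^+ i.+1 * y ^+ (4 - i.+1)).
      have -> : (4 - i = (4 - i.+1).+1)%N by rewrite subnSK.
      by rewrite !exprS; ring.
    move: e2; rewrite /= in e0 e1; rewrite e0 e1 /p => e2.
    have -> : x * F i0 - y * F i1 = x * (F i0 + z * q0 + w * r0) - y * (F i1 + z * q1 + w * r1)
       + z * (y * q1 - x * q0) + w * (y * r1 - x * r0) by ring.
    by rewrite e2 subrr add0r.
  have [q' [r' [hq hr Jq Jr {}ep]]] := ideal_zw hp Jp ep.
  have [a ha eq] := @ideal_comb 0 q' hq Jq; have [b hb er] := @ideal_comb 0 r' hr Jr.
  exists (\row_j (x *+ (j == i :> nat) - y *+ (j == i.+1 :> nat) - (z * a j + w * b j))); split.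
  - move=> j; rewrite mxE; apply: rpredB.
      by apply: rpredB; apply: rpredMn.
    by apply: rpredD; [exact: (dhomogM z1 (ha j)) | exact: (dhomogM w1 (hb j))].
  - move=> j; rewrite mxE !rmorphB rmorphD !rmorphM !rmorphMn /= redx redy redz redw.
    by rewrite !mul0r addr0 subr0.
  transitivity (p - (z * q' + w * r')); last by rewrite -ep subrr.
  rewrite eq er !mulr_sumr -big_split /= /p -!mulNr.
  have sdelta (u : S) (i' : 'I_5) : u * F i' = \sum_(j < 5) (u *+ (j == i' :> nat)) * F j.
    rewrite (bigD1 i') //= eqxx big1 ?addr0 // => j ne.
    by rewrite (negPf (_ : (j : nat) != i')) ?mul0r.
  rewrite (sdelta x i0) (sdelta (- y) i1) -big_split -sumrB; apply: eq_bigr => j _ /=.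
  by rewrite mxE mulNrn; ring.
have [v hv] := nat_choice (0 : 'rV[S]_5) h.
exists (\matrix_(i, j) v i 0 j); split=> [i j|i j|i].
- by rewrite mxE; case: (hv i (ltn_ord i)).
- by rewrite mxE; case: (hv i (ltn_ord i)).
by under eq_bigr => j _ do rewrite mxE; case: (hv i (ltn_ord i)).
Qed.

Lemma sminor_homog m (M : 'M[S]_(m, m.+1)) : (forall i j, M i j \is 1.-homog) ->
  forall j, sminor M j \is m.-homog.
Proof.
move=> hM j; rewrite /sminor -signr_odd mulr_sign.
have h : \det (col' j M) \is m.-homog by apply: det_homog => a b; rewrite mxE.
by case: (odd _); rewrite ?rpredN.
Qed.

End Generators.

(** Cramer's rule makes the vector of minors proportional to the vector of quartics. The first
entries of both reduce to y^4, and F_0, F_4 are a regular pair, so the factor is 1. *)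
Theorem hilbert_burch_form : exists M : 'M[S]_(4, 5), let F := sminor M in [/\
  forall i j, M i j \is 1.-homog,
  forall i j, red (M i j) = x *+ (j == i :> nat) - y *+ (j == i.+1 :> nat),
  forall j : 'I_5, red (F j) = x ^+ j * y ^+ (4 - j),
  forall p, J p <-> exists a : 'I_5 -> S, p = \sum_j a j * F j &
  rpair (F ord0) (F ord_max)].
Proof.
have [F hF] := monomial_quartics.
have F4 (j : 'I_5) : F j \is 4.-homog by case: (hF j).
have JF (j : 'I_5) : J (F j) by case: (hF j).
have Fmod (j : 'I_5) : exists q r, x ^+ j * y ^+ (4 - j) = F j + z * q + w * r by case: (hF j).
have [M [M1 redM MF]] := linear_syzygies F4 JF Fmod.
have rF := red_F Fmod.
have rpF : rpair (F ord0) (F ord_max).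
  by apply: (rpair_red (F4 _) (F4 _)); rewrite rF /= ?expr0 ?mul1r ?mulr1.
have F0_neq0 : F ord0 != 0.
  by apply/eqP => /(congr1 red)/eqP; rewrite rF rmorph0 mul1r expf_eq0 (negPf y_neq0) andbF.
have Fm_neq0 : F ord_max != 0.
  by apply/eqP => /(congr1 red)/eqP; rewrite rF rmorph0 mulr1 expf_eq0 (negPf x_neq0) andbF.
have D4 := sminor_homog M1.
(* The reduction of M without its first column is triangular with - y on the diagonal. *)
have rD0 : red (sminor M ord0) = y ^+ 4.
  rewrite /sminor expr0 mul1r -det_map_mx det_trig.
    have -> : \prod_i map_mx red (col' ord0 M) i i = \prod_(i < 4) (- y).
      apply: eq_bigr => i _; rewrite !mxE redM /= /bump leq0n add1n eqxx.
      by rewrite eqn_leq ltnn mulr0n sub0r.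
    by rewrite prodr_const card_ord exprNn -signr_odd mul1r.
  apply/is_trig_mxP => i j lt; rewrite !mxE redM /= /bump leq0n add1n eqSS.
  by rewrite !gtn_eqF ?subrr // leqW.
have D0F : sminor M ord0 = F ord0.
  have [c ec] := rpair_sym F0_neq0 Fm_neq0 rpF (sminor_cramer MF ord0 ord_max).
  have e1 := pihomogMl 0 c (F4 ord0); rewrite addn0 in e1.
  have := congr1 (pihomog mdeg 4) ec; rewrite mulrC pihomog_dE // e1 (homog0_const (pihomogP mdeg 0 c)).
  set a := mcoeff _ _ => e.
  suff -> : sminor M ord0 = F ord0 * 1 by rewrite mulr1.
  rewrite e; congr (_ * _); have := congr1 red e.
  rewrite rD0 rmorphM redC rF mul1r -[LHS]mulr1 => /mulfI <- //.
  by rewrite expf_neq0.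
have DF j : sminor M j = F j.
  by apply: (mulIf F0_neq0); rewrite (sminor_cramer MF j ord0) D0F mulrC.
exists M; split; [exact: M1 | exact: redM | | |].
- by move=> j; apply: etrans (congr1 red (DF j)) (rF j).
- move=> p; split=> [Jp|[a ->]].
    have [a ea] := ideal_comb_any F4 JF Fmod Jp; exists a; apply: etrans ea _.
    by apply: eq_bigr => j _; apply: (congr1 (fun t => a j * t)); exact: esym (DF j).
  apply: idealP_sum => [|j _]; first exact: idJ.
  apply: JM.
  by apply: (eq_ind_r J (JF j)); exact: DF.
move: (DF ord0) (DF ord_max) rpF; move: (sminor M _) (sminor M _) => D0 D1 -> ->.
exact: id.
Qed.

End HilbertBurchForm.

(** * Smoothness and the rank of the Hilbert-Burch matrix *)

Section SmoothRank.
Variables (R : comNzRingType) (n : nat) (x : 'I_n -> R).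

(** Membership in the square of the ideal of a point, read off first-order data. *)
Definition singular_at (p : {mpoly R[n]}) := p.@[x] = 0 /\ forall i, (mderiv i p).@[x] = 0.

Lemma singular_atD p q : singular_at p -> singular_at q -> singular_at (p + q).
Proof.
move=> [p0 dp] [q0 dq]; split=> [|i]; first by rewrite mevalD p0 q0 addr0.
by rewrite mderivD mevalD dp dq addr0.
Qed.

Lemma singular_atM c p : singular_at p -> singular_at (c * p).
Proof.
move=> [p0 dp]; split=> [|i]; first by rewrite mevalM p0 mulr0.
by rewrite mderivM mevalD !mevalM dp p0 !mulr0 addr0.
Qed.

Lemma singular_at_mul p q : p.@[x] = 0 -> q.@[x] = 0 -> singular_at (p * q).
Proof.
move=> p0 q0; split=> [|i]; first by rewrite mevalM p0 mul0r.
by rewrite mderivM mevalD !mevalM p0 q0 mulr0 mul0r addr0.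
Qed.

Lemma singular_at0 : singular_at 0.
Proof. by split=> [|i]; rewrite ?mderiv0 meval0. Qed.

(** Every term of the Leibniz formula has a factor in each of the two rows. *)
Lemma det_singular_at m (A : 'M[{mpoly R[n]}]_m) (a b : 'I_m) : a != b ->
  (forall j, (A a j).@[x] = 0) -> (forall j, (A b j).@[x] = 0) -> singular_at (\det A).
Proof.
move=> ne ha hb; rewrite /determinant; apply: (big_ind singular_at).
- exact: singular_at0.
- exact: singular_atD.
move=> s _; apply: singular_atM.
rewrite (bigD1 a) //= (bigD1 b) //= 1?eq_sym // mulrA mulrC.
by apply: singular_atM; apply: singular_at_mul.
Qed.

End SmoothRank.

Lemma two_zero_rows (k : fieldType) (B : 'M[k]_(4, 5)) : (\rank B <= 2)%N ->
  exists2 U : 'M[k]_4, U \in unitmx &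
    forall i : 'I_4, (1 < i)%N -> row i (U *m B) = 0.
Proof.
move=> le; exists (invmx (col_ebase B)); first by rewrite unitmx_inv col_ebase_unit.
move=> i lt; rewrite -{2}(mulmx_ebase B) -mulmxA mulKmx ?col_ebase_unit // row_mul.
have -> : row i (pid_mx (\rank B) : 'M[k]_(4, 5)) = 0; last by rewrite mul0mx.
by apply/rowP => j; rewrite !mxE [(i < _)%N]ltnNge (leq_trans le lt) andbF.
Qed.

(** If the rank at a point is at most 2, a constant row operation makes two rows vanish there.
Then the maximal minors lie in the square of the ideal of the point, and all gradients of
elements of I are 0, against the Jacobian criterion. *)
Lemma smooth_rank (k : fieldType) (I : {pred {mpoly k[4]}}) (M : 'M[{mpoly k[4]}]_(4, 5)) :
  (forall p, p \in I <-> exists a : 'I_5 -> {mpoly k[4]}, p = \sum_j a j * sminor M j) ->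
  smooth_curve I -> forall x : 'rV[k]_4, x != 0 ->
  (2 < \rank (map_mx (meval (fun j => x ord0 j)) M))%N.
Proof.
move=> hI smI x x0; rewrite ltnNge; apply/negP; set v := (X in meval X) => le.
have [U uU hU] := two_zero_rows le.
have sing j : singular_at v (sminor M j).
  pose c : {mpoly k[4]} := (\det U)^-1%:MP.
  pose V : 'M[{mpoly k[4]}]_4 := map_mx (@mpolyC 4 k) U.
  have eV : c * \det V = 1.
    by rewrite /c /V -[map_mx _ _]/(map_mx (@mpolyC 4 k) U) det_map_mx -mpolyCM mulVf ?mpolyC1 // -unitfE.
  have hV (i : 'I_4) l : (1 < i)%N -> ((V *m col' j M) i l).@[v] = 0.
    move=> /hU/rowP/(_ (lift j l)); rewrite [RHS]mxE => h0; apply: etrans h0; rewrite !mxE raddf_sum.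
    by apply: eq_bigr => m _; rewrite /= !mxE mevalM mevalC.
  have -> : sminor M j = ((-1) ^+ j * c) * \det (V *m col' j M).
    by rewrite det_mulmx mulrA -[_ * c * _]mulrA eV mulr1.
  apply: singular_atM.
  apply: (@det_singular_at _ _ _ _ _ (inord 2) (inord 3)).
    by rewrite -val_eqE /= !inordK.
    by move=> l; apply: hV; rewrite inordK.
  by move=> l; apply: hV; rewrite inordK.
have smI0 f : f \in I -> singular_at v f.
  move=> /hI[a ->]; apply: (big_ind (singular_at _)).
  - exact: singular_at0.
  - exact: singular_atD.
  by move=> j _; apply: singular_atM.
have [f1 [f2 [I1 I2 rk _]]] := smI x x0 (fun f If => proj1 (smI0 f If)).
have g0 f : f \in I -> gradient f x = 0.
  by move=> If; apply/rowP => i; rewrite !mxE; apply: (proj2 (smI0 f If)).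
by move: rk; rewrite !g0 // col_mx0 mxrank0.
Qed.

(** * Minors of the top rows *)

Definition cminor (S : idomainType) n j (A : 'M[S]_(j.+1, n)) (c : 'I_j.+1)
  (g : {ffun 'I_j -> 'I_n}) : S := \det (colsub g (row' c A)).

Section MinorElimination.
Variables (S : idomainType) (n j : nat) (A : 'M[S]_(j.+1, n)).
Variables (c : 'I_j.+1) (g : {ffun 'I_j -> 'I_n}).
Local Notation h := (cminor A c g).
Local Notation notc := (fun a => a != c).

(** The matrix E that [elim_mx] asks for: the adjugate of the submatrix, placed in the columns
[g] and the rows other than [c]. *)
Definition cminor_mx : 'M[S]_(n, j.+1) :=
  colsub g 1%:M *m \adj (colsub g (row' c A)) *m row' c 1%:M.

Lemma cminor_mxE a b : a != c -> b != c -> (A *m cminor_mx) a b = h *+ (a == b).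
Proof.
move=> nac nbc; rewrite eq_sym in nac; rewrite eq_sym in nbc.
have [s -> _] := unlift_some nac; have [t -> _] := unlift_some nbc.
have e : row' c A *m cminor_mx = h *: row' c 1%:M.
  by rewrite /cminor_mx !mulmxA mulmx_colsub mulmx1 mul_mx_adj mul_scalar_mx.
have := congr1 (fun B : 'M_(j, j.+1) => B s (lift c t)) e.
rewrite mxE [in X in _ = X]mxE [in X in _ = X]mxE [in X in _ = X]mxE mulr_natr => <-.
by rewrite mxE; apply: eq_bigr => i _; rewrite [X in _ = X * _]mxE.
Qed.

Local Notation Q := (elim_mx A cminor_mx h notc).

Lemma elim_cminorE : Q = h%:M - colsub g 1%:M *m \adj (colsub g (row' c A)) *m row' c A.
Proof.
rewrite /elim_mx; congr (_ - _).
have -> : (\matrix_(i, b) (cminor_mx i b *+ (b != c))) = cminor_mx.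
  apply/matrixP => i b; rewrite mxE; case: eqP => [->|_]; last by rewrite mulr1n.
  rewrite mulr0n mxE big1 // => l _; rewrite [X in _ * X]mxE [X in _ * X]mxE.
  by rewrite (negPf (_ : lift c l != c)) ?mulr0 // eq_sym neq_lift.
rewrite /cminor_mx -[LHS]mulmxA; congr (_ *m _); apply/matrixP => a b; rewrite !mxE.
rewrite (bigD1 (lift c a)) //= big1 => [|l /negPf ne]; rewrite !mxE ?eqxx ?mul1r ?addr0 //.
by rewrite eq_sym ne mul0r.
Qed.

Lemma elim_cminor_col i t : Q i (g t) = 0.
Proof.
have e : colsub g Q = 0.
  rewrite elim_cminorE linearB /= -[X in _ - X]mulmx_colsub -mulmxA mul_adj_mx.
  rewrite mul_mx_scalar; apply/matrixP => a b; rewrite !mxE mulr_natr.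
  by rewrite subrr.
by have := congr1 (fun B : 'M_(n, j) => B i t) e; rewrite !mxE.
Qed.

Lemma elim_cminorX i : i \notin codom g -> lsubst Q 'X_i = h *: 'X_i.
Proof.
move=> ni; rewrite lsubstX elim_cminorE linearB /= -[_ *m row' c A]mulmxA row_mul.
have -> : row i (colsub g 1%:M : 'M[S]_(n, j)) = 0.
  apply/rowP => t; rewrite !mxE; case: eqP => // e.
  by rewrite e codom_f in ni.
rewrite mul0mx subr0 -scalemx1 linearZ /= row1 linZ lin_delta //.
Qed.

(** When all but two columns are eliminated, forms of degree d become binary forms, and every
binary monomial of degree d >= a + b - 1 is divisible by the a-th power of the first variable
or the b-th power of the second. *)
Lemma elim_two_var (i1 i2 : 'I_n) (d a b : nat) p : i1 != i2 ->
  (forall i, i \in codom g \/ (i == i1) || (i == i2)) -> (a + b <= d.+1)%N ->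
  p \is d.-homog ->
  exists G1 G2, lsubst Q p = 'X_i1 ^+ a * G1 + 'X_i2 ^+ b * G2.
Proof.
move=> ne hi; have lX i : exists u v, lsubst Q 'X_i = u * 'X_i1 + v * 'X_i2.
  exists ((Q i i1)%:MP), ((Q i i2)%:MP).
  rewrite lsubstX /lin (bigD1 i1) //= (bigD1 i2) 1?eq_sym //= big1 => [|l /andP[n1 n2]].
    by rewrite addr0 !mxE !mul_mpolyC.
  rewrite mxE; case: (hi l) => [/codomP[t ->]|]; first by rewrite elim_cminor_col scale0r.
  by rewrite (negPf n1) (negPf n2).
elim: d a b p => [|d IHd] [|a] [|b] p le hp;
  try by exists (lsubst Q p), 0; rewrite mul1r mulr0 addr0.
- by exists 0, (lsubst Q p); rewrite mul1r mulr0 add0r.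
- by move: le; rewrite addSn addnS.
- by exists 0, (lsubst Q p); rewrite mul1r mulr0 add0r.
have [q hq ->] := homogS_split hp.
pose Sp p := exists G1 G2, p = 'X_i1 ^+ a.+1 * G1 + 'X_i2 ^+ b.+1 * G2 :> {mpoly S[n]}.
rewrite rmorph_sum; apply: (big_ind Sp).
- by exists 0, 0; rewrite !mulr0 addr0.
- move=> _ _ [G1 [G2 ->]] [H1 [H2 ->]]; exists (G1 + H1), (G2 + H2).
  by rewrite !mulrDr addrACA.
move=> i _; rewrite rmorphM /=; have [u [v ->]] := lX i.
have [||G1 [G2 eG]] := IHd a b.+1 (q i); [by rewrite addSn in le | exact: hq |].
have [||H1 [H2 eH]] := IHd a.+1 b (q i); [by rewrite addnS in le | exact: hq |].
exists (u * G1 + v * 'X_i2 * H1), (u * 'X_i1 * G2 + v * H2).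
rewrite mulrDl {1}eG eH (exprS 'X_i1 a) (exprS 'X_i2 b); ring.
Qed.

End MinorElimination.

(** Away from the zeros of a minor of the remaining rows, some row operation turns
    the other rows into distinct variables, hence into a regular sequence. *)
Lemma cminor_regular (S : idomainType) n j (A : 'M[S]_(j.+1, n)) c g p :
  (forall v : 'rV_j.+1, v *m A = 0 -> v = 0) ->
  rowid A (fun a => a != ord_max) (rowform A ord_max * p) ->
  exists K, rowid A (fun a => a != ord_max) ((cminor A c g ^+ K)%:MP * p).
Proof.
move=> Afree hp; have [h0|h0] := eqVneq (cminor A c g) 0.
  by exists 1%N; rewrite h0 expr1 mpolyC0 mul0r; apply: rowid0.
apply: (@minor_regular _ _ _ A (cminor_mx A c g) _ c) => // a b.
exact: cminor_mxE.
Qed.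

(** Each omitted row lowers the rank by at most one. *)
Lemma rank_rowsub (F : fieldType) m n p (B : 'M[F]_(m, n)) (f : 'I_p -> 'I_m) :
  injective f -> (\rank B <= \rank (rowsub f B) + (m - p))%N.
Proof.
move=> fI.
have le : (B <= rowsub f B + \sum_(i | i \notin codom f) <<row i B>>)%MS.
  apply/row_subP => i; case: (boolP (i \in codom f)) => [/codomP[a ->]|ni].
    by apply: submx_trans (addsmxSl _ _); rewrite -row_rowsub row_sub.
  apply: submx_trans (addsmxSr _ _); apply: (sumsmx_sup i) => //.
  by rewrite genmxE.
apply: leq_trans (mxrankS le) _; apply: leq_trans (mxrank_adds_leqif _ _) _.
rewrite leq_add2l.
have -> : (m - p = \sum_(i | i \notin codom f) 1)%N.
  have := cardC (mem (codom f)); rewrite card_codom // !card_ord => /(congr1 (subn^~ p)) /=.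
  by rewrite addKn sum1_card => <-.
apply: (big_ind2 (fun (C : 'M_n) d => \rank C <= d)%N) => [|C d C' d' h h'|i _].
- by rewrite mxrank0.
- by apply: leq_trans (mxrank_adds_leqif _ _) _; apply: leq_add.
by rewrite mxrank_gen; apply: rank_leq_row.
Qed.

Lemma exists_cminor (F : fieldType) n j (B : 'M[F]_(j.+1, n)) :
  (j <= \rank B)%N -> exists c g, cminor B c g != 0.
Proof.
move=> le.
have [c hc] : exists c, (j <= \rank (row' c B))%N.
  have h c : (B <= row c B + row' c B)%MS.
    apply/row_subP => i; case: (unliftP c i) => [s ->|->]; last exact: addsmxSl.
    by apply: submx_trans (addsmxSr _ _); rewrite -row_rowsub row_sub.
  case: (boolP (row_free B)) => [fB|/row_freePn[c hc]]; last first.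
    exists c; apply: leq_trans le (mxrankS _).
    by apply: submx_trans (h c) _; rewrite addsmx_sub hc submx_refl.
  exists ord0; rewrite -(leq_add2l 1) add1n; apply: leq_trans (eq_leq (esym (eqP fB))) _.
  apply: leq_trans (mxrankS (h ord0)) _; apply: leq_trans (mxrank_adds_leqif _ _) _.
  by rewrite leq_add2r rank_leq_row.
have fr : row_full (row' c B)^T.
  by rewrite /row_full mxrank_tr eqn_leq rank_leq_row.
exists c, (fullrankfun fr).
have := fullrowsub_unit fr; rewrite unitmxE unitfE -det_tr.
by congr (_ != 0); congr (\det _); apply/matrixP => i i'; rewrite !mxE.
Qed.

Definition famid (R : nzRingType) (I : finType) (h : I -> R) p :=
  exists r : I -> R, p = \sum_u r u * h u.

Lemma famid_idealP (R : nzRingType) (I : finType) (h : I -> R) : idealP (famid h).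
Proof.
split.
- by exists (fun=> 0); rewrite big1 // => u _; rewrite mul0r.
- move=> p q [r ->] [s ->]; exists (fun u => r u + s u).
  by rewrite -big_split; apply: eq_bigr => u _; rewrite mulrDl.
move=> c p [r ->]; exists (fun u => c * r u).
by rewrite mulr_sumr; apply: eq_bigr => u _; rewrite mulrA.
Qed.

Lemma famid_mem (R : nzRingType) (I : finType) (h : I -> R) u : famid h (h u).
Proof.
exists (fun u' => (u' == u)%:R); rewrite (bigD1 u) //= eqxx mul1r big1 ?addr0 // => v /negPf->.
by rewrite mul0r.
Qed.

Lemma famid_hidealP (k : fieldType) n (I : finType) (h : I -> {mpoly k[n]}) d :
  (forall u, h u \is d.-homog) -> hidealP (famid h).
Proof.
move=> hd; split; first exact: famid_idealP.
move=> _ e [r ->]; rewrite raddf_sum; apply: idealP_sum => [|u _ /=]; first exact: famid_idealP.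
rewrite mulrC; case: (leqP d e) => le.
  rewrite -(subnKC le) (pihomogMl _ _ (hd u)) mulrC.
  by have [_ _ h3] := famid_idealP h; apply/h3/famid_mem.
by rewrite (pihomogMl0 _ (hd u)) //; have [h0 _ _] := famid_idealP h.
Qed.

Section LinearMatrix.
Variables (k : closedFieldType) (M : 'M[{mpoly k[4]}]_(4, 5)).
Local Notation S := {mpoly k[4]}.
Hypothesis M1 : forall i j, M i j \is 1.-homog.
Hypothesis rankM : forall v : 'I_4 -> k, ~ (v =1 fun=> 0) ->
  (2 < \rank (map_mx (meval v) M))%N.

Definition toprow j (a : 'I_j.+1) : 'I_4 := inord a.

Lemma toprow_inj j : (j < 4)%N -> injective (@toprow j).
Proof.
move=> lt a b /(congr1 val); rewrite /= !inordK; first exact: val_inj.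
  exact: leq_trans (ltn_ord b) lt.
exact: leq_trans (ltn_ord a) lt.
Qed.

Definition topminor j (u : 'I_j.+1 * {ffun 'I_j -> 'I_5}) : S :=
  cminor (rowsub (@toprow j) M) u.1 u.2.

(** Rank at least 3 for the four rows leaves rank at least j for the first j + 1 rows, so their
j-minors have no common zero but the origin. *)
Lemma topminor_irrelevant j i : (j < 4)%N -> exists K, famid (@topminor j) ('X_i ^+ K).
Proof.
move=> lt; apply: projective_nullstellensatz => [|v hv].
  by apply: (@famid_hidealP _ _ _ _ j) => u; apply: det_homog => a b; rewrite !mxE.
apply: NNPP => v0; have rk := rankM v0.
have le : (j <= \rank (rowsub (@toprow j) (map_mx (meval v) M)))%N.
  have := leq_trans rk (rank_rowsub (map_mx (meval v) M) (toprow_inj lt)).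
  by move: (\rank _) => r; lia.
have [c [g]] := exists_cminor le; apply/negP; rewrite negbK; apply/eqP.
rewrite -[RHS](hv (topminor (c, g))); last exact: famid_mem.
rewrite /topminor /cminor -det_map_mx; congr (\det _).
by apply/matrixP => a b; rewrite !mxE.
Qed.

Definition trunc_mx m : 'M[k]_4 := \matrix_(i, j) ((i == j) && (i < m)%N)%:R.
Definition trunc m := lsubst (trunc_mx m).
HB.instance Definition _ m := GRing.RMorphism.on (trunc m).

Lemma truncX m i : trunc m 'X_i = if (i < m)%N then 'X_i else 0.
Proof.
rewrite /trunc lsubstX; have -> : row i (trunc_mx m) = (i < m)%:R *: delta_mx 0 i.
  by apply/rowP => j; rewrite !mxE eqxx eq_sym -natrM mulnb andbC.
by rewrite linZ lin_delta; case: ifP; rewrite ?scale1r ?scale0r.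
Qed.

(** The coefficient vector of x_i in row [a] of M; as a linear form in y it is N_ai. *)
Definition mcoef a i : 'rV[S]_5 := \row_b ((M (inord a) b)@_U_(inord i))%:MP.

Lemma trunc_M m a : (m <= 4)%N ->
  row (inord a) (map_mx (trunc m) M) = \sum_(i < m) 'X_(inord i) *: mcoef a i.
Proof.
move=> le; apply/rowP => b; rewrite !mxE summxE {1}(homog1_lin (M1 _ b)).
rewrite /lin raddf_sum (big_ord_widen 4 (fun i => ('X_(inord i) *: mcoef a i) 0 b)) // [RHS]big_mkcond.
apply: eq_bigr => i _ /=; rewrite !mxE inord_val -mul_mpolyC rmorphM /=.
rewrite /trunc {1}/lsubst comp_mpolyC -/(trunc m) truncX.
by case: ifP => _; rewrite ?mulr0 // mulrC.
Qed.

End LinearMatrix.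

(** * Relations between maximal minors, one small minor at a time *)

(** Coefficient by coefficient. *)
Lemma rpair_mpolyC (R : idomainType) (n : nat) (a b : R) (P Q : {mpoly R[n]}) :
  rpair a b -> a%:MP * P = b%:MP * Q -> exists C, P = b%:MP * C.
Proof.
move=> ab e; rewrite [P]mpolyE.
apply: (big_ind (fun P => exists C, P = b%:MP * C)).
- by exists 0; rewrite mulr0.
- by move=> _ _ [C ->] [D ->]; exists (C + D); rewrite mulrDr.
move=> m _; have := congr1 (mcoeff m) e; rewrite !mcoeffCM mulrC [RHS]mulrC.
by move=> /ab[c ->]; exists (c *: 'X_[m]); rewrite mul_mpolyC scalerA mulrC.
Qed.

(** The relations q(f) = 0 between the signed maximal minors f of the matrix A, and the elements
that become forms in f after multiplication by powers of f_j, are studied here up to powers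
of one minor h of size 3. *)
Section MinorKernel.
Variables (S : idomainType) (A : 'M[S]_(4, 5)).
Local Notation T := {mpoly S[5]}.
Local Notation f := (sminor A).
Hypothesis Afree : forall v : 'rV_4, v *m A = 0 -> v = 0.
Hypothesis f_neq0 : forall i, f i != 0.
Hypothesis rpair_f : rpair (f ord0) (f ord_max).

Definition rowsid : T -> Prop := rowid A xpredT.

Lemma rowsid_idealP : idealP rowsid.
Proof. split; [exact: rowid0 | exact: rowidD | exact: rowidM]. Qed.

Lemma rowform_meval a : (rowform A a).@[f] = 0.
Proof.
rewrite lin_meval -[RHS](sminor_kernel A a); apply: eq_bigr => i _.
by rewrite mxE.
Qed.

Lemma rowid_meval U p : rowid A U p -> p.@[f] = 0.
Proof.
move=> [r ->]; rewrite raddf_sum big1 // => a _ /=.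
by rewrite mevalM rowform_meval mulr0.
Qed.

Lemma rowsid_sub U p : rowid A U p -> rowsid p.
Proof. by move=> [r ->]; apply: rowid_sum => a _; apply: rowid_mem. Qed.

(** Cramer's rule makes f_i y_j and f_j y_i congruent modulo the rows, so that y may
    be replaced by a multiple of f. *)
Lemma sminor_congr i n q : q \is n.-homog ->
  rowsid ((f i ^+ n)%:MP * q - 'X_i ^+ n * (q.@[f])%:MP).
Proof.
have [I0 ID IM] := rowsid_idealP.
elim: n q => [|n IHn] q hq.
  rewrite (homog0_const hq) mevalC !expr0 mpolyC1 !mul1r subrr; exact: I0.
have [r hr ->] := homogS_split hq.
have -> : ((\sum_i 'X_i * r i).@[f])%:MP = \sum_i (('X_i * r i).@[f])%:MP :> T.
  by rewrite (raddf_sum (meval f)) (raddf_sum (@mpolyC 5 S)).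
rewrite !mulr_sumr -sumrB.
apply: idealP_sum; first exact: rowsid_idealP.
move=> j _; have [w ew] := sminor_rows A i j.
have hl : rowsid ((f i)%:MP * 'X_j - (f j)%:MP * 'X_i).
  have -> : (f i)%:MP * 'X_j - (f j)%:MP * 'X_i = lin (w *m A) :> T.
    by rewrite -ew linearB /= !linZ !lin_delta !mul_mpolyC.
  rewrite mulmx_sum_row lin_sum; apply: rowid_sum => a _.
  by rewrite linZ -mul_mpolyC; apply: rowid_mem.
have -> : (f i ^+ n.+1)%:MP * ('X_j * r j) - 'X_i ^+ n.+1 * (('X_j * r j).@[f])%:MP =
    (f i ^+ n)%:MP * r j * ((f i)%:MP * 'X_j - (f j)%:MP * 'X_i)
    + (f j)%:MP * 'X_i * ((f i ^+ n)%:MP * r j - 'X_i ^+ n * ((r j).@[f])%:MP).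
  rewrite mevalM mevalXU exprSr (exprSr 'X_i) !mpolyCM; ring.
by apply: (ID); [apply: (IM) | apply/IM/IHn].
Qed.

Lemma rpair_sminor n : rpair (f ord0 ^+ n) (f ord_max ^+ n).
Proof. by apply: rpairXX; rewrite ?f_neq0. Qed.

(** The substitution [sigma] eliminates the rows other than [c]. After inverting h it identifies
S[y] modulo these rows with polynomials in the two variables outside the columns [g], and
the row [c] becomes, up to a factor, the linear form f_2 y_1 - f_1 y_2. *)
Section OneMinor.
Variables (c : 'I_4) (g : {ffun 'I_3 -> 'I_5}).
Local Notation h := (cminor A c g).
Hypothesis h_neq0 : h != 0.
Local Notation sigma := (lsubst (elim_mx A (cminor_mx A c g) h (fun a => a != c))).

Lemma sigma_kill a : a != c -> sigma (rowform A a) = 0.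
Proof.
move=> ne; have := @elim_kill S 5 3 A (cminor_mx A c g) h c.
move=> /(_ _ (fun a => a != c) a); apply=> //; exact: cminor_mxE.
Qed.

Lemma sigma_c_neq0 : sigma (rowform A c) != 0.
Proof.
apply: (@elim_c_neq0 S 5 3 A (cminor_mx A c g) h c) => //; exact: cminor_mxE.
Qed.

Lemma sigma_homog n p : p \is n.-homog -> exists2 r, rowsid r & (h ^+ n)%:MP * p = sigma p + r.
Proof.
move=> hp; exists ((h ^+ n)%:MP * p - sigma p); last by rewrite addrC subrK.
exact: rowsid_sub (elim_mx_homog _ _ _ _ hp).
Qed.

Lemma sigma_rowsid p : rowsid p -> exists G, sigma p = sigma G * sigma (rowform A c).
Proof.
move=> [r ->]; exists (r c); rewrite (linear_sum (lsubst _)) (bigD1 c) //= big1 => [|a ne].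
  by rewrite addr0 rmorphM.
by rewrite rmorphM /= sigma_kill ?mulr0.
Qed.

(** By [sminor_congr], f_0^n q and f_4^n q lie in the ideal of the rows; so their images are
multiples of the image of row [c]. The quotients are proportional to f_0^n and f_4^n, and
since these form a regular pair the image of q itself is such a multiple. *)
Lemma kernel_one_minor n q : q \is n.-homog -> q.@[f] = 0 -> rowsid ((h ^+ n)%:MP * q).
Proof.
have [I0 ID IM] := rowsid_idealP.
move=> hq q0; have hf i : rowsid ((f i ^+ n)%:MP * q).
  by have := sminor_congr i hq; rewrite q0 mpolyC0 mulr0 subr0.
have [G eG] := sigma_rowsid (hf ord0); have [G' eG'] := sigma_rowsid (hf ord_max).
have sC x p : sigma (x%:MP * p) = x%:MP * sigma p.
  by rewrite !mul_mpolyC lsubstZ.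
rewrite !sC in eG eG'.
have e : (f ord_max ^+ n)%:MP * sigma G = (f ord0 ^+ n)%:MP * sigma G'.
  by apply: (mulIf sigma_c_neq0); rewrite -!mulrA -eG -eG' mulrCA.
have [|G2 eG2] := rpair_mpolyC _ e.
  by apply: rpair_sym; rewrite ?expf_neq0 ?f_neq0 //; apply: rpair_sminor.
have sq : sigma q = G2 * sigma (rowform A c).
  have fn : (f ord0 ^+ n)%:MP != 0 :> T by rewrite mpolyC_eq0 expf_neq0.
  by apply: (mulfI fn); rewrite eG eG2 mulrA.
have [r hr ->] := sigma_homog hq.
have [r' hr' er'] := sigma_homog (lin_homog (row c A)).
have es : sigma (rowform A c) = (h ^+ 1)%:MP * rowform A c - r' by rewrite /rowform er' addrK.
apply: (ID) => //; rewrite sq es mulrBr; apply: (ID).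
  by rewrite mulrA; apply: rowid_mem.
by rewrite -mulrN; apply: (IM); rewrite -mulN1r; apply: (IM).
Qed.

(** Let y_1, y_2 be the two variables left by the elimination, and u f_1^m = Q_1(f),
u f_2^m = Q_2(f). Then y_2^m Q_1 - y_1^m Q_2 is a relation, hence a multiple G L of the
remaining row after elimination. The binary form G has degree 2m + 2, so it splits into
multiples of y_1^m and y_2^m; absorbing them, y_1^m divides Q_1 modulo L. Evaluating at f
and cancelling f_1^m expresses u, up to a power of h, as a cubic form in f. *)
Lemma section_one_minor u :
  (forall j, exists m Q, Q \is (3 + m).-homog /\ u * f j ^+ m = Q.@[f]) ->
  exists N Q, Q \is 3.-homog /\ h ^+ N * u = Q.@[f].
Proof.
move=> hu.
have gI : injective g.
  move=> s t est; apply/eqP/negPn/negP => ne; move/eqP: h_neq0; apply.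
  rewrite /cminor -det_tr; apply: (determinant_alternate ne) => i.
  by rewrite !mxE est.
have [i1 [i2 [ne cov]]] : exists i1 i2 : 'I_5, i1 != i2 /\
    forall i, (i \in codom g) = ~~ ((i == i1) || (i == i2)).
  pose B := [set i | i \notin codom g].
  have B2 : #|B| == 2%N.
    have e := cardC (mem (codom g)); rewrite card_codom // !card_ord in e.
    rewrite -(eqn_add2l 3); apply/eqP; apply: etrans e; congr (_ + _)%N.
    by apply: eq_card => i; rewrite !inE.
  have /cards2P[i1 [i2 [ne eB]]] := B2; exists i1, i2; split=> // i.
  by move/setP/(_ i): eB; rewrite !inE => <-; rewrite negbK.
have ni1 : i1 \notin codom g by rewrite cov eqxx.
have ni2 : i2 \notin codom g by rewrite cov eqxx orbT.
have cov' i : i \in codom g \/ (i == i1) || (i == i2).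
  by rewrite cov; case: (_ || _); [right | left].
have [m1 [R1 [hR1 eR1]]] := hu i1; have [m2 [R2 [hR2 eR2]]] := hu i2.
(* A common exponent for both charts. *)
pose m := (m1 + m2)%N.
have X1 (i : 'I_5) : ('X_i : T) \is 1.-homog by rewrite dhomogX /= mdeg1.
have Xh i e : ('X_i : T) ^+ e \is e.-homog by have := dhomogMn e (X1 i); rewrite mul1n.
have [Q1 [hQ1 eQ1]] : exists Q, Q \is (3 + m).-homog /\ u * f i1 ^+ m = Q.@[f].
  exists ('X_i1 ^+ m2 * R1); split.
    by have := dhomogM (Xh i1 m2) hR1; rewrite addnCA [(m2 + m1)%N]addnC.
  by rewrite mevalM rmorphXn /= mevalXU -eR1 /m exprD; ring.
have [Q2 [hQ2 eQ2]] : exists Q, Q \is (3 + m).-homog /\ u * f i2 ^+ m = Q.@[f].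
  exists ('X_i2 ^+ m1 * R2); split.
    by have := dhomogM (Xh i2 m1) hR2; rewrite addnCA.
  by rewrite mevalM rmorphXn /= mevalXU -eR2 /m exprD; ring.
pose D := 'X_i2 ^+ m * Q1 - 'X_i1 ^+ m * Q2.
have hD : D \is (m + (3 + m)).-homog by apply: rpredB; apply: dhomogM.
have D0 : D.@[f] = 0.
  by rewrite mevalB !mevalM !rmorphXn /= !mevalXU -eQ1 -eQ2; ring.
have [G eG] := sigma_rowsid (kernel_one_minor hD D0).
set K := (m + (3 + m))%N in hD eG.
pose Lc := sigma (rowform A c).
have hLc : Lc \is 1.-homog by apply/lsubst_homog/lin_homog.
pose H : T := (h ^+ (K + m))%:MP.
have sX i e : i \notin codom g -> sigma ('X_i ^+ e) = (h ^+ e)%:MP * 'X_i ^+ e.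
  by move=> ni; rewrite rmorphXn /= elim_cminorX // exprZn mul_mpolyC.
have eD : 'X_i2 ^+ m * (H * sigma Q1) - 'X_i1 ^+ m * (H * sigma Q2) =
    Lc * sigma (pihomog mdeg (m + (2 + m)) G).
  rewrite -lsubst_pihomog -(pihomogMl _ _ hLc) [in RHS]mulrC -eG.
  have hs : sigma ((h ^+ K)%:MP * D) \is (1 + (m + (2 + m))).-homog.
    rewrite mul_mpolyC; apply: lsubst_homog; apply: rpredZ.
    by have -> : (1 + (m + (2 + m)))%N = K by rewrite /K; lia.
  rewrite (pihomog_dE hs) mul_mpolyC lsubstZ -mul_mpolyC.
  rewrite rmorphB /= !rmorphM /= !sX // /H exprD mpolyCM; ring.
have le : (m + m <= (m + (2 + m)).+1)%N by lia.
have [G1 [G2 eG12]] := @elim_two_var S 5 3 A c g i1 i2 _ m m _ ne cov' le (pihomogP mdeg _ G).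
have e2 : (H * sigma Q1 - Lc * G2) * 'X_i2 ^+ m = (H * sigma Q2 + Lc * G1) * 'X_i1 ^+ m.
  by move: eD; rewrite eG12 => /eqP; rewrite subr_eq => /eqP eD;
     rewrite mulrBl mulrC eD; ring.
have [C eC] : exists C, H * sigma Q1 - Lc * G2 = C * 'X_i1 ^+ m.
  have ne' : i2 != i1 by rewrite eq_sym.
  exact: (rpairXX (mpolyX_neq0 _ _) (mpolyX_neq0 _ _) (rpair_mpolyX ne')) e2.
exists (K + m + (3 + m))%N, (pihomog mdeg 3 C); split; first exact: pihomogP.
have e3 : H * sigma Q1 = Lc * pihomog mdeg (2 + m) G2 + 'X_i1 ^+ m * pihomog mdeg 3 C.
  rewrite -(pihomogMl _ _ hLc) -(pihomogMl _ _ (Xh i1 m)) [(m + 3)%N]addnC.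
  rewrite -raddfD /= [_ * C]mulrC -eC addrCA subrr addr0.
  have hs : H * sigma Q1 \is (3 + m).-homog.
    by rewrite mul_mpolyC; apply/rpredZ/lsubst_homog.
  by rewrite pihomog_dE.
have mLc : Lc.@[f] = 0.
  have [r' hr' er'] := sigma_homog (lin_homog (row c A)).
  have -> : Lc = (h ^+ 1)%:MP * rowform A c - r' by rewrite /rowform er' addrK.
  by rewrite mevalB mevalM rowform_meval (rowid_meval hr') mulr0 subr0.
have mQ1 : (sigma Q1).@[f] = h ^+ (3 + m) * Q1.@[f].
  have [r' hr' er'] := sigma_homog hQ1.
  have -> : sigma Q1 = (h ^+ (3 + m))%:MP * Q1 - r' by rewrite er' addrK.
  by rewrite mevalB mevalM mevalC (rowid_meval hr') subr0.
have fm : f i1 ^+ m != 0 by rewrite expf_neq0.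
have := congr1 (meval f) e3; rewrite mevalD !mevalM mLc mul0r add0r mQ1 -eQ1 mevalC.
rewrite rmorphXn /= mevalXU => e4; apply: (mulIf fm).
by rewrite [RHS]mulrC -e4 exprD; ring.
Qed.

End OneMinor.
End MinorKernel.

(** * Relations and sections over an abstract coefficient ring *)

Lemma rmorph_cross0 (R U : pzRingType) (e : {rmorphism R -> U}) a b p q :
  e p = 0 -> e q = 0 -> e (a * p - b * q) = 0.
Proof. by move=> ep eq; rewrite rmorphB !rmorphM ep eq !mulr0 subr0. Qed.

Lemma rmorph_subM_eq (R : pzRingType) (e : {rmorphism R -> R}) q d D :
  e q = q -> e D = D -> e (q - d * D) = 0 -> q = e d * D.
Proof. by move=> eq eD; rewrite rmorphB rmorphM eq eD => /eqP; rewrite subr_eq0 => /eqP. Qed.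

Lemma mcoeff0_pihomog0 (R : comNzRingType) (n : nat) (p : {mpoly R[n]}) :
  (pihomog mdeg 0 p)@_0 = p@_0.
Proof.
rewrite {2}[p](pihomog_partitionE (leqnSn (msize p))) [RHS](raddf_sum (mcoeff 0)) /=.
rewrite (bigD1 ord0) //= big1 ?addr0 // => i ne.
by rewrite (dhomog_nemf_coeff (pihomogP _ _ _)) //= mdeg0 eq_sym.
Qed.

Lemma homog_const_factor (R : comNzRingType) (n e : nat) (p d D : {mpoly R[n]}) :
  p \is e.-homog -> D \is e.-homog -> p = d * D -> p = (d@_0)%:MP * D.
Proof.
move=> hp hD ep; rewrite -(mcoeff0_pihomog0 d) -(homog0_const (pihomogP mdeg 0 d)).
by rewrite mulrC -(pihomogMl _ _ hD) addn0 mulrC -ep pihomog_dE.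
Qed.

(** Here S is an abstract domain with elements X_0..X_3 and retractions [kl i] that set X_i to 0;
[linrows j m] has the first j + 1 rows of M with X_i = 0 for i >= m, so that [linrows 3 4]
is M. *)
Section PolynomialCore.
Variables (S : idomainType) (X : nat -> S) (kl : nat -> {rmorphism S -> S}).
Variables (c : nat -> nat -> 'rV[S]_5).
Local Notation T := {mpoly S[5]}.
Hypothesis X_neq0 : forall i, (i < 4)%N -> X i != 0.
Hypothesis klX : forall i, (i < 4)%N -> kl i (X i) = 0.
Hypothesis klX_neq : forall i j, (i < 4)%N -> (j < 4)%N -> i != j -> kl i (X j) = X j.
Hypothesis klc : forall i a b l, (i < 4)%N -> kl i (c a b 0 l) = c a b 0 l.
Hypothesis kl_mod : forall i p, (i < 4)%N -> exists q, p = kl i p + X i * q.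
Hypothesis klC : forall i j p, (i < 4)%N -> (j < 4)%N -> kl i (kl j p) = kl j (kl i p).

Definition linrows j m : 'M[S]_(j.+1, 5) := \matrix_(a, b) (\sum_(i < m) X i *: c a i) 0 b.

Hypothesis linrows_free : forall j m (v : 'rV[S]_j.+1), (j < 4)%N -> (0 < m <= 4)%N ->
  v *m linrows j m = 0 -> v = 0.
Hypothesis linrows_minor : forall j m, (j < 4)%N -> (m < 4)%N ->
  exists K, famid (fun u : 'I_j.+1 * {ffun 'I_j -> 'I_5} =>
    cminor (linrows j m.+1) u.1 u.2) (X m ^+ K).

Definition cx i : T := (X i)%:MP.
Definition cpi i : T -> T := map_mpoly (kl i).
HB.instance Definition _ i := GRing.RMorphism.copy (cpi i) (map_mpoly (kl i)).
Definition cN a i : T := lin (c a i).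

Lemma lform_rowform j m (a : 'I_j.+1) : lform cx cN m a = rowform (linrows j m) a.
Proof.
rewrite /rowform; have -> : row a (linrows j m) = \sum_(i < m) X i *: c a i by apply/rowP => b; rewrite !mxE.
rewrite lin_sum; apply: eq_bigr => i _.
by rewrite linZ -mul_mpolyC mulrC.
Qed.

Lemma lid_rowid j m p :
  lid cx cN j m p <-> rowid (linrows j m) (fun a => a != ord_max) p.
Proof.
have sum_lt (r : nat -> T) :
    \sum_(a < j.+1 | a != ord_max) r a * rowform (linrows j m) a =
    \sum_(a < j) r a * lform cx cN m a.
  under eq_bigr => a _ do rewrite -lform_rowform.
  rewrite big_mkcond big_ord_recr /= eqxx addr0; apply: eq_bigr => a _.
  by rewrite -val_eqE /= ltn_eqF.
split=> [[r ->]|[r ->]]; first by exists (fun a => r a); rewrite sum_lt.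
exists (fun a => r (inord a)); rewrite -(sum_lt (fun a => r (inord a))).
by apply: eq_bigr => a _; rewrite inord_val.
Qed.

(** This provides [local_regular] for the matrix M: the ideal of those u in S that bring p into the ideal of
the forms contains powers of the minors by [cminor_regular], hence a power of the last
variable. *)
Lemma core_local_regular j m p : (j <= m <= 4)%N -> (j < 4)%N -> (0 < m)%N ->
  lid cx cN j m (lform cx cN m j * p) -> exists K, lid cx cN j m (xlast cx m ^+ K.+1 * p).
Proof.
case: m => [|m] /andP[_ le] lt // _ /lid_rowid h.
pose P (u : S) := rowid (linrows j m.+1) (fun a => a != ord_max) (u%:MP * p).
have idP : idealP P.
  split; first by rewrite /P mpolyC0 mul0r; apply: rowid0.
    by move=> u v hu hv; rewrite /P mpolyCD mulrDl; apply: rowidD.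
  by move=> d u hu; rewrite /P mpolyCM -mulrA; apply: rowidM.
rewrite -[X in lform _ _ _ X]/(val (ord_max : 'I_j.+1)) lform_rowform in h.
have hmin (u : 'I_j.+1 * {ffun 'I_j -> 'I_5}) : radical P (cminor (linrows j m.+1) u.1 u.2).
  have fr (v : 'rV_j.+1) : v *m linrows j m.+1 = 0 -> v = 0 by apply: linrows_free.
  by have [K hK] := cminor_regular u.1 u.2 fr h; exists K.
have [K [r er]] := linrows_minor lt le.
have [L hL] : radical P (X m ^+ K).
  rewrite er; apply: (big_ind (radical P)).
  - by exists 1%N; rewrite expr1; case: idP.
  - by move=> a b; apply: radicalD.
  by move=> u _; apply: radicalM.
exists (K * L)%N; apply/lid_rowid; rewrite exprS -mulrA; apply: rowidM.
by move: hL; rewrite /P -exprM /xlast /cx rmorphXn.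
Qed.

Lemma cx_neq0 i : (i < 4)%N -> cx i != 0.
Proof. by move=> lt; rewrite mpolyC_eq0 X_neq0. Qed.

Lemma cpix i : (i < 4)%N -> cpi i (cx i) = 0.
Proof. by move=> lt; rewrite /cpi map_mpolyC /= klX // mpolyC0. Qed.

Lemma cpix_neq i j : (i < 4)%N -> (j < 4)%N -> i != j -> cpi i (cx j) = cx j.
Proof. by move=> hi hj ne; rewrite /cpi map_mpolyC /= klX_neq. Qed.

Lemma cpiN i a b : (i < 4)%N -> cpi i (cN a b) = cN a b.
Proof.
move=> lt; rewrite /cN /lin rmorph_sum; apply: eq_bigr => l _ /=.
by rewrite /cpi map_mpolyZ map_mpolyX /= klc.
Qed.

Lemma cpi_mod i p : (i < 4)%N -> exists q, p = cpi i p + cx i * q.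
Proof.
move=> lt; move: p; apply: mpoly_ind_ring.
- move=> d; have [q eq] := kl_mod d lt; exists q%:MP.
  by rewrite {1}eq mpolyCD mpolyCM /cpi map_mpolyC.
- by move=> j; exists 0; rewrite mulr0 addr0 /cpi map_mpolyX.
- move=> p q [a ea] [b eb]; exists (a + b).
  by rewrite rmorphD mulrDr {1}ea {1}eb addrACA.
move=> p q [a ea] [b eb]; exists (a * cpi i q + cpi i p * b + cx i * a * b).
by rewrite rmorphM {1}ea {1}eb; ring.
Qed.

Lemma cpiC i j p : (i < 4)%N -> (j < 4)%N -> cpi i (cpi j p) = cpi j (cpi i p).
Proof.
move=> hi hj; move: p.
apply: (@rmorph_mpoly_ext _ _ _ (cpi i \o cpi j)%FUN (cpi j \o cpi i)%FUN).
  by move=> d /=; rewrite /cpi !map_mpolyC /= klC.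
by move=> l /=; rewrite /cpi !map_mpolyX.
Qed.

Local Notation A := (linrows 3 4).
Local Notation f := (sminor A).
Hypothesis minor3 : forall i, (i < 4)%N ->
  exists K, famid (fun u : 'I_4 * {ffun 'I_3 -> 'I_5} => cminor A u.1 u.2) (X i ^+ K).
Hypothesis f_neq0 : forall i, f i != 0.
Hypothesis rpair_f : rpair (f ord0) (f ord_max).

Local Notation L := (lid cx cN 4 4).
Local Notation Delta := (ldet cN 4).
Local Notation eps := (eps cpi 4).

Let Afree (v : 'rV_4) : v *m A = 0 -> v = 0 := @linrows_free 3 4 v isT isT.
Let torsion := torsion_levelP cx_neq0 cpix cpix_neq cpiN cpi_mod core_local_regular (leqnn 4).
Let compatible := compatible_levelP cx_neq0 cpix cpix_neq cpiN cpi_mod cpiC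
  core_local_regular (leqnn 4).
Let Delta_neq0 : Delta != 0 :=
  ldet_neq0 cx_neq0 cpix cpix_neq cpiN cpi_mod core_local_regular (leqnn 4).

Lemma rowsid_lid p : rowsid A p <-> L p.
Proof.
have e (r : nat -> T) : \sum_(a < 4) r a * rowform A a = \sum_(a < 4) r a * lform cx cN 4 a.
  by apply: eq_bigr => a _; rewrite -lform_rowform.
split=> [[r ->]|[r ->]].
  exists (fun a => r (inord a)); apply: (etrans _ (e (fun a => r (inord a)))).
  by apply: eq_bigr => a _; rewrite inord_val.
by exists (fun a => r a); apply: (esym (e r)).
Qed.

Lemma lid_meval p : L p -> p.@[f] = 0.
Proof. by move/rowsid_lid/rowid_meval. Qed.

(** By [kernel_one_minor] and [minor3] a relation is x-torsion modulo the forms l_a. *)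
Lemma kernel_lid n q : q \is n.-homog -> q.@[f] = 0 -> exists d, L (q - d * Delta).
Proof.
move=> hq q0; have [I0 ID IM] := rowsid_idealP A.
pose P (u : S) := rowsid A (u%:MP * q).
have idP : idealP P.
  split; first by rewrite /P mpolyC0 mul0r.
    by move=> u v hu hv; rewrite /P mpolyCD mulrDl; apply: (ID).
  by move=> d u hu; rewrite /P mpolyCM -mulrA; apply: (IM).
have hmin (u : 'I_4 * {ffun 'I_3 -> 'I_5}) : radical P (cminor A u.1 u.2).
  have [h0|h0] := eqVneq (cminor A u.1 u.2) 0.
    by exists 1%N; rewrite expr1 h0; case: idP.
  by exists n; apply: kernel_one_minor.
have [K [r er]] := minor3 (isT : (3 < 4)%N).
have [M hM] : radical P (X 3 ^+ K).
  rewrite er; apply: (big_ind (radical P)).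
  - by exists 1%N; rewrite expr1; case: idP.
  - by move=> a b; apply: radicalD.
  by move=> u _; apply: radicalM.
apply: (torsion (K := (K * M)%N)); apply/rowsid_lid.
rewrite exprS -mulrA; apply: (IM).
by move: hM; rewrite /P -exprM /xlast /cx rmorphXn.
Qed.

Lemma sections_radical i s : (i < 4)%N ->
  (forall j, exists M m Q, Q \is (3 + m).-homog /\ X i ^+ M * s * f j ^+ m = Q.@[f]) ->
  exists K Q, Q \is 3.-homog /\ X i ^+ K * s = Q.@[f].
Proof.
move=> lt hs.
have [m hm] : exists m, forall j, exists m' Q, Q \is (3 + m').-homog /\
    X i ^+ m * s * f j ^+ m' = Q.@[f].
  have [mm hmm] := nat_choice 0%N (fun j (_ : (j < 5)%N) => hs (inord j)).
  exists (\sum_(j < 5) mm j)%N => j; have [m' [Q [hQ eQ]]] := hmm j (ltn_ord j).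
  rewrite inord_val in eQ; exists m', ((X i ^+ (\sum_(l < 5 | l != j) mm l)%N)%:MP * Q).
  split; first by rewrite mul_mpolyC rpredZ.
  by rewrite mevalM mevalC -eQ (bigD1 j) //= exprD; ring.
pose P (v : S) := exists Q, Q \is 3.-homog /\ v * (X i ^+ m * s) = Q.@[f].
have idP : idealP P.
  split; first by exists 0; rewrite rpred0 mul0r meval0.
    move=> u v [Q [hQ eQ]] [Q' [hQ' eQ']]; exists (Q + Q'); split; first exact: rpredD.
    by rewrite mulrDl eQ eQ' mevalD.
  move=> d u [Q [hQ eQ]]; exists (d%:MP * Q); split; first by rewrite mul_mpolyC rpredZ.
  by rewrite -mulrA eQ mevalM mevalC.
have hmin (u : 'I_4 * {ffun 'I_3 -> 'I_5}) : radical P (cminor A u.1 u.2).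
  have [h0|h0] := eqVneq (cminor A u.1 u.2) 0.
    by exists 1%N; rewrite expr1 h0; case: idP.
  by have [N [Q hQ]] := section_one_minor Afree f_neq0 rpair_f h0 hm; exists N, Q.
have [K [r er]] := minor3 lt.
have [N [Q [hQ eQ]]] : radical P (X i ^+ K).
  rewrite er; apply: (big_ind (radical P)).
  - by exists 1%N; rewrite expr1; case: idP.
  - by move=> a b; apply: radicalD.
  by move=> u _; apply: radicalM.
by exists (K * N + m)%N, Q; rewrite exprD -mulrA exprM.
Qed.

Lemma cN_homog a i : cN a i \is 1.-homog.
Proof. exact: lin_homog. Qed.

Lemma lform_homog a : lform cx cN 4 a \is 1.-homog.
Proof.
apply: rpred_sum => i _; rewrite mulrC mul_mpolyC; apply: rpredZ.
exact: lin_homog.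
Qed.

Lemma lid_pihomog d p : L p -> L (pihomog mdeg d p).
Proof.
move=> [r ->]; rewrite raddf_sum; apply: gen_sum => a _ /=.
case: d => [|d]; first by rewrite mulrC (pihomogMl0 _ (lform_homog a)) //; apply: gen0.
rewrite mulrC -[d.+1]add1n (pihomogMl _ _ (lform_homog a)) mulrC.
by apply: (gen_mem _ _ (ltn_ord a)).
Qed.

Lemma Delta_homog : Delta \is 4.-homog.
Proof. by apply: det_homog => i j; rewrite mxE cN_homog. Qed.

(** If every X_i b is a cubic form in f whose coefficients vanish at X = 0, then X_j Q_i - X_i Q_j
is a relation without determinant part, and the family Q is divisible by X. *)
Lemma compatible_section b (Q : nat -> T) :
  (forall i, (i < 4)%N -> [/\ Q i \is 3.-homog, eps (Q i) = 0 & (Q i).@[f] = X i * b]) ->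
  exists q, q \is 3.-homog /\ b = q.@[f].
Proof.
move=> hQ.
have [||q hq] := compatible (Q := Q).
- by move=> i /hQ[].
- move=> i j hi hj; have [h1 e1 m1] := hQ i hi; have [h2 e2 m2] := hQ j hj.
  have hh : cx j * Q i - cx i * Q j \is 3.-homog.
    by apply: rpredB; rewrite mul_mpolyC; apply: rpredZ.
  have h0 : (cx j * Q i - cx i * Q j).@[f] = 0.
    by rewrite mevalB !mevalM !mevalC m1 m2; ring.
  have [d hd] := kernel_lid hh h0.
  have e0 : eps (cx j * Q i - cx i * Q j) = 0.
    exact: rmorph_cross0 e1 e2.
  exact: (lid_of_eps0 cpix cpix_neq cpiN cpi_mod (leqnn 4) e0 hd).
exists (pihomog mdeg 3 q); split; first exact: pihomogP.
have [h1 e1 m1] := hQ 0%N isT; have := lid_pihomog 3 (hq 0%N isT).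
rewrite raddfB /= pihomog_dE // /cx mul_mpolyC linearZ /= => /lid_meval.
rewrite mevalB mevalZ m1 -mulrBr => /eqP; rewrite mulf_eq0 (negPf (X_neq0 _)) //=.
by rewrite subr_eq0 => /eqP.
Qed.

Lemma cpi_coef i p m : cpi i p = p -> kl i (p@_m) = p@_m.
Proof. by move/(congr1 (mcoeff m)); rewrite /cpi mcoeff_map_mpoly. Qed.

(** An element with constant coefficients is its own reduction modulo X, which kills the forms
l_a; only the multiple of Delta survives. *)
Lemma const_quartic q : q \is 4.-homog -> eps q = q -> q.@[f] = 0 ->
  exists2 d : S, forall i, (i < 4)%N -> kl i d = d & q = d%:MP * Delta.
Proof.
move=> hq eq q0; have [d hd] := kernel_lid hq q0.
have e : q = eps d * Delta.
  exact: rmorph_subM_eq eq (eps_ldet cpiN (leqnn 4)) (eps_lid cpix cpix_neq (leqnn 4) hd).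
exists ((eps d)@_0); last exact: homog_const_factor hq Delta_homog e.
by move=> i lt; apply: cpi_coef; apply: (pi_eps cpix cpi_mod cpiC _ lt (leqnn 4)).
Qed.

Lemma const_cubic q : q \is 3.-homog -> eps q = q -> q.@[f] = 0 -> q = 0.
Proof.
move=> hq eq q0; have [d /(lid_pihomog 3)] := kernel_lid hq q0.
rewrite raddfB /= pihomog_dE // mulrC (pihomogMl0 _ Delta_homog) // subr0.
by move/(eps_lid cpix cpix_neq (leqnn 4)); rewrite eq.
Qed.

Lemma lform_meval a : (a < 4)%N -> (lform cx cN 4 a).@[f] = 0.
Proof. by move=> lt; rewrite (lform_rowform 4 (Ordinal lt)) rowform_meval. Qed.

Definition Nmx : 'M[T]_4 := \matrix_(a < 4, i < 4) cN a i.

Lemma adjN_homog i a : \adj Nmx i a \is 3.-homog.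
Proof.
rewrite mxE /cofactor -signr_odd mulr_sign.
have h : \det (row' a (col' i Nmx)) \is 3.-homog.
  by apply: det_homog => u v; rewrite !mxE cN_homog.
by case: (odd _); rewrite ?rpredN.
Qed.

Lemma eps_cN a i : eps (cN a i) = cN a i.
Proof. exact: (eps_N cpiN _ _ (leqnn 4)). Qed.

Lemma eps_adjN i a : eps (\adj Nmx i a) = \adj Nmx i a.
Proof.
rewrite mxE /cofactor rmorphM rmorphXn rmorphN1 -det_map_mx; congr (_ * \det _).
by apply/matrixP => u v; rewrite !mxE eps_cN.
Qed.

Lemma cpi_const i d : kl i d = d -> cpi i d%:MP = d%:MP.
Proof. by move=> h; rewrite /cpi map_mpolyC /= h. Qed.

Lemma kl_eps d : (forall i, (i < 4)%N -> kl i d = d) -> eps d%:MP = d%:MP.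
Proof.
move=> h; apply: (@eps_fix _ _ 4 4) => // j lt.
by apply: cpi_const; apply: h.
Qed.

(** A section s has cubic multiples x_i s; the matrix N applied to them gives quartic
    relations, all of which are multiples of det N. *)
Lemma sections_adj s (q : 'I_4 -> T) :
  (forall i, [/\ q i \is 3.-homog, eps (q i) = q i & (q i).@[f] = X i * s]) ->
  exists2 d : 'I_4 -> S, forall a i, (i < 4)%N -> kl i (d a) = d a &
    forall i, q i = \sum_a \adj Nmx i a * (d a)%:MP.
Proof.
move=> hq.
have hN (a : nat) : (a < 4)%N -> exists d : S, (forall i, (i < 4)%N -> kl i d = d) /\
    \sum_(i < 4) cN a i * q i = d%:MP * Delta.
  move=> lt; have [|||d h1 h2] := @const_quartic (\sum_(i < 4) cN a i * q i); last by exists d.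
  - apply: rpred_sum => i _; case: (hq i) => h _ _.
    exact: (dhomogM (cN_homog a i) h).
  - apply: etrans (rmorph_sum _ _ _ _) _; apply: eq_bigr => i _; case: (hq i) => _ e _.
    by apply: etrans (rmorphM _ _ _) _; rewrite e eps_cN.
  rewrite (raddf_sum (meval f)); transitivity (s * (lform cx cN 4 a).@[f]).
    rewrite (raddf_sum (meval f)) mulr_sumr; apply: eq_bigr => i _ /=.
    by case: (hq i) => _ _ e; rewrite !mevalM e mevalC; ring.
  by rewrite lform_meval ?mulr0.
have [d hd] := nat_choice (0 : S) hN.
exists (fun a => d a) => [a i lt|i]; first by have [h _] := hd a (ltn_ord a); apply: h.
have e : Nmx *m (\col_i q i) = Delta *: (\col_a (d a)%:MP).
  apply/colP => a; rewrite !mxE mulrC.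
  have [_ <-] := hd a (ltn_ord a).
  by apply: eq_bigr => l _; rewrite !mxE.
have := congr1 (mulmx (\adj Nmx)) e; rewrite mulmxA mul_adj_mx mul_scalar_mx -scalemxAr.
move/colP/(_ i); rewrite !mxE => /(mulfI Delta_neq0) ->.
by apply: eq_bigr => a _; rewrite [X in _ * X = _]mxE.
Qed.

(** Rows of N(f) kill X, so by Cramer's rule the cofactors of each row are proportional to X;
as X_0, X_1 is a regular pair, X divides them. *)
Lemma adjN_sections : exists t : 'I_4 -> S, forall i a : 'I_4,
  (\adj Nmx i a).@[f] = X i * t a.
Proof.
pose B : 'M[S]_4 := map_mx (meval f) Nmx.
have BX (a : 'I_4) : \sum_(i < 4) B a i * X i = 0.
  transitivity ((lform cx cN 4 a).@[f]); last by rewrite lform_meval.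
  by rewrite (raddf_sum (meval f)); apply: eq_bigr => i _ /=; rewrite mevalM mevalC !mxE.
have cof (a i : 'I_4) : (\adj Nmx i a).@[f] = (-1) ^+ a * sminor (row' a B) i.
  rewrite mxE /cofactor mevalM rmorphXn rmorphN1 exprD -mulrA; congr (_ * (_ * _)).
  rewrite -det_map_mx; congr (\det _); by apply/matrixP => u v; rewrite !mxE.
(* The cofactors of a row are the signed minors of the other three rows. *)
have cross (a i j : 'I_4) : (\adj Nmx i a).@[f] * X j = (\adj Nmx j a).@[f] * X i.
  have hX u : \sum_(m < 4) row' a B u m * X m = 0.
    by rewrite -[RHS](BX (lift a u)); apply: eq_bigr => l _; rewrite mxE.
  have e := @sminor_cramer S 3 (row' a B) (fun l => X l) hX i j.
  by rewrite !cof -[LHS]mulrA e mulrA.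
have rX : rpair (X 1) (X 0).
  move=> u v e; have [w ew] := kl_mod u (isT : (0 < 4)%N); exists w.
  have := congr1 (kl 0) e; rewrite !rmorphM klX // klX_neq // mulr0 => /eqP.
  by rewrite mulf_eq0 (negPf (X_neq0 _)) // orbF => /eqP k0; rewrite ew k0 add0r mulrC.
have h (a : 'I_4) : exists t, (\adj Nmx (inord 0) a).@[f] = t * X 0.
  by apply: rX (\adj Nmx (inord 1) a).@[f] _; have := cross a (inord 0) (inord 1); rewrite !inordK.
have [t ht] := nat_choice (0 : S) (fun a (_ : (a < 4)%N) => h (inord a)).
exists (fun a => t a) => i a; apply: (mulIf (X_neq0 (isT : (0 < 4)%N))).
have := cross a i (inord 0); rewrite inordK // => ->.
by have := ht a (ltn_ord a); rewrite inord_val => ->; ring.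
Qed.

Lemma adjN_independent (d : 'I_4 -> S) : (forall a i, (i < 4)%N -> kl i (d a) = d a) ->
  (forall i, (\sum_a \adj Nmx i a * (d a)%:MP).@[f] = 0) -> forall a, d a = 0.
Proof.
move=> hd h a.
have z i : \sum_a \adj Nmx i a * (d a)%:MP = 0.
  apply: const_cubic => //.
    by apply: rpred_sum => b _; rewrite mulrC mul_mpolyC; apply/rpredZ/adjN_homog.
  apply: etrans (rmorph_sum _ _ _ _) _; apply: eq_bigr => b _.
  apply: etrans (rmorphM _ _ _) _; rewrite eps_adjN kl_eps // => l; exact: hd.
have e : \adj Nmx *m (\col_a (d a)%:MP) = 0.
  by apply/colP => i; rewrite !mxE -[RHS](z i); apply: eq_bigr => b _; rewrite [X in _ * X]mxE.
have := congr1 (mulmx Nmx) e; rewrite mulmxA mul_mx_adj mul_scalar_mx mulmx0.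
move/colP/(_ a)/eqP; rewrite !mxE mulf_eq0 (negPf Delta_neq0) mpolyC_eq0.
by move/eqP.
Qed.

End PolynomialCore.

(** * Degrees of the coefficients *)

Lemma eps_mpolyC (S : idomainType) (n : nat) (kl : nat -> {rmorphism S -> S}) m d :
  eps (cpi kl) m (d%:MP) = (eps kl m d)%:MP.
Proof. by elim: m d => //= m IHm d; rewrite -IHm /cpi map_mpolyC. Qed.

Lemma eps_mpolyX (S : idomainType) (kl : nat -> {rmorphism S -> S}) m (u : 'X_{1..5}) :
  eps (cpi kl) m 'X_[u] = 'X_[u].
Proof. by elim: m => //= m IHm; rewrite -[RHS]IHm /cpi map_mpolyX. Qed.

Lemma eps_mpolyZ (S : idomainType) (kl : nat -> {rmorphism S -> S}) m d (u : 'X_{1..5}) :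
  eps (cpi kl) m (d *: 'X_[u]) = eps kl m d *: 'X_[u].
Proof. by rewrite -!mul_mpolyC rmorphM eps_mpolyX eps_mpolyC. Qed.

Section CoefficientDegree.
Variables (k : closedFieldType).
Local Notation S := {mpoly k[4]}.
Local Notation T := {mpoly S[5]}.

Definition Xs i : S := 'X_(inord i).
Definition kls i : {rmorphism S -> S} := kill (inord i : 'I_4).

Lemma Xs_neq0 i : (i < 4)%N -> Xs i != 0. Proof. by move=> _; apply: mpolyX_neq0. Qed.

Lemma klsX i : (i < 4)%N -> kls i (Xs i) = 0.
Proof. by move=> _; rewrite /kls /Xs /= killX eqxx. Qed.

Lemma klsX_neq i j : (i < 4)%N -> (j < 4)%N -> i != j -> kls i (Xs j) = Xs j.
Proof.
move=> hi hj ne; rewrite /kls /Xs /= killX.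
by rewrite -val_eqE /= !inordK // eq_sym (negPf ne).
Qed.

Lemma kls_mod i p : (i < 4)%N -> exists q, p = kls i p + Xs i * q.
Proof. by move=> _; apply: kill_mod. Qed.

Lemma klsC i j p : (i < 4)%N -> (j < 4)%N -> kls i (kls j p) = kls j (kls i p).
Proof. by move=> _ _; apply: killK. Qed.

Lemma trunc4 (p : S) : trunc 4 p = p.
Proof.
have e : trunc_mx k 4 = 1%:M by apply/matrixP => i j; rewrite !mxE ltn_ord andbT.
by rewrite /trunc e lsubst1.
Qed.

(** The part of degree [d] of the coefficients. When the f_i have degree e, it selects the part
of total degree e n + d from Q(f), Q of degree n in y. *)
Definition cpart d (Q : T) : T := \sum_(m <- msupp Q) pihomog mdeg d Q@_m *: 'X_[m].

Lemma cpart_homog d n Q : Q \is n.-homog -> cpart d Q \is n.-homog.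
Proof.
move=> hQ; rewrite /cpart big_seq; apply: rpred_sum => m hm; apply: rpredZ.
by rewrite dhomogX /= (dhomog_mf hQ hm).
Qed.

Lemma mevalX_homog (F : 'I_5 -> S) e (m : 'X_{1..5}) : (forall i, F i \is e.-homog) ->
  ('X_[m]).@[F] \is (e * mdeg m).-homog.
Proof.
move=> hF; rewrite mpolyXE_id (rmorph_prod (meval F)) mdegE big_distrr /=.
apply: (big_rec2 (fun d p => p \is d.-homog)) => [|i d p _ hp]; first exact: dhomog1.
by rewrite rmorphXn /= mevalXU; apply: dhomogM => //; apply: dhomogMn.
Qed.

Lemma cpart_meval (F : 'I_5 -> S) e n d Q : (forall i, F i \is e.-homog) -> Q \is n.-homog ->
  (cpart d Q).@[F] = pihomog mdeg (e * n + d) (Q.@[F]).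
Proof.
move=> hF hQ; rewrite /cpart {3}[Q]mpolyE !(raddf_sum (meval F)) (raddf_sum (pihomog mdeg _)) /=.
rewrite !big_seq; apply: eq_bigr => m hm; rewrite !mevalZ [LHS]mulrC [Q@_m * _]mulrC.
have hX := mevalX_homog m hF; rewrite [mdeg m](dhomog_mf hQ hm) in hX.
by rewrite (pihomogMl _ _ hX).
Qed.

Local Notation epsS := (eps kls 4).

Lemma eps_kls_const p : exists d, epsS p = d%:MP.
Proof.
move: p; apply: mpoly_ind_ring.
- by move=> d; exists d; rewrite /= !killC.
- move=> i; exists 0; rewrite mpolyC0 /=.
  rewrite /kls /= !killX; case: (i =P inord 3) => [_|n3]; first by rewrite !rmorph0.
  rewrite killX; case: (i =P inord 2) => [_|n2]; first by rewrite !rmorph0.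
  rewrite killX; case: (i =P inord 1) => [_|n1]; first by rewrite !rmorph0.
  rewrite killX; case: (i =P inord 0) => [_|n0]; first by rewrite ?rmorph0.
  by case: i n3 n2 n1 n0 => [[|[|[|[|]]]] lt] n3 n2 n1 n0 //;
    exfalso; [apply: n0 | apply: n1 | apply: n2 | apply: n3];
    apply: val_inj; rewrite /= inordK.
- by move=> p q [a ea] [b eb]; exists (a + b); rewrite rmorphD ea eb mpolyCD.
by move=> p q [a ea] [b eb]; exists (a * b); rewrite rmorphM ea eb mpolyCM.
Qed.

Lemma kls_fixed_const d : (forall i, (i < 4)%N -> kls i d = d) -> d = (d@_0)%:MP.
Proof.
move=> h; have [a ea] := eps_kls_const d.
have e : epsS d = d by apply: (@eps_fix _ _ 4).
by rewrite -e ea mcoeffC eqxx mulr1.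
Qed.

Lemma eps_kls_pos n p : p \is n.+1.-homog -> epsS p = 0.
Proof.
move=> hp; have [a ea] := eps_kls_const p.
have : epsS p \is n.+1.-homog by do 4! apply: kill_homog.
rewrite ea => /(dhomog_nemf_coeff (m := 0%MM)); rewrite /= mdeg0 => /(_ isT).
by rewrite mcoeffC eqxx mulr1 => ->; rewrite mpolyC0.
Qed.

Lemma eps_cpart n Q : eps (cpi kls) 4 (cpart n.+1 Q) = 0.
Proof.
apply: etrans (rmorph_sum (eps (cpi kls) 4) _ _ _) _; apply: big1 => m _; apply: etrans (eps_mpolyZ _ _ _ _) _.
by rewrite (eps_kls_pos (pihomogP _ _ _)) scale0r.
Qed.

Lemma eps_cpart0 Q : eps (cpi kls) 4 (cpart 0 Q) = cpart 0 Q.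
Proof.
apply: etrans (rmorph_sum (eps (cpi kls) 4) _ _ _) _; apply: eq_bigr => m _.
apply: etrans (eps_mpolyZ _ _ _ _) _; congr (_ *: _).
rewrite (homog0_const (pihomogP mdeg 0 Q@_m)); apply: (@eps_fix _ _ 4) => // j _.
exact: killC.
Qed.

(** By the pigeonhole principle, a monomial of large degree has one large exponent. *)
Lemma irrelevant_power (J : S -> Prop) : idealP J ->
  (forall i : 'I_4, exists K, J ('X_i ^+ K)) ->
  exists E, forall e v, (E <= e)%N -> v \is e.-homog -> J v.
Proof.
move=> idJ hX; have [J0 JD JM] := idJ.
have [K hK] := nat_choice 0%N (fun i (_ : (i < 4)%N) => hX (inord i)).
exists (\sum_(i < 4) K i).+1 => e v le hv; rewrite [v]mpolyE big_seq.
apply: idealP_sum => // m hm; rewrite -mul_mpolyC; apply: (JM).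
have [i hi] : exists i : 'I_4, (K i <= m i)%N.
  apply/existsP; apply: contraLR le; rewrite negb_exists => /forallP h.
  rewrite -ltnNge ltnS -(dhomog_mf hv hm) /= mdegE; apply: leq_sum => i _.
  by rewrite ltnW // ltnNge h.
have le1 : (U_(i) *+ K i <= m)%MM.
  apply/mnm_lepP => l; rewrite mulmnE mnmE; case: eqP => [<-|_]; last by rewrite mul0n.
  by rewrite mul1n.
rewrite -(submK le1) mpolyXD; apply: (JM); rewrite -mpolyXn.
by have := hK i (ltn_ord i); rewrite inord_val.
Qed.

End CoefficientDegree.

(** * The space of sections in normal coordinates *)

(** The point [v0] lies on the coordinate axis of x_0, so it survives in all truncations; there
M has rank 4, which makes the rows of each truncation independent. *)
Section SectionsBasis.
Variables (k : closedFieldType) (M : 'M[{mpoly k[4]}]_(4, 5)).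
Local Notation S := {mpoly k[4]}.
Local Notation T := {mpoly S[5]}.
Local Notation Xs := (@Xs k).
Local Notation kls := (@kls k).
Hypothesis M1 : forall i j, M i j \is 1.-homog.
Hypothesis rankM : forall v : 'I_4 -> k, ~ (v =1 fun=> 0) ->
  (2 < \rank (map_mx (meval v) M))%N.
Variable v0 : 'I_4 -> k.
Hypothesis v0_line : forall i : 'I_4, (0 < i)%N -> v0 i = 0.
Hypothesis M_v0 : (sminor M ord_max).@[v0] != 0.
Hypothesis f_neq0M : forall i, sminor M i != 0.
Hypothesis rpair_fM : rpair (sminor M ord0) (sminor M ord_max).

Local Notation truncM m := (map_mx (@trunc k m) M).
Local Notation truncMj j m := (rowsub (@toprow j) (truncM m)).

Lemma trunc_meval m (p : S) : (0 < m)%N -> (trunc m p).@[v0] = p.@[v0].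
Proof.
move=> m0; rewrite lsubst_meval; apply: meval_eq => i.
rewrite (bigD1 i) //= big1 => [|l /negPf ne]; last by rewrite mxE eq_sym ne mul0r.
rewrite mxE eqxx addr0 /=; case: (ltnP i m) => hi; first by rewrite mul1r.
by rewrite v0_line ?mulr0 // (leq_trans m0 hi).
Qed.

Lemma truncM_free j m (v : 'rV[S]_j.+1) : (j < 4)%N -> (0 < m)%N ->
  v *m truncMj j m = 0 -> v = 0.
Proof.
move=> lt m0; rewrite -[truncM m]mul1mx -mul_rowsub_mx mulmxA.
set w := v *m _ => hw.
have w0 : w = 0.
  have hB : w *m col' ord_max (truncM m) = 0.
    apply/rowP => i; move/rowP/(_ (lift ord_max i)): hw; rewrite !mxE => h.
    by apply: etrans h; apply: eq_bigr => l _; rewrite [X in _ * X = _]mxE.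
  have dB : \det (col' ord_max (truncM m)) != 0.
    apply: contra M_v0 => /eqP e; rewrite -(trunc_meval _ m0) /sminor rmorphM.
    rewrite -det_map_mx; have -> : map_mx (trunc m) (col' ord_max M) = col' ord_max (truncM m).
      by apply/matrixP => a b; rewrite !mxE.
    by rewrite e mulr0 meval0.
  have := congr1 (mulmx^~ (\adj (col' ord_max (truncM m)))) hB.
  rewrite -mulmxA mul_mx_adj mul0mx mul_mx_scalar => /rowP h.
  apply/rowP => i; move: (h i); rewrite !mxE => /eqP.
  by rewrite mulf_eq0 (negPf dB) => /eqP.
apply/rowP => a; move/rowP/(_ (toprow a)): w0; rewrite !mxE (bigD1 a) //= big1.
  by rewrite !mxE eqxx addr0 mulr1.
move=> b ne; rewrite !mxE; case: eqP => [/(toprow_inj lt) e|_]; last by rewrite mulr0.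
by rewrite e eqxx in ne.
Qed.

Lemma linrows_trunc j m : (m <= 4)%N -> linrows Xs (mcoef M) j m = truncMj j m.
Proof.
move=> le; apply/row_matrixP => a; rewrite row_rowsub (trunc_M M1 _ le).
by apply/rowP => b; rewrite !mxE !summxE; apply: eq_bigr => i _; rewrite !mxE.
Qed.

Lemma linrows34 : linrows Xs (mcoef M) 3 4 = M.
Proof.
rewrite linrows_trunc //; apply/matrixP => a b; rewrite !mxE trunc4.
by rewrite /toprow inord_val.
Qed.

Lemma klsc i a b l : (i < 4)%N -> kls i (mcoef M a b 0 l) = mcoef M a b 0 l.
Proof. by move=> _; rewrite mxE /kls /= killC. Qed.

Lemma linrowsM_free j m (v : 'rV[S]_j.+1) : (j < 4)%N -> (0 < m <= 4)%N ->
  v *m linrows Xs (mcoef M) j m = 0 -> v = 0.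
Proof. by move=> lt /andP[m0 le]; rewrite linrows_trunc //; apply: truncM_free. Qed.

Lemma linrowsM_minor_at j m i : (j < 4)%N -> (m <= 4)%N -> (i < m)%N ->
  exists K, famid (fun u : 'I_j.+1 * {ffun 'I_j -> 'I_5} =>
    cminor (linrows Xs (mcoef M) j m) u.1 u.2) (Xs i ^+ K).
Proof.
move=> lt le lti; have [K [r er]] := topminor_irrelevant M1 rankM (inord i) lt.
exists K, (fun u => trunc m (r u)).
have eX : trunc m (Xs i) = Xs i.
  by rewrite truncX inordK ?lti // (leq_trans lti le).
rewrite -eX; apply: etrans (esym (rmorphXn (trunc m) K (Xs i))) _; rewrite /Xs er.
apply: etrans (rmorph_sum _ _ _ _) _; apply: eq_bigr => u _.
apply: etrans (rmorphM _ _ _) _; congr (_ * _).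
rewrite linrows_trunc // /topminor /cminor -det_map_mx; congr (\det _).
by apply/matrixP => a b; rewrite !mxE.
Qed.

Lemma linrowsM_minor j m : (j < 4)%N -> (m < 4)%N ->
  exists K, famid (fun u : 'I_j.+1 * {ffun 'I_j -> 'I_5} =>
    cminor (linrows Xs (mcoef M) j m.+1) u.1 u.2) (Xs m ^+ K).
Proof. by move=> lt lm; apply: linrowsM_minor_at. Qed.

Lemma M_minor3 i : (i < 4)%N ->
  exists K, famid (fun u : 'I_4 * {ffun 'I_3 -> 'I_5} =>
    cminor (linrows Xs (mcoef M) 3 4) u.1 u.2) (Xs i ^+ K).
Proof. by move=> lt; apply: linrowsM_minor_at. Qed.

Local Notation f := (sminor (linrows Xs (mcoef M) 3 4)).
Local Notation N := (Nmx (mcoef M)).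

Let f_neq0 i : f i != 0. Proof. by rewrite linrows34; apply: f_neq0M. Qed.
Let rpair_f : rpair (f ord0) (f ord_max).
Proof. by rewrite linrows34; apply: rpair_fM. Qed.
Let f4 i : f i \is 4.-homog.
Proof. by rewrite linrows34; apply: sminor_homog. Qed.

Definition deg3 (b : S) := exists Q, Q \is 3.-homog /\ b = Q.@[f].

Let compat b Q := @compatible_section S Xs kls (mcoef M) (@Xs_neq0 k) (@klsX k) (@klsX_neq k)
  klsc (@kls_mod k) (@klsC k) linrowsM_free linrowsM_minor
  M_minor3 f_neq0 rpair_f b Q.

Let srad i s := @sections_radical S Xs (mcoef M) linrowsM_free
  M_minor3 f_neq0 rpair_f i s.

Let sadj s q := @sections_adj S Xs kls (mcoef M) (@Xs_neq0 k) (@klsX k) (@klsX_neq k)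
  klsc (@kls_mod k) (@klsC k) linrowsM_free linrowsM_minor
  M_minor3 f_neq0 rpair_f s q.

Let indep d := @adjN_independent S Xs kls (mcoef M) (@Xs_neq0 k) (@klsX k) (@klsX_neq k)
  klsc (@kls_mod k) linrowsM_free linrowsM_minor
  M_minor3 f_neq0 rpair_f d.

(** In degree 12 + d the coefficients of a cubic form in f have degree d; those for x_i b have
positive degree, hence vanish at x = 0, as [compatible_section] demands. *)
Lemma deg3_descend b d : b \is (12 + d).-homog ->
  (forall i, (i < 4)%N -> deg3 (Xs i * b)) -> deg3 b.
Proof.
move=> hb h.
have h' i : (i < 4)%N -> exists Q, [/\ Q \is 3.-homog, eps (cpi kls) 4 Q = 0 & Q.@[f] = Xs i * b].
  move=> lt; have [Q [hQ eQ]] := h i lt; exists (cpart d.+1 Q).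
  split; [exact: cpart_homog | exact: eps_cpart |].
  rewrite (cpart_meval _ f4 hQ) -eQ.
  have hX : Xs i \is 1.-homog by rewrite dhomogX /= mdeg1.
  have hXb : Xs i * b \is (12 + d.+1).-homog by rewrite addnS; exact: (dhomogM hX hb).
  exact: pihomog_dE hXb.
have [Q hQ] := nat_choice (0 : T) h'.
exact: (compat hQ).
Qed.

Lemma deg3_idealP (s : S) : idealP (fun v => deg3 (v * s)).
Proof.
split.
- by exists 0; rewrite rpred0 mul0r meval0.
- move=> u v [Q [hQ eQ]] [Q' [hQ' eQ']]; exists (Q + Q'); split; first exact: rpredD.
  by rewrite mulrDl eQ eQ' mevalD.
move=> d u [Q [hQ eQ]]; exists (d%:MP * Q); split; first by rewrite mul_mpolyC; apply: rpredZ.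
by rewrite -mulrA eQ mevalM mevalC.
Qed.

(** Descending induction on the degree of v, from the degree where all forms lie in the ideal
of multipliers. *)
Lemma section_cubics s : s \is 11.-homog ->
  (forall i : 'I_4, exists K, deg3 ('X_i ^+ K * s)) ->
  forall v, v \is 1.-homog -> deg3 (v * s).
Proof.
move=> hs hK; have [E hE] := irrelevant_power (deg3_idealP s) hK.
suff h n : forall e v, (E <= e.+1 + n)%N -> v \is e.+1.-homog -> deg3 (v * s).
  by move=> v hv; apply: (h E 0%N) => //; rewrite leq_addl.
elim: n => [|n IHn] e v le hv; first by apply: hE hv; rewrite addn0 in le.
have hb : v * s \is (12 + e).-homog by have := dhomogM hv hs; rewrite addSnnS addnC.
apply: (deg3_descend hb) => i lt; rewrite mulrA; apply: (IHn e.+1).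
  by rewrite addSnnS.
have hX : Xs i \is 1.-homog by rewrite dhomogX /= mdeg1.
exact: (dhomogM hX hv).
Qed.

Lemma deg3_const b : b \is 12.-homog -> deg3 b ->
  exists Q, [/\ Q \is 3.-homog, eps (cpi kls) 4 Q = Q & Q.@[f] = b].
Proof.
move=> hb [Q [hQ eQ]]; exists (cpart 0 Q); split; [exact: cpart_homog | exact: eps_cpart0 |].
by rewrite (cpart_meval _ f4 hQ) -eQ pihomog_dE.
Qed.

Lemma cN_meval_homog a i : (cN (mcoef M) a i).@[f] \is 4.-homog.
Proof.
rewrite /cN lin_meval; apply: rpred_sum => l _.
have h d p : p \is 4.-homog -> d%:MP * p \is 4.-homog.
  by move=> hp; rewrite mul_mpolyC; apply: rpredZ.
rewrite [X in X * _]mxE; apply: h; exact: f4.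
Qed.

Theorem sections_basis : exists t : 'I_4 -> S, [/\
  forall a, t a \is 11.-homog,
  forall i a, deg3 ('X_i * t a),
  forall s, s \is 11.-homog ->
    (forall (i : 'I_4) j, exists K m Q, Q \is (3 + m).-homog /\
       'X_i ^+ K * s * f j ^+ m = Q.@[f]) ->
    exists c : 'I_4 -> k, s = \sum_a c a *: t a &
  forall c : 'I_4 -> k, \sum_a c a *: t a = 0 -> forall a, c a = 0].
Proof.
have [t ht] := @adjN_sections S Xs kls (mcoef M) (@Xs_neq0 k) (@klsX k) (@klsX_neq k) (@kls_mod k).
have eX (i : 'I_4) : Xs i = 'X_i by apply: (congr1 (fun l => 'X_l)); apply: inord_val.
have hX (i : 'I_4) : ('X_i : S) \is 1.-homog by rewrite dhomogX /= mdeg1.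
have h12 (i : 'I_4) a : 'X_i * t a \is 12.-homog.
  rewrite -eX -ht mxE /cofactor mevalM rmorphXn rmorphN1 -signr_odd mulr_sign -det_map_mx.
  set D := \det _; suff hD : D \is 12.-homog by case: (odd _); rewrite ?rpredN.
  apply: (@det_homogM _ _ 3 4) => u v; rewrite 4!mxE; exact: cN_meval_homog.
exists t; split.
- move=> a; have /pihomog_dE := h12 ord0 a; rewrite -[12%N]/(1 + 11)%N (pihomogMl _ _ (hX _)).
  by move/(mulfI (mpolyX_neq0 _ _)) => <-; apply: pihomogP.
- by move=> i a; exists (\adj N i a); split; [exact: adjN_homog | rewrite ht eX].
- move=> s hs h.
  have hK (i : 'I_4) : exists K, deg3 ('X_i ^+ K * s).
    have [|K [Q hQ]] := @srad i s (ltn_ord i); last by exists K, Q; rewrite -eX.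
    by move=> j; rewrite eX.
  have hc (i : nat) : (i < 4)%N -> exists Q, [/\ Q \is 3.-homog, eps (cpi kls) 4 Q = Q & Q.@[f] = Xs i * s].
    move=> lt; apply: deg3_const; first exact: (dhomogM (hX (inord i)) hs).
    by apply: section_cubics => //; apply: hX.
  have [q hq] := nat_choice (0 : T) hc.
  have [d hd eqd] := @sadj s (fun i : 'I_4 => q i) (fun i => hq i (ltn_ord i)).
  exists (fun a => (d a)@_0); apply: (mulfI (Xs_neq0 k (isT : (0 < 4)%N))).
  have [_ _ <-] := hq 0%N isT; rewrite (eqd ord0) (raddf_sum (meval f)) mulr_sumr.
  apply: eq_bigr => a _ /=; rewrite mevalM mevalC ht.
  by rewrite (kls_fixed_const (hd a)) mcoeffC eqxx mulr1 -mul_mpolyC; ring.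
move=> c e a.
have : (c a)%:MP = 0 :> S.
  apply: (@indep (fun a => (c a)%:MP)) => [b i _|i]; first exact: killC.
  transitivity (Xs i * \sum_a c a *: t a); last by rewrite e mulr0.
  rewrite (raddf_sum (meval f)) mulr_sumr.
  apply: eq_bigr => b _ /=; rewrite mevalM mevalC ht -mul_mpolyC; ring.
by move/eqP; rewrite mpolyC_eq0 => /eqP.
Qed.

End SectionsBasis.

(** * Sections on the blow-up *)

Lemma tofrac_common (R : idomainType) (a : {fraction R}) p q u v :
  p != 0 -> q != 0 -> rpair p q ->
  a * tofrac p = tofrac u -> a * tofrac q = tofrac v -> exists c, a = tofrac c.
Proof.
move=> p0 q0 rpq eu ev.
have e : v * p = u * q.
  by apply/eqP; rewrite -tofrac_eq !rmorphM /= -eu -ev mulrAC.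
have [c ec] := rpq _ _ e; exists c.
have q0' : tofrac q != 0 by rewrite tofrac_eq0.
by apply: (mulIf q0'); rewrite ev ec rmorphM.
Qed.

(** The substitution G passes from the coordinates of the normal form to those of I. *)
Section Transfer.
Variables (k : closedFieldType) (I : {pred {mpoly k[4]}}) (G : 'M[k]_4).
Local Notation S := {mpoly k[4]}.
Local Notation T := {mpoly S[5]}.
Variable F : 'I_5 -> S.
Hypothesis uG : G \in unitmx.
Hypothesis F4 : forall i, F i \is 4.-homog.
Hypothesis F_neq0 : forall i, F i != 0.
Hypothesis rpairF : rpair (F ord0) (F ord_max).
Hypothesis genF : forall p, lsubst G p \in I <-> exists a : 'I_5 -> S, p = \sum_j a j * F j.

Local Notation gam := (lsubst G).
Local Notation gaminv := (lsubst (invmx G)).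

Let gamK p : gam (gaminv p) = p.
Proof. by rewrite lsubst_comp mulVmx // lsubst1. Qed.
Let gaminvK p : gaminv (gam p) = p.
Proof. by rewrite lsubst_comp mulmxV // lsubst1. Qed.

Lemma gamF_mem j : gam (F j) \in I.
Proof.
apply/genF; exists (fun l => (l == j)%:R); rewrite (bigD1 j) //= eqxx mul1r big1 ?addr0 //.
by move=> l /negPf->; rewrite mul0r.
Qed.

Lemma gam_neq0 p : p != 0 -> gam p != 0.
Proof. by apply: contra => /eqP e; rewrite -[p]gaminvK e raddf0. Qed.

Lemma rpair_gam p q : rpair p q -> rpair (gam p) (gam q).
Proof.
move=> h a b e; have [c ec] : exists c, gaminv a = c * q.
  by apply: (h _ (gaminv b)); rewrite -[p]gaminvK -[q]gaminvK -!rmorphM e.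
by exists (gam c); rewrite -[a]gamK ec rmorphM.
Qed.

Lemma ideal_pow_forms n h : ideal_pow I n h ->
  exists q : T, q \is n.-homog /\ gaminv h = q.@[F].
Proof.
elim: n h => [|n IHn] h /=.
  by move=> _; exists (gaminv h)%:MP; rewrite mevalC; split=> //; rewrite -[_%:MP]mulr1 mul_mpolyC rpredZ ?dhomog1.
move=> [r [a [b [ha hb ->]]]].
pose P h := exists q : T, q \is n.+1.-homog /\ gaminv h = q.@[F].
apply: (big_ind P).
- by exists 0; rewrite rpred0 raddf0 meval0.
- move=> u v [q [hq eq]] [q' [hq' eq']]; exists (q + q'); split; first exact: rpredD.
  by rewrite raddfD /= eq eq' mevalD.
move=> i _; have [q [hq eq]] := IHn _ (hb i).
have [c ec] : exists c : 'I_5 -> S, gaminv (a i) = \sum_j c j * F j.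
  by apply/genF; rewrite gamK.
exists ((\sum_j (c j)%:MP * 'X_j) * q); split.
  have h1 : \sum_j (c j)%:MP * 'X_j \is 1.-homog.
    apply: rpred_sum => j _; rewrite mul_mpolyC.
    by apply: rpredZ; rewrite dhomogX /= mdeg1.
  exact: (dhomogM h1 hq).
rewrite rmorphM /= eq ec mevalM (raddf_sum (meval F)) /=; congr (_ * _).
by apply: eq_bigr => j _; rewrite mevalM mevalC mevalXU.
Qed.

Lemma forms_ideal_pow n (q : T) : q \is n.-homog -> ideal_pow I n (gam q.@[F]).
Proof.
elim: n q => [|n IHn] q hq //=; have [r hr ->] := homogS_split hq.
exists 5%N, (fun j => gam (F j)), (fun j => gam (r j).@[F]); split.
- exact: gamF_mem.
- by move=> j; apply: IHn.
rewrite (raddf_sum (meval F)) (raddf_sum gam); apply: eq_bigr => j _ /=.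
by rewrite mevalM mevalXU rmorphM.
Qed.

(** The charts of x_0, x_1 and of f_0, f_4 allow denominators that form regular pairs, so s is a
polynomial; its degree is read off one chart. For each f_j, the multipliers u with u s f_j^m
in the power of I form an ideal whose radical contains all linear forms. *)
Lemma blowup_polynomial s : blowup_section I 11 3 s -> exists p : S,
  [/\ p \is 11.-homog, s = tofrac (gam p) &
      forall (i : 'I_4) j, exists K m (Q : T), Q \is (3 + m).-homog /\
        'X_i ^+ K * p * F j ^+ m = Q.@[F]].
Proof.
move=> hs.
have chart (i : 'I_4) j : exists m h, [/\ h \is (11 + m * 5).-homog, ideal_pow I (3 + m) h &
    (s : {fraction S}) * tofrac (('X_i * gam (F j)) ^+ m) = tofrac h].
  have h4 : gam (F j) \is 4.-homog by apply: lsubst_homog.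
  exact: hs i 4 (gam (F j)) (gamF_mem j) (gam_neq0 (F_neq0 j)) h4.
(* The denominator x_i disappears by comparing the charts of x_0 and x_1. *)
have col j : exists m c, (s : {fraction S}) * tofrac (gam (F j) ^+ m) = tofrac c.
  have [m0 [h0 [_ _ e0]]] := chart (inord 0) j; have [m1 [h1 [_ _ e1]]] := chart (inord 1) j.
  exists (m0 + m1)%N.
  have ne : inord 0 != inord 1 :> 'I_4 by rewrite inord4_neq.
  apply: (@tofrac_common _ _ ('X_(inord 0) ^+ m0) ('X_(inord 1) ^+ m1)
     (h0 * gam (F j) ^+ m1) (h1 * gam (F j) ^+ m0)).
  - by rewrite expf_neq0 // mpolyX_neq0.
  - by rewrite expf_neq0 // mpolyX_neq0.
  - by apply: rpairXX; rewrite ?mpolyX_neq0 //; apply: rpair_mpolyX.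
  - by rewrite exprMn in e0; rewrite exprD !rmorphM /= -e0 rmorphM; ring.
  by rewrite exprMn in e1; rewrite exprD !rmorphM /= -e1 rmorphM; ring.
have [p0 ep0] : exists p0, (s : {fraction S}) = tofrac p0.
  have [m0 [c0 e0]] := col ord0; have [m1 [c1 e1]] := col ord_max.
  apply: tofrac_common e0 e1.
  - by rewrite expf_neq0 // gam_neq0.
  - by rewrite expf_neq0 // gam_neq0.
  by apply: rpairXX; rewrite ?gam_neq0 //; apply: rpair_gam.
have pchart (i : 'I_4) j : exists m h, [/\ h \is (11 + m * 5).-homog, ideal_pow I (3 + m) h &
    p0 * ('X_i * gam (F j)) ^+ m = h].
  have [m [h [h1 h2 h3]]] := chart i j; exists m, h; split=> //.
  by apply/eqP; rewrite -tofrac_eq rmorphM /= -h3 ep0.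
have hp0 : p0 \is 11.-homog.
  have [m [h [h1 _ h3]]] := pchart ord0 ord0.
  have hz : ('X_ord0 * gam (F ord0)) ^+ m \is (m * 5).-homog.
    have hX : ('X_ord0 : S) \is 1.-homog by rewrite dhomogX /= mdeg1.
    have : 'X_ord0 * gam (F ord0) \is 5.-homog.
      exact: (dhomogM hX (lsubst_homog G (F4 ord0))).
    by move/(dhomogMn m); rewrite mulnC.
  have z0 : ('X_ord0 * gam (F ord0)) ^+ m != 0.
    by rewrite expf_neq0 // mulf_neq0 ?mpolyX_neq0 ?gam_neq0.
  have : p0 = pihomog mdeg 11 p0; last by move->; apply: pihomogP.
  apply: (mulfI z0); rewrite -(pihomogMl _ _ hz) [_ * p0]mulrC h3 addnC.
  by rewrite pihomog_dE.
exists (gaminv p0); split; [exact: lsubst_homog | by rewrite gamK ep0 |].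
move=> i j; pose P (u : S) := exists m (Q : T), Q \is (3 + m).-homog /\
  u * gaminv p0 * F j ^+ m = Q.@[F].
have idP : idealP P.
  split.
  - by exists 0%N, 0; rewrite rpred0 !mul0r meval0.
  - move=> u v [m [Q [hQ eQ]]] [m' [Q' [hQ' eQ']]].
    have X1 e : ('X_j : T) ^+ e \is e.-homog.
      by have := dhomogMn e (_ : ('X_j : T) \is 1.-homog); rewrite mul1n; apply; rewrite dhomogX /= mdeg1.
    exists (m + m')%N, ('X_j ^+ m' * Q + 'X_j ^+ m * Q'); split.
      apply: rpredD; last by have := dhomogM (X1 m) hQ'; rewrite addnCA.
      by have := dhomogM (X1 m') hQ; rewrite addnCA [(m' + m)%N]addnC.
    by rewrite mevalD !mevalM !rmorphXn /= mevalXU -eQ -eQ' exprD; ring.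
  move=> d u [m [Q [hQ eQ]]]; exists m, (d%:MP * Q); split.
    by rewrite mul_mpolyC; apply: rpredZ.
  by rewrite mevalM mevalC -eQ !mulrA.
have rad l : radical P (gaminv 'X_l).
  have [m [h [_ h2 h3]]] := pchart l j; have [Q [hQ eQ]] := ideal_pow_forms h2.
  exists m, m, Q; split=> //.
  by rewrite -eQ -h3 rmorphM rmorphXn rmorphM /= gaminvK exprMn; ring.
have [K [m [Q [hQ eQ]]]] : radical P 'X_i; last by exists K, m, Q.
rewrite -['X_i]gaminvK lsubstX /lin (raddf_sum gaminv) /=.
apply: (big_ind (radical P)).
- by exists 1%N; rewrite expr1; case: idP.
- by move=> a b; apply: radicalD.
by move=> l _; rewrite lsubstZ -mul_mpolyC; apply: radicalM.
Qed.

Variable t : 'I_4 -> S.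
Hypothesis t11 : forall a, t a \is 11.-homog.
Hypothesis tX : forall i a, exists Q : T, Q \is 3.-homog /\ 'X_i * t a = Q.@[F].
Hypothesis t_span : forall s, s \is 11.-homog ->
  (forall (i : 'I_4) j, exists K m (Q : T), Q \is (3 + m).-homog /\
    'X_i ^+ K * s * F j ^+ m = Q.@[F]) -> exists c : 'I_4 -> k, s = \sum_a c a *: t a.
Hypothesis t_free : forall c : 'I_4 -> k, \sum_a c a *: t a = 0 -> forall a, c a = 0.

(** One factor x_i suffices as a denominator, since x_i s_a lies in the cube of I. *)
Lemma t_section a : blowup_section I 11 3 (tofrac (gam (t a))).
Proof.
move=> i d g gI g0 hg; exists 1%N, (g * ('X_i * gam (t a))); split.
- have -> : (11 + 1 * d.+1 = d + (1 + 11))%N by lia.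
  have hX : ('X_i : S) \is 1.-homog by rewrite dhomogX /= mdeg1.
  exact: (dhomogM hg (dhomogM hX (lsubst_homog G (t11 a)))).
- rewrite addn1; exists 1%N, (fun=> g), (fun=> 'X_i * gam (t a)); split=> //.
    move=> _; have [Q [hQ eQ]] : exists Q : T, Q \is 3.-homog /\ gaminv 'X_i * t a = Q.@[F].
      rewrite lsubstX /lin mulr_suml.
      pose P (u : S) := exists Q : T, Q \is 3.-homog /\ u = Q.@[F].
      apply: (big_ind P).
      - by exists 0; rewrite rpred0 meval0.
      - move=> u v [Q [hQ ->]] [Q' [hQ' ->]]; exists (Q + Q'); split; first exact: rpredD.
        by rewrite mevalD.
      move=> l _; have [Q [hQ eQ]] := tX l a; rewrite -scalerAl eQ.
      exists ((row i (invmx G) 0 l)%:MP%:MP * Q); split; first by rewrite mul_mpolyC; apply: rpredZ.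
      by rewrite mevalM mevalC mul_mpolyC.
    by have := forms_ideal_pow hQ; rewrite -eQ rmorphM /= gamK.
  by rewrite big_ord1.
by rewrite expr1 -rmorphM /=; congr tofrac; ring.
Qed.

Lemma tofrac_scale (c : k) (p : S) : c *: (tofrac (gam p) : ratfun k) = tofrac (gam (c *: p)).
Proof. by rewrite lsubstZ -mul_mpolyC rmorphM. Qed.

Theorem blowup_sections_dim : linear_system_dim I 11 3 3.
Proof.
exists (fun a => (tofrac (gam (t a)) : ratfun k)); split; first exact: t_section.
have comb (c : 'I_4 -> k) : \sum_a c a *: (tofrac (gam (t a)) : ratfun k) =
    tofrac (gam (\sum_a c a *: t a)).
  under eq_bigr => a _ do rewrite tofrac_scale.
  by rewrite (raddf_sum gam) (raddf_sum (@tofrac S)).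
move=> s hs; have [p [hp ep hQ]] := blowup_polynomial hs.
have [c ec] := t_span hp hQ; exists [ffun a => c a]; split.
  by under eq_bigr => a _ do rewrite ffunE; rewrite comb -ec ep subrr.
move=> c' /eqP; rewrite subr_eq0 comb ep tofrac_eq => /eqP e.
have e' : \sum_a (c a - c' a) *: t a = 0.
  under eq_bigr => a _ do rewrite scalerBl.
  by rewrite sumrB -ec -[p]gaminvK e gaminvK subrr.
apply/ffunP => a; rewrite ffunE; apply/eqP; rewrite -subr_eq0.
by apply/eqP; exact: t_free e' a.
Qed.

End Transfer.

(** * The dimension of the linear system *)

Section AcmCurve.
Variables (k : closedFieldType) (I : {pred {mpoly k[4]}}).
Local Notation S := {mpoly k[4]}.
Local Notation X0 := ('X_(inord 0) : S).
Local Notation X1 := ('X_(inord 1) : S).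
Local Notation X2 := ('X_(inord 2) : S).
Local Notation X3 := ('X_(inord 3) : S).

Lemma smooth_rank_pullback (G : 'M[k]_4) (M : 'M[S]_(4, 5)) : G \in unitmx ->
  (forall p, lsubst G p \in I <-> exists a : 'I_5 -> S, p = \sum_j a j * sminor M j) ->
  smooth_curve I -> forall v : 'I_4 -> k, ~ (v =1 fun=> 0) ->
  (2 < \rank (map_mx (meval v) M))%N.
Proof.
move=> uG genF smI v v0; pose M' := map_mx (lsubst G) M.
have gM j : lsubst G (sminor M j) = sminor M' j.
  rewrite /sminor rmorphM rmorphXn rmorphN1 -det_map_mx; congr (_ * \det _).
  by apply/matrixP => a b; rewrite !mxE.
have genI p : p \in I <-> exists a : 'I_5 -> S, p = \sum_j a j * sminor M' j.
  have -> : p = lsubst G (lsubst (invmx G) p) by rewrite lsubst_comp mulVmx // lsubst1.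
  split=> [/genF[a ->]|[a ea]].
    exists (fun j => lsubst G (a j)); rewrite (raddf_sum (lsubst G)).
    by apply: eq_bigr => j _; rewrite -gM /= rmorphM.
  apply/genF; exists (fun j => lsubst (invmx G) (a j)).
  rewrite -[LHS]lsubst1 -(mulmxV uG) -lsubst_comp ea (raddf_sum (lsubst _)).
  by apply: eq_bigr => j _; rewrite -gM /= rmorphM /= lsubst_comp mulmxV // lsubst1.
have [u eu] : exists u : 'rV[k]_4, u *m G^T = \row_i v i.
  by exists ((\row_i v i) *m (invmx G)^T); rewrite -mulmxA -trmx_mul mulmxV // trmx1 mulmx1.
have u0 : u != 0.
  apply/eqP => e; apply: v0 => i; move: eu; rewrite e mul0mx => /rowP/(_ i).
  by rewrite !mxE.
have -> : map_mx (meval v) M = map_mx (meval (fun j => u ord0 j)) M'; last first.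
  exact: (smooth_rank genI smI u0).
apply/matrixP => a b; rewrite !mxE /= lsubst_meval; apply: meval_eq => i.
move/rowP/(_ i): eu; rewrite !mxE => <-; apply: eq_bigr => j _.
by rewrite mxE mulrC.
Qed.

Lemma acm_curve_dim : hilb 10 11 I -> smooth_irreducible_acm I -> linear_system_dim I 11 3 3.
Proof.
move=> [hI _ [d0 hd0]] [prI smI acm].
have hJ := homogeneous_hidealP hI.
have pJ (p q : S) : p * q \in I -> p \in I \/ q \in I by move/prI/orP.
have hdim d : (d0 <= d)%N -> hcodim (fun p => p \in I) d (10 * d - 10).
  move=> le; have := dim_mod_hcodim hJ (hd0 d le).
  by have -> : (10 * d + 1 - 11 = 10 * d - 10)%N by lia.
have [G uG [hJ' n2 n3 J3 full4]] := lin_sop hJ pJ acm hdim.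
have X1h (i : 'I_4) : ('X_i : S) \is 1.-homog by rewrite dhomogX /= mdeg1.
have redC (c : k) : red c%:MP = c%:MP by rewrite /red !killC.
have r0 : red X0 = X0 by rewrite redX.
have r1 : red X1 = X1 by rewrite redX.
have r2 : red X2 = 0 by rewrite redX.
have r3 : red X3 = 0 by rewrite redX.
have [M [M1 redM redF genF rpF]] := @hilbert_burch_form k _ X0 X1 X2 X3 (@red k)
  (X1h _) (X1h _) (X1h _) (X1h _) (mpolyX_neq0 _ _) (mpolyX_neq0 _ _) (mpolyX_neq0 _ _)
  r0 r1 r2 r3 redC (@two_var_span k) (@rpair_forms k) hJ' n2 n3 J3 full4.
have rankM := smooth_rank_pullback uG genF smI.
have F_neq0 i : sminor M i != 0.
  apply/eqP => e; have := redF i; rewrite e rmorph0 => /esym/eqP.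
  by rewrite mulf_eq0 !expf_eq0 !(negPf (mpolyX_neq0 _ _)) !andbF.
pose v0 (i : 'I_4) : k := (i == inord 0)%:R.
have v0_line (i : 'I_4) : (0 < i)%N -> v0 i = 0.
  by move=> lt; rewrite /v0 -val_eqE /= inordK // gtn_eqF.
(* The last minor is x_0^4 modulo x_2, x_3. *)
have M_v0 : (sminor M ord_max).@[v0] != 0.
  have [q [r ->]] := red_mod (sminor M ord_max).
  rewrite redF /= expr0 mulr1 !mevalD [(X2 * q).@[_]]mevalM [(X3 * r).@[_]]mevalM.
  rewrite (rmorphXn (meval v0)) /= !mevalXU.
  by rewrite (v0_line (inord 2)) ?inordK // (v0_line (inord 3)) ?inordK // !mul0r !addr0 /v0 eqxx expr1n oner_neq0.
have [t [t11 tX t_span t_free]] := sections_basis M1 rankM v0_line M_v0 F_neq0 rpF.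
rewrite /deg3 (linrows34 M1) in tX; rewrite (linrows34 M1) in t_span.
exact: (@blowup_sections_dim k I G (sminor M) uG (sminor_homog M1) F_neq0 rpF genF t t11 tX
  t_span t_free).
Qed.

End AcmCurve.

Theorem lemma3p11 (k : closedFieldType) (char0 : [pchar k] =i pred0)
    (Z : {pred {mpoly k[4]}} -> Prop) (HZ : acm_component 10 11 Z) :
  general_element 10 11 Z (fun I_C => linear_system_dim I_C 11 3 3).
Proof.
have [[[Zhilb _ _] _] [A [closedA someA genA]]] := HZ.
exists A; split=> // I ZI nAI; apply: acm_curve_dim; first exact: Zhilb.
exact: genA.
Qed.
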